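(* Let $d\ge1$ and $\tfrac14<H\le\tfrac12$. Let $X:[0,1]\to\mathbb R^d$ be a process whose components are $d$ independent copies of a fractional Brownian motion with Hurst parameter $H$. For $n\ge1$ let $\tilde X^n:[0,1]\to\mathbb R^{2d}$ be the lead-lag path of $X$, $\mathbb A^n$ its L\'evy area, $\tilde{\mathbf X}^n=\exp(\tilde X^n+\mathbb A^n)$ its level-2 lift, and let $\tilde X=(X,X)$, $\mathbb A$ its canonical L\'evy area, $\tilde{\mathbf X}=\exp(\tilde X+\mathbb A)$, and $\tilde v^n$ the anti-symmetric $(2d)\times(2d)$ matrix, all as defined in the context. Then for all $\alpha\in[0,H)$ and $q\in[1,\infty)$, it holds that $T_{\tilde v^n}(\tilde{\mathbf X}^n)\to\tilde{\mathbf X}$ in $L^q$ and $\alpha$-H\''older topology as $n\to\infty$. More precisely, as $n\to\infty$, the random variable $$\sup_{0\le s<t\le1}\frac{|\tilde X^n_{s,t}-\tilde X_{s,t}|}{|t-s|^\alpha}+\sup_{0\le s<t\le1}\frac{|\mathbb A^n_{s,t}+(t-s)\tilde v^n-\mathbb A_{s,t}|}{|t-s|^{2\alpha}}$$ converges to $0$ in $L^q$.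
   Context: Fractional Brownian motion with Hurst parameter $H$ is the centred continuous Gaussian process with covariance $R(s,t)=\frac12(t^{2H}+s^{2H}-|t-s|^{2H})$. For a path $x$, $x_{s,t}=x_t-x_s$; $|\cdot|$ is a fixed norm on vectors and matrices. Lead-lag path: for $n\ge1$ write $X^n_i=X_{i/n}$. The path $\tilde X^n:[0,1]\to\mathbb R^{2d}$ is defined by $\tilde X^n_{2i/2n}=(X^n_i,X^n_i)$ for $i=0,\dots,n$ and $\tilde X^n_{(2i+1)/2n}=(X^n_i,X^n_{i+1})$ for $i=0,\dots,n-1$, and is linear on each of the intervals $[\frac{2i}{2n},\frac{2i+1}{2n}]$ and $[\frac{2i+1}{2n},\frac{2i+2}{2n}]$, $i=0,\dots,n-1$. L\'evy area: for a piecewise linear path $x$ in $\mathbb R^{2d}$ its L\'evy area over $[s,t]$ is the anti-symmetric $(2d)\times(2d)$ matrix with entries $\frac12\left(\int_s^tx^i_{s,r}\,dx^j_r-\int_s^tx^j_{s,r}\,dx^i_r\right)$. $\mathbb A^n_{s,t}$ is the L\'evy area of $\tilde X^n$ over $[s,t]$. $\mathbb A_{s,t}$ is the canonical L\'evy area of the Gaussian process $\tilde X=(X,X)$, which exists for $H>1/4$: it is the limit of the L\'evy areas of the piecewise linear interpolations of $\tilde X$ as the mesh tends to $0$. Renormalisation: $$v^n=\frac12\,\mathbb E\Big[\sum_{k=0}^{n-1}(X^n_{k+1}-X^n_k)\otimes(X^n_{k+1}-X^n_k)\Big]=\frac{n^{1-2H}}2I,\qquad \tilde v^n=\begin{pmatrix}0&v^n\\-v^n&0\end{pmatrix},$$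 with $I$ the $d\times d$ identity matrix. Level-2 lifts: $\exp$ is the exponential map from the step-2 free nilpotent Lie algebra over $\mathbb R^{2d}$ (vectors plus anti-symmetric matrices) to its group. For an anti-symmetric matrix $v$, $T_v$ adds $(t-s)v$ to the second level of a level-2 rough path, i.e. $T_v(\exp(x_{s,t}+a_{s,t}))=\exp(x_{s,t}+a_{s,t}+(t-s)v)$. *)

(* Defs.v *)
From HB Require Import structures.
From mathcomp Require Import all_boot all_order all_algebra.
From mathcomp Require Import all_classical all_reals all_analysis.
From mathcomp Require Import measurable_realfun.

Set Implicit Arguments.
Unset Strict Implicit.
Unset Printing Implicit Defensive.

Import Order.TTheory GRing.Theory Num.Theory.
Import numFieldNormedType.Exports.

Local Open Scope classical_set_scope.
Local Open Scope ring_scope.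

Section GaussianProcesses.
Context (R : realType) (disp : measure_display) (T : measurableType disp).
Variable P : probability T R.

(* [normal_prob m 0] is not the degenerate Gaussian law (it is a uniform law
   in the library), hence the separate Dirac case. *)
Definition gaussian_law (Y : T -> R) : Prop :=
  exists m s : R, forall B : set R, measurable B ->
    P (Y @^-1` B) = if s == 0 then \d_m B else normal_prob m s B.

(* Processes are indexed by the whole of R, but only times in [0, 1] matter. *)
Definition gaussian_process (B : R -> {RV P >-> R}) : Prop :=
  forall (k : nat) (t c : 'I_k -> R), (forall i, 0 <= t i <= 1) ->
    gaussian_law (fun w => \sum_(i < k) c i * B (t i) w).

Definition fbm_cov (H s t : R) : R :=
  2^-1 * (t `^ (2 * H) + s `^ (2 * H) - `|t - s| `^ (2 * H)).

Definition fbm (H : R) (B : R -> {RV P >-> R}) : Prop :=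
  [/\ forall w : T, {within `[0, 1], continuous (fun t => B t w)},
      gaussian_process B,
      forall t : R, 0 <= t <= 1 -> ('E_P[B t] = 0)%E &
      forall s t : R, 0 <= s <= 1 -> 0 <= t <= 1 ->
        covariance P (B s) (B t) = (fbm_cov H s t)%:E].

Definition process_sigma_algebra (B : R -> T -> R) : set (set T) :=
  <<s [set E | exists t S, [/\ 0 <= t <= 1, measurable S & E = B t @^-1` S]] >>.

(* Subfamilies are covered by taking some of the events [E i] to be [setT]. *)
Definition independent_processes (d : nat) (X : 'I_d -> R -> T -> R) : Prop :=
  forall E : 'I_d -> set T,
    (forall i, process_sigma_algebra (X i) (E i)) ->
    P (\bigcap_(i in [set: 'I_d]) E i) = (\prod_(i < d) P (E i))%E.

End GaussianProcesses.

Section Paths.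
Context (R : realType).

(* Interpolates linearly between the nodes (time, value) in [p :: s], which are
   listed by increasing time. *)
Fixpoint pl_interp (V : lmodType R) (p : R * V) (s : seq (R * V)) (u : R) : V :=
  if s is p' :: s' then
    if u <= p'.1 then p.2 + ((u - p.1) / (p'.1 - p.1)) *: (p'.2 - p.2)
    else pl_interp p' s' u
  else p.2.

(* As in [itv_partition 0 1 D], the partition of [0, 1] is [0 :: D]. *)
Definition pl_along (V : lmodType R) (D : seq R) (x : R -> V) : R -> V :=
  pl_interp (0, x 0) [seq (t, x t) | t <- D].

Definition mesh (D : seq R) : R :=
  \big[Num.max/0]_(l <- pairmap (fun a b => b - a) 0 D) l.

(* The node at time k / 2n is (X_i, X_i) if k = 2i, (X_i, X_(i+1)) if
   k = 2i + 1, where X_i = x (i / n). *)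
Definition lead_lag_node (d n : nat) (x : R -> 'rV[R]_d) (k : nat) :
    R * 'rV[R]_(d + d) :=
  (k%:R / (n.*2)%:R,
   row_mx (x (k./2%:R / n%:R)) (x ((uphalf k)%:R / n%:R))).

Definition lead_lag (d n : nat) (x : R -> 'rV[R]_d) : R -> 'rV[R]_(d + d) :=
  pl_interp (lead_lag_node n x 0)
            [seq lead_lag_node n x k | k <- iota 1 n.*2].

Definition diag_path (d : nat) (x : R -> 'rV[R]_d) : R -> 'rV[R]_(d + d) :=
  fun t => row_mx (x t) (x t).

Definition incr (V : zmodType) (x : R -> V) (s t : R) : V := x t - x s.

(* For a piecewise linear x, dx^j_r is (x^j)'(r) dr; the derivative takes junk
   values only at the finitely many kinks. *)
Definition path_integral (m : nat) (x : R -> 'rV[R]_m) (s t : R) (i j : 'I_m) :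
    R :=
  \int[lebesgue_measure]_(r in `[s, t])
    (incr x s r 0 i * derive1 (fun u => x u 0 j) r).

Definition levy_area (m : nat) (x : R -> 'rV[R]_m) (s t : R) : 'M[R]_m :=
  \matrix_(i, j) (2^-1 * (path_integral x s t i j - path_integral x s t j i)).

(* Both the step-2 free nilpotent Lie algebra and its group are embedded in the
   truncated tensor algebra R (+) R^m (+) (R^m (x) R^m), whose scalar component
   (0, resp. 1) is left out. *)
Definition exp2 (m : nat) (l : 'rV[R]_m * 'M[R]_m) : 'rV[R]_m * 'M[R]_m :=
  (l.1, l.2 + 2^-1 *: (l.1^T *m l.1)).

Definition log2 (m : nat) (g : 'rV[R]_m * 'M[R]_m) : 'rV[R]_m * 'M[R]_m :=
  (g.1, g.2 - 2^-1 *: (g.1^T *m g.1)).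

Definition lift2 (m : nat) (x : R -> 'rV[R]_m) (a : R -> R -> 'M[R]_m)
    (s t : R) : 'rV[R]_m * 'M[R]_m :=
  exp2 (incr x s t, a s t).

Definition translate (m : nat) (v : 'M[R]_m) (g : R -> R -> 'rV[R]_m * 'M[R]_m)
    (s t : R) : 'rV[R]_m * 'M[R]_m :=
  ((g s t).1, (g s t).2 + (t - s) *: v).

Lemma translate_lift2 (m : nat) (v : 'M[R]_m) x a s t :
  translate v (lift2 x a) s t = exp2 (incr x s t, a s t + (t - s) *: v).
Proof. by rewrite /translate /lift2 /exp2 /= addrAC. Qed.

Definition is_norm (V : lmodType R) (N : V -> R) : Prop :=
  [/\ forall x, N x = 0 -> x = 0,
      forall a x, N (a *: x) = `|a| * N x &
      forall x y, N (x + y) <= N x + N y].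

Definition holder_sup (V : Type) (N : V -> R) (b : R) (f : R -> R -> V) :
    \bar R :=
  ereal_sup [set e | exists s t : R,
    [/\ 0 <= s, s < t, t <= 1 & e = (N (f s t) / (t - s) `^ b)%:E]].

(* Distance in logarithmic coordinates, inducing the alpha-Hoelder rough path
   topology. *)
Definition rp_holder_dist (m : nat) (Nv : 'rV[R]_m -> R) (Nm : 'M[R]_m -> R)
    (alpha : R) (g h : R -> R -> 'rV[R]_m * 'M[R]_m) : \bar R :=
  (holder_sup Nv alpha (fun s t => ((log2 (g s t)).1 - (log2 (h s t)).1)%R)
   + holder_sup Nm (2 * alpha)%R
       (fun s t => ((log2 (g s t)).2 - (log2 (h s t)).2)%R))%E.

End Paths.

Section RandomPaths.
Context (R : realType) (disp : measure_display) (T : measurableType disp).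
Variable P : probability T R.

Definition vec_path (d : nat) (X : 'I_d -> R -> T -> R) (w : T) (t : R) :
    'rV[R]_d :=
  \row_(i < d) X i t w.

(* A is the continuous version of the limit in probability of the Levy areas of
   the piecewise linear interpolations of Y, along any partitions of [0, 1]
   with vanishing mesh; this determines A up to indistinguishability. *)
Definition canonical_levy_area (m : nat) (Y : T -> R -> 'rV[R]_m)
    (A : T -> R -> R -> 'M[R]_m) : Prop :=
  [/\ forall (s t : R) i j, 0 <= s -> s <= t -> t <= 1 ->
        measurable_fun [set: T] (fun w => A w s t i j),
      forall (w : T) i j,
        {within [set st : R * R | 0 <= st.1 /\ st.1 <= st.2 /\ st.2 <= 1],
          continuous (fun st : R * R => A w st.1 st.2 i j)} &
      forall D : nat -> seq R,
        (forall k, itv_partition 0 1 (D k)) ->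
        mesh (D k) @[k --> \oo] --> (0 : R) ->
        forall (s t : R) i j (eps : R), 0 <= s -> s <= t -> t <= 1 -> 0 < eps ->
          P [set w | eps <=
               `|levy_area (pl_along (D k) (Y w)) s t i j - A w s t i j|]
            @[k --> \oo] --> 0%E].

Definition renorm (d n : nat) (X : T -> R -> 'rV[R]_d) : 'M[R]_d :=
  \matrix_(i, j) (2^-1 * fine ('E_P[fun w => (\sum_(k < n)
    incr (X w) (k%:R / n%:R) (k.+1%:R / n%:R) 0 i *
    incr (X w) (k%:R / n%:R) (k.+1%:R / n%:R) 0 j)%R])%E).

Definition lead_lag_renorm (d n : nat) (X : T -> R -> 'rV[R]_d) :
    'M[R]_(d + d) :=
  block_mx 0 (renorm n X) (- renorm n X) 0.

Definition cvg0_Lq (q : R) (Z : nat -> T -> \bar R) : Prop :=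
  (forall n, measurable_fun [set: T] (Z n)) /\
  (('N[P]_(q%:E) [Z n])%E @[n --> \oo] --> 0%E).

End RandomPaths.

(* Main.v *)
Require Import Defs.
From HB Require Import structures.
From mathcomp Require Import all_boot all_order all_algebra.
From mathcomp Require Import all_classical all_reals all_analysis.
From mathcomp Require Import measurable_realfun.
From mathcomp Require Import ring lra zify.
Import Order.TTheory GRing.Theory Num.Theory.
Import numFieldNormedType.Exports.
Set Implicit Arguments.
Unset Strict Implicit.
Local Open Scope classical_set_scope.
Local Open Scope ring_scope.

Section Moments.
Context {R : realType} {disp : measure_display} {T : measurableType disp}.
Variable P : probability T R.
Implicit Types f g : T -> R.

Definition all_moments f :=
  measurable_fun [set: T] f /\
  forall k, P.-integrable [set: T] (EFin \o (fun w => `|f w| ^+ k)).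

Definition ex f : R := \int[P]_(w in [set: T]) f w.

Lemma eq_all_moments f g : f =1 g -> all_moments f -> all_moments g.
Proof. by move=> /funext ->. Qed.

Lemma all_moments_measurable f : all_moments f -> measurable_fun [set: T] f.
Proof. by case. Qed.

Lemma all_moments_le f : measurable_fun [set: T] f ->
  (forall k, exists2 h, P.-integrable [set: T] (EFin \o h) &
    forall w, `|f w| ^+ k <= h w) -> all_moments f.
Proof.
move=> mf H; split=> // k; have [h ih fh] := H k.
apply: le_integrable ih => //.
  by apply/measurable_EFinP; apply: measurable_funX; exact: measurableT_comp.
move=> w _ /=; rewrite lee_fin normrX normr_id.
by apply: le_trans (fh w) _; rewrite ler_norm.
Qed.

Lemma all_moments_integrable f : all_moments f ->
  P.-integrable [set: T] (EFin \o f).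
Proof.
move=> [mf /(_ 1%N)] i1; apply: le_integrable i1 => //.
  exact/measurable_EFinP.
by move=> w _ /=; rewrite lee_fin expr1 normr_id.
Qed.

Lemma all_moments_cst c : all_moments (fun=> c).
Proof.
split=> [|k]; first exact: measurable_cst.
exact: finite_measure_integrable_cst.
Qed.

Lemma all_moments_exp f n : all_moments f -> all_moments (fun w => f w ^+ n).
Proof.
move=> [mf i]; split=> [|k]; first exact: measurable_funX.
by under eq_fun do rewrite normrX -exprM; exact: i.
Qed.

Lemma normrXD_le (x y : R) k :
  `|x + y| ^+ k <= 2 ^+ k * (`|x| ^+ k + `|y| ^+ k).
Proof.
apply: (@le_trans _ _ ((2 * Num.max `|x| `|y|) ^+ k)).
  rewrite lerXn2r ?nnegrE// ?mulr_ge0// ?le_max ?normr_ge0//.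
  apply: le_trans (ler_normD _ _) _.
  rewrite mulr_natl mulr2n lerD// le_max lexx ?orbT//.
rewrite exprMn ler_pM2l ?exprn_gt0//.
by case: (leP `|x| `|y|) => _; rewrite ?lerDl ?lerDr exprn_ge0.
Qed.

Lemma all_momentsD f g :
  all_moments f -> all_moments g -> all_moments (fun w => f w + g w).
Proof.
move=> [mf fi] [mg gi]; apply: all_moments_le.
  exact: measurable_funD.
move=> k; exists (fun w => 2 ^+ k * (`|f w| ^+ k + `|g w| ^+ k)).
  exact: (integrableZl measurableT (2 ^+ k)
    (integrableD measurableT (fi k) (gi k))).
by move=> w; exact: normrXD_le.
Qed.

Lemma all_momentsM f g :
  all_moments f -> all_moments g -> all_moments (fun w => f w * g w).
Proof.
move=> [mf fi] [mg gi]; apply: all_moments_le.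
  exact: measurable_funM.
move=> k; exists (fun w => `|f w| ^+ (2 * k) + `|g w| ^+ (2 * k)).
  exact: (integrableD measurableT (fi (2 * k)%N) (gi (2 * k)%N)).
move=> w; rewrite normrM exprMn ![(2 * k)%N]mulnC !exprM.
set a := _ ^+ k; set b := _ ^+ k.
have := sqr_ge0 (a - b); have := sqr_ge0 a; have := sqr_ge0 b.
by rewrite sqrrB; lra.
Qed.

Lemma all_momentsZ c f : all_moments f -> all_moments (fun w => c * f w).
Proof. by apply: all_momentsM; exact: all_moments_cst. Qed.

Lemma all_momentsN f : all_moments f -> all_moments (fun w => - f w).
Proof.
move=> mf; rewrite (_ : (fun w => - f w) = (fun w => -1 * f w)).
  exact: all_momentsZ.
by apply/funext => w; rewrite mulNr mul1r.
Qed.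

Lemma all_momentsB f g :
  all_moments f -> all_moments g -> all_moments (fun w => f w - g w).
Proof. by move=> mf mg; apply: all_momentsD => //; exact: all_momentsN. Qed.

Lemma all_moments_sum I (s : seq I) (p : pred I) (F : I -> T -> R) :
  (forall i, p i -> all_moments (F i)) ->
  all_moments (fun w => \sum_(i <- s | p i) F i w).
Proof.
move=> mF; elim: s => [|i s ih].
  apply: (eq_all_moments _ (all_moments_cst 0)) => w.
  by rewrite big_nil.
case: (boolP (p i)) => pi.
  apply: (eq_all_moments _ (all_momentsD (mF i pi) ih)) => w.
  by rewrite big_cons pi.
by apply: (eq_all_moments _ ih) => w; rewrite big_cons (negbTE pi).
Qed.

Lemma all_moments_prod I (s : seq I) (p : pred I) (F : I -> T -> R) :
  (forall i, p i -> all_moments (F i)) ->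
  all_moments (fun w => \prod_(i <- s | p i) F i w).
Proof.
move=> mF; elim: s => [|i s ih].
  apply: (eq_all_moments _ (all_moments_cst 1)) => w.
  by rewrite big_nil.
case: (boolP (p i)) => pi.
  apply: (eq_all_moments _ (all_momentsM (mF i pi) ih)) => w.
  by rewrite big_cons pi.
by apply: (eq_all_moments _ ih) => w; rewrite big_cons (negbTE pi).
Qed.

Lemma eq_ex f g : f =1 g -> ex f = ex g.
Proof. by move=> fg; congr (ex _); exact/funext. Qed.

Lemma exD f g : all_moments f -> all_moments g ->
  ex (fun w => f w + g w) = ex f + ex g.
Proof. by move=> mf mg; apply: RintegralD => //; exact: all_moments_integrable. Qed.

Lemma exZ c f : all_moments f -> ex (fun w => c * f w) = c * ex f.
Proof. by move=> mf; apply: RintegralZl => //; exact: all_moments_integrable. Qed.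

Lemma exB f g : all_moments f -> all_moments g ->
  ex (fun w => f w - g w) = ex f - ex g.
Proof. by move=> mf mg; apply: RintegralB => //; exact: all_moments_integrable. Qed.

Lemma ex_cst c : ex (fun=> c) = c.
Proof.
rewrite /ex Rintegral_cst// [X in fine X](_ : _ = 1%E) ?mulr1//.
exact: probability_setT.
Qed.

Lemma ex_sum I (s : seq I) (p : pred I) (F : I -> T -> R) :
  (forall i, p i -> all_moments (F i)) ->
  ex (fun w => \sum_(i <- s | p i) F i w) = \sum_(i <- s | p i) ex (F i).
Proof.
move=> mF; elim: s => [|i s ih].
  by rewrite big_nil -[RHS](ex_cst 0); apply: eq_ex => w; rewrite big_nil.
rewrite big_cons (eq_ex (fun w => big_cons _ _ _ _ _ _)).
case: ifP => // pi; rewrite exD ?ih//; first exact: mF.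
exact: all_moments_sum.
Qed.

Lemma ex_ge0 f : (forall w, 0 <= f w) -> 0 <= ex f.
Proof. by move=> f0; apply: Rintegral_ge0. Qed.

Lemma le_ex f g : all_moments f -> all_moments g -> (forall w, f w <= g w) ->
  ex f <= ex g.
Proof.
by move=> mf mg fg; apply: le_Rintegral => //; exact: all_moments_integrable.
Qed.

Lemma integral_ex f : all_moments f -> (\int[P]_w (f w)%:E = (ex f)%:E)%E.
Proof.
move=> mf; rewrite /ex /Rintegral fineK//.
exact: integrable_fin_num (all_moments_integrable mf).
Qed.

End Moments.

Section Density.
Local Open Scope ereal_scope.
Context {R : realType} {disp : measure_display} {T : measurableType disp}.
Variables (mu nu : {measure set T -> \bar R}) (p : T -> R).
Hypothesis mp : measurable_fun [set: T] p.
Hypothesis p0 : forall x, (0 <= p x)%R.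
Hypothesis nuE : forall A, measurable A -> nu A = \int[mu]_(x in A) (p x)%:E.

Import HBNNSimple.

Lemma nnsfun_integral_density (f : {nnsfun T >-> R}) :
  \int[nu]_x (f x)%:E = \int[mu]_x ((f x)%:E * (p x)%:E).
Proof.
under [LHS]eq_integral do rewrite fimfunE -fsumEFin//.
rewrite [LHS]ge0_integral_fsum//; last 2 first.
- by move=> r; exact/measurable_EFinP/measurableT_comp.
- by move=> n x _; rewrite EFinM nnfun_muleindic_ge0.
have h0 r x : 0 <= (r * \1_(f @^-1` [set r]) x)%:E * (p x)%:E.
  by apply: mule_ge0; [rewrite EFinM nnfun_muleindic_ge0|rewrite lee_fin].
have fE x : (f x)%:E * (p x)%:E =
    \sum_(r \in range f) ((r * \1_(f @^-1` [set r]) x)%:E * (p x)%:E).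
  rewrite {1}fimfunE -fsumEFin// muleC ge0_mule_fsumr; last first.
    by move=> r; rewrite EFinM nnfun_muleindic_ge0.
  by apply: eq_fsbigr => r _; rewrite muleC.
under [RHS]eq_integral do rewrite fE.
rewrite [RHS]ge0_integral_fsum//; last first.
  by move=> r; apply: emeasurable_funM; apply/measurable_EFinP => //;
     exact: measurableT_comp.
apply: eq_fsbigr => r _; rewrite integralZl_indic_nnsfun//=.
rewrite integral_indic// setIT nuE//.
rewrite integral_mkcond; have [r0|r0] := leP 0%R r; last first.
  rewrite [f @^-1` _]preimage_nnfun0//.
  under eq_integral do rewrite patchE in_set0.
  under [RHS]eq_integral do rewrite indicE in_set0 mulr0 mul0e.
  by rewrite integral0 mule0.
rewrite -ge0_integralZl//.
- apply: eq_integral => x _; rewrite patchE indicE.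
  by case: ifP => _; rewrite ?mulr1// mule0 mulr0 mul0e.
- apply/(measurable_restrictT _ _).1 => //.
  by apply/measurable_EFinP/measurable_funTS.
- by move=> x _; rewrite patchE; case: ifP; rewrite ?lee_fin.
Qed.

Lemma ge0_integral_density (f : T -> \bar R) :
  measurable_fun [set: T] f -> (forall x, 0 <= f x) ->
  \int[nu]_x f x = \int[mu]_x (f x * (p x)%:E).
Proof.
move=> mf f0; pose f_ := nnsfun_approx measurableT mf.
have ndf n m x : (n <= m)%N -> ((f_ n x)%:E <= (f_ m x)%:E).
  by move=> nm; rewrite lee_fin; exact/lefP/nd_nnsfun_approx.
have mfp n : measurable_fun [set: T] (fun x => (f_ n x)%:E * (p x)%:E).
  by apply: emeasurable_funM; apply/measurable_EFinP.
transitivity (lim (\int[nu]_x (f_ n x)%:E @[n --> \oo])).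
  rewrite -monotone_convergence//=.
  - apply: eq_integral => ? /[!inE] xD; apply/esym/cvg_lim => //=.
    exact: cvg_nnsfun_approx.
  - by move=> n; exact/measurable_EFinP/measurable_funTS.
  - by move=> n ? _; rewrite lee_fin.
  - by move=> x _ n m nm; exact: ndf.
transitivity (lim (\int[mu]_x ((f_ n x)%:E * (p x)%:E) @[n --> \oo])).
  by apply: congr_lim; apply/funext => n /=; exact: nnsfun_integral_density.
rewrite -monotone_convergence//=.
- apply: eq_integral => x /[!inE] xD; apply/cvg_lim => //=.
  apply: cvgeZr => //; exact: cvg_nnsfun_approx.
- by move=> n x _; rewrite mule_ge0 ?lee_fin.
- by move=> x _ n m nm; rewrite lee_wpmul2r ?lee_fin//; exact: ndf.
Qed.

Lemma integral_density (f : T -> \bar R) : measurable_fun [set: T] f ->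
  \int[nu]_x f x = \int[mu]_x (f x * (p x)%:E).
Proof.
move=> mf; rewrite integralE [RHS]integralE.
rewrite !ge0_integral_density//; [|exact: measurable_funeneg|exact: measurable_funepos].
congr (_ - _); apply: eq_integral => x _.
- rewrite !funeposE; have [fx0|fx0] := leP (f x) 0.
    rewrite mul0e max_r// -oppe_ge0 -mulNe mule_ge0 ?lee_fin//.
    by rewrite oppe_ge0.
  by rewrite max_l// mule_ge0 ?lee_fin// ltW.
- rewrite !funenegE; have [fx0|fx0] := leP (f x) 0.
    rewrite (@max_l _ _ (- f x) 0) ?oppe_ge0// mulNe max_l// -mulNe mule_ge0 ?lee_fin//.
    by rewrite oppe_ge0.
  rewrite (@max_r _ _ (- f x) 0) ?oppe_le0 ?ltW// mul0e max_r// oppe_le0 mule_ge0 ?lee_fin//.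
  exact: ltW.
Qed.

End Density.

Fixpoint gaussian_moment (k : nat) : nat :=
  match k with 0 => 1 | 1 => 0 | k'.+2 => k'.+1 * gaussian_moment k' end%N.

Lemma gaussian_moment_odd k : odd k -> gaussian_moment k = 0%N.
Proof.
suff [] : (odd k -> gaussian_moment k = 0%N) /\
  (odd k.+1 -> gaussian_moment k.+1 = 0%N) by [].
elim: k => [//|k [ih1 ih2]]; split => //.
by rewrite /= negbK => /ih1 ->; rewrite muln0.
Qed.

Section GaussianMoments.
Context {R : realType}.
Local Notation mu := (@lebesgue_measure R).

Lemma Rintegral_primitive_eq0 (f F : R -> R) (m : R) :
  continuous f -> mu.-integrable [set: R] (EFin \o f) ->
  (forall x : R, is_derive x 1 F (f x)) ->
  F (m + n%:R) - F (m - n%:R) @[n --> \oo] --> 0 ->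
  \int[mu]_(x in [set: R]) f x = 0.
Proof.
move=> cf fi dF lF.
pose D n := `[m - n%:R, m + n%:R]%classic : set R.
have mD n : measurable (D n) by exact: measurable_itv.
have mf : measurable_fun [set: R] f by exact: continuous_measurable_fun.
have [] := @dominated_convergence _ _ _ mu setT measurableT
  (fun n => EFin \o (f \_ (D n))) (EFin \o f) (abse \o (EFin \o f)).
- move=> n; apply/measurable_EFinP.
  apply: (iffLR (measurable_restrictT _ (mD n))); exact: measurable_funTS.
- exact/measurable_EFinP.
- apply: aeW => x _; apply: cvg_near_cst.
  exists (Num.truncn `|x - m|).+1 => // n /= nx.
  rewrite patchE mem_set//= /D/= in_itv/= lerBlDr -lerBlDl.
  have : `|x - m| <= n%:R.
    by rewrite ltW// (lt_le_trans (truncnS_gt _))// ler_nat.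
  by rewrite ler_norml => /andP[]; lra.
- exact: integrable_abse.
- apply: aeW => x n _ /=; rewrite patchE; case: ifP => //.
  by rewrite normr0 lee_fin.
move=> _ _ lim_f.
have E n : (\int[mu]_x (EFin \o (f \_ (D n.+1))) x =
            (F (m + n.+1%:R) - F (m - n.+1%:R))%:E)%E.
  rewrite -restrict_EFin -integral_mkcond.
  have dF' x : derivable F x 1 by have [] := dF x.
  have cF x : {for x, continuous F}.
    by apply/differentiable_continuous/derivable1_diffP.
  rewrite (@continuous_FTC2 _ f F)//.
  - have : 0 < n.+1%:R :> R by rewrite ltr0n.
    lra.
  - exact: continuous_subspaceT.
  - split; first by move=> x _; exact: dF'.
    + by apply: cvg_at_right_filter; exact: cF.
    + by apply: cvg_at_left_filter; exact: cF.
  - by move=> x _; rewrite derive1E; have [] := dF x.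
have : (\int[mu]_x (EFin \o (f \_ (D n))) x @[n --> \oo] --> 0%:E)%E.
  rewrite -(cvg_shiftS (fun n => \int[mu]_x (EFin \o (f \_ (D n))) x)%E).
  rewrite (_ : (fun n => _) =
     (fun n => (F (m + n.+1%:R) - F (m - n.+1%:R))%:E)); last exact/funext.
  apply: cvg_EFin; first by near=> n.
  by rewrite (cvg_shiftS (fun n => F (m + n%:R) - F (m - n%:R))).
move=> l0; rewrite /Rintegral.
by have /= -> := cvg_unique (@ereal_hausdorff R) lim_f l0.
Unshelve. all: by end_near. Qed.

Variables (m s : R).
Hypothesis s0 : s != 0.

Let f k (x : R) := (x - m) ^+ k * normal_fun m s x.

Lemma normal_fun_le1 t x : normal_fun m t x <= 1.
Proof.
rewrite /normal_fun -[leRHS]expR0 ler_expR mulNr oppr_le0.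
by rewrite divr_ge0 ?sqr_ge0// mulrn_wge0 ?sqr_ge0.
Qed.

Lemma normal_fun_poly_bound k : exists2 C, 0 <= C &
  forall x, `|f k x| <= C * normal_fun m (2 * s) x.
Proof.
exists (1 + (4 * s ^+ 2) ^+ k * k`!%:R).
  by rewrite addr_ge0// mulr_ge0// exprn_ge0// mulr_ge0// sqr_ge0.
move=> x; rewrite /f normrM (ger0_norm (normal_fun_ge0 _ _ _)) normrX /normal_fun.
set y := x - m.
have [u uE] : {u | u = y ^+ 2 / (s ^+ 2 *+ 2)} by exists (y ^+ 2 / (s ^+ 2 *+ 2)).
have s2 : 0 < s ^+ 2 by rewrite exprn_even_gt0.
have u0 : 0 <= u by rewrite uE divr_ge0 ?sqr_ge0// mulrn_wge0 ?sqr_ge0.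
have -> : - y ^+ 2 / (s ^+ 2 *+ 2) = - u by rewrite uE mulNr.
have -> : - y ^+ 2 / ((2 * s) ^+ 2 *+ 2) = - (u / 4).
  rewrite uE; field.
  by rewrite s0.
have yk : `|y| ^+ k <= (1 + (4 * s ^+ 2) ^+ k * k`!%:R) * expR (u / 2).
  have h1 : `|y| ^+ k <= 1 + (y ^+ 2) ^+ k.
    have [y1|y1] := leP `|y| 1.
      by apply: (@le_trans _ _ 1); rewrite ?exprn_ile1// lerDl exprn_ge0 ?sqr_ge0.
    have -> : y ^+ 2 = `|y| ^+ 2 by rewrite real_normK ?num_real.
    rewrite -exprM mulnC exprM.
    have := exprn_ege1 k (ltW y1); set z := _ ^+ k => z1.
    by have := sqr_ge0 (z - 1); rewrite sqrrB; lra.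
  apply: le_trans h1 _; rewrite mulrDl mul1r.
  apply: lerD.
    by rewrite -[leLHS]expR0 ler_expR divr_ge0.
  have -> : y ^+ 2 = 4 * s ^+ 2 * (u / 2) by rewrite uE; field; rewrite s0.
  have s4 : 0 < (4 * s ^+ 2) ^+ k by rewrite exprn_gt0// mulr_gt0.
  rewrite exprMn -mulrA ler_pM2l//.
  have u20 : 0 <= u / 2 by rewrite divr_ge0.
  case: k s4 => [|k] _; first by rewrite expr0 fact0 mul1r -[leLHS]expR0 ler_expR.
  have := expR_ge1Dxn k u20.
  have kf : 0 < k.+1`!%:R :> R by rewrite ltr0n fact_gt0.
  move=> h; rewrite [leRHS]mulrC -ler_pdivrMr//.
  by lra.
rewrite -(ler_pM2r (expR_gt0 (u / 4))) -!mulrA -!expRD addNr expR0 mulr1.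
apply: le_trans (ler_wpM2r (expR_ge0 _) yk) _.
rewrite -mulrA -expRD; apply: ler_piMr.
  by rewrite addr_ge0// mulr_ge0// exprn_ge0// mulr_ge0// sqr_ge0.
rewrite -[leRHS]expR0 ler_expR; lra.
Qed.

Let continuous_f k : continuous (f k).
Proof.
move=> x; rewrite /f; apply: cvgM.
  apply: (@continuous_comp _ _ _ (fun x : R => x - m) (fun x : R => x ^+ k)).
    by apply: cvgB; [exact: cvg_id|exact: cvg_cst].
  exact: exprn_continuous.
have -> : normal_fun m s = fun x => (normal_peak s)^-1 * normal_pdf m s x.
  apply/funext => z; rewrite normal_pdfE// mulKf// gt_eqF//.
  exact: normal_peak_gt0.
apply: cvgM; first exact: cvg_cst.
exact: continuous_normal_pdf.
Qed.

Let integrable_normal_fun t : t != 0 ->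
  mu.-integrable [set: R] (EFin \o normal_fun m t).
Proof.
move=> t0.
have := integrableZl measurableT (normal_peak t)^-1 (integrable_normal_pdf m t).
apply: eq_integrable => // x _ /=.
rewrite -EFinM normal_pdfE// mulKf// gt_eqF//.
exact: normal_peak_gt0.
Qed.

Let integrable_f k : mu.-integrable [set: R] (EFin \o f k).
Proof.
have [C C0 fC] := normal_fun_poly_bound k.
have s20 : 2 * s != 0 by rewrite mulf_neq0.
have := integrableZl measurableT C (integrable_normal_fun s20).
apply: le_integrable => //.
  by apply/measurable_EFinP; apply: continuous_measurable_fun; exact: continuous_f.
move=> x _ /=; rewrite lee_fin (le_trans (fC x))// ler_norm//.
Qed.

Let G k (x : R) := - s ^+ 2 * f k x.

Let cvg_G k (b : bool) : G k (m + (-1) ^+ b * n%:R) @[n --> \oo] --> 0.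
Proof.
have [C C0 fC] := normal_fun_poly_bound k.+1.
apply/cvgr0Pnorm_le => e e0.
near=> n.
have n0 : 0 < n%:R :> R by near: n; exact: nbhs_infty_gtr.
set y := m + _.
have ym : `|y - m| = n%:R.
  rewrite /y addrC addKr normrM normrX normrN1 expr1n mul1r.
  by rewrite ger0_norm.
have := le_trans (fC y) (ler_wpM2l C0 (normal_fun_le1 (2 * s) y)).
rewrite mulr1 (_ : f k.+1 y = (y - m) * f k y); last first.
  by rewrite /f exprS mulrA.
rewrite normrM ym -ler_pdivlMl// => h.
rewrite /G normrM normrN; apply: le_trans (ler_wpM2l (normr_ge0 _) h) _.
have -> : `|s ^+ 2| * (n%:R^-1 * C) = C * `|s ^+ 2| / n%:R by ring.
rewrite ler_pdivrMr// -ler_pdivrMl//.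
by near: n; exact: nbhs_infty_ger.
Unshelve. all: by end_near. Qed.

Let is_derive_G k (x : R) :
  is_derive x 1 (G k) (f k.+1 x - s ^+ 2 * (k%:R * f k.-1 x)).
Proof.
have scE (u v : R^o) : u *: v = u * v by [].
pose a : R -> R := fun y => y - m.
have da : is_derive x (1 : R) a 1.
  rewrite (_ : a = id - cst m)//; apply: is_derive_eq.
  by rewrite subr0.
pose c := - (s ^+ 2 *+ 2)^-1.
have d2 := is_deriveZ c (is_deriveX 2 da).
have d1 := is_derive1_comp (is_derive_expR ((c \*: (a ^+ 2)) x)) d2.
have d3 := is_deriveZ (- s ^+ 2) (is_deriveM (is_deriveX k da) d1).
have nfE y : normal_fun m s y = expR ((c \*: (a ^+ 2)) y).
  by rewrite /normal_fun; congr expR; rewrite exprfctE /= scE /c /a mulNr mulrC mulNr.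
have -> : G k = (- s ^+ 2) \*: ((a ^+ k) * (expR \o (c \*: (a ^+ 2)))).
  by apply/funext => y; rewrite /G /f nfE !fctE.
apply: (is_derive_eq d3); rewrite /f !nfE !scE /= exprfctE.
set E := expR _; rewrite /a /c; move: (x - m) E => y E.
clear d1 d2 d3 nfE; case: k => [|k] /=; rewrite ?expr0 ?exprS ?expr0; field; exact: s0.
Qed.

Let Rint_rec k : \int[mu]_(x in setT) f k.+1 x =
  s ^+ 2 * k%:R * \int[mu]_(x in setT) f k.-1 x.
Proof.
apply/eqP; rewrite -subr_eq0; apply/eqP.
have i1 : mu.-integrable [set: R] (EFin \o (fun x => s ^+ 2 * k%:R * f k.-1 x)).
  exact: (integrableZl measurableT (s ^+ 2 * k%:R) (integrable_f k.-1)).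
rewrite -RintegralZl// -RintegralB//.
apply: (@Rintegral_primitive_eq0 _ (G k) m).
- move=> x; apply: cvgB; first exact: continuous_f.
  apply: cvgM; [exact: cvg_cst|exact: continuous_f].
- exact: (integrableB measurableT (integrable_f k.+1) i1).
- by move=> x; rewrite -mulrA; exact: is_derive_G.
rewrite -[X in _ --> X](subr0 0); apply: cvgB.
  have := cvg_G k false; rewrite expr0.
  by under eq_fun do rewrite mul1r.
have := cvg_G k true; rewrite expr1.
by under eq_fun do rewrite mulN1r.
Qed.

Lemma Rint_normal_fun k :
  \int[mu]_(x in setT) f k x = (gaussian_moment k)%:R * s ^+ k * (normal_peak s)^-1.
Proof.
suff [] : \int[mu]_(x in setT) f k x =
    (gaussian_moment k)%:R * s ^+ k * (normal_peak s)^-1 /\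
  \int[mu]_(x in setT) f k.+1 x =
    (gaussian_moment k.+1)%:R * s ^+ k.+1 * (normal_peak s)^-1 by [].
elim: k => [|k [ih1 ih2]]; last first.
  split => //; rewrite Rint_rec ih1 /= natrM !exprS.
  by ring.
split; last by rewrite Rint_rec !(mulr0, mul0r).
rewrite mul1r expr0 mul1r /Rintegral.
have np0 : normal_peak s != 0 by rewrite gt_eqF// normal_peak_gt0.
have -> : (\int[mu]_x (f 0%N x)%:E =
    (normal_peak s)^-1%:E * \int[mu]_x (normal_pdf m s x)%:E)%E.
  rewrite -integralZl//; last exact: integrable_normal_pdf.
  apply: eq_integral => x _; rewrite -EFinM normal_pdfE// mulKf//.
  by rewrite /f expr0 mul1r.
by rewrite integral_normal_pdf mule1.
Qed.

Lemma integrable_normal_prob k :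
  (normal_prob m s).-integrable [set: R] (fun x => ((x - m) ^+ k)%:E).
Proof.
have mf : measurable_fun [set: R] (fun x : R => (x - m) ^+ k).
  by apply: measurable_funX; exact: measurable_funB.
apply/integrableP; split; first exact/measurable_EFinP.
rewrite (integral_density (mu := mu) (p := normal_pdf m s))//; last 3 first.
- exact: measurable_normal_pdf.
- exact: normal_pdf_ge0.
- by apply: measurableT_comp => //; exact/measurable_EFinP.
have /integrableP[_] := integrableZl measurableT (normal_peak s) (integrable_f k).
apply: le_lt_trans; rewrite le_eqVlt; apply/orP; left; apply/eqP; apply: eq_integral => x _ /=.
rewrite normal_pdfE//= -EFinM /f; congr EFin.
rewrite !normrM (ger0_norm (normal_fun_ge0 _ _ _)).
by rewrite (ger0_norm (normal_peak_ge0 _)); ring.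
Qed.

Lemma normal_prob_moment k :
  (\int[normal_prob m s]_x ((x - m) ^+ k)%:E =
   ((gaussian_moment k)%:R * s ^+ k)%:E)%E.
Proof.
have mf : measurable_fun [set: R] (fun x : R => (x - m) ^+ k).
  by apply: measurable_funX; exact: measurable_funB.
rewrite (integral_density (mu := mu) (p := normal_pdf m s))//; last 3 first.
- exact: measurable_normal_pdf.
- exact: normal_pdf_ge0.
- exact/measurable_EFinP.
transitivity (\int[mu]_x ((normal_peak s)%:E * (f k x)%:E))%E.
  apply: eq_integral => x _; rewrite normal_pdfE// -!EFinM /f; congr EFin.
  by rewrite /=; ring.
rewrite integralZl//; last exact: integrable_f.
have := fineK (integrable_fin_num measurableT (integrable_f k)).
rewrite -[fine _]/(\int[mu]_(x in setT) f k x) Rint_normal_fun /= => <-.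
rewrite -EFinM.
have np0 : normal_peak s != 0 by rewrite gt_eqF// normal_peak_gt0.
by congr EFin; field.
Qed.

End GaussianMoments.

Section GaussianLaw.
Context {R : realType} {disp : measure_display} {T : measurableType disp}.
Variable P : probability T R.

Lemma law_moments (Y : T -> R) (nu : {measure set (measurableTypeR R) -> \bar R}) (m s : R) :
  measurable_fun [set: T] Y ->
  (forall B : set R, measurable B -> P (Y @^-1` B) = nu B) ->
  (forall k, nu.-integrable [set: R] (fun x => ((x - m) ^+ k)%:E)) ->
  (forall k, \int[nu]_x ((x - m) ^+ k)%:E =
     ((gaussian_moment k)%:R * s ^+ k)%:E)%E ->
  all_moments P Y /\
  forall k, ex P (fun w => (Y w - m) ^+ k) = (gaussian_moment k)%:R * s ^+ k.
Proof.
move=> mY YE inu Inu.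
have mf k : measurable_fun [set: R] (fun x : R => (x - m) ^+ k).
  by apply: measurable_funX; exact: measurable_funB.
pose Y' : T -> measurableTypeR R := Y.
have mY' : measurable_fun [set: T] Y' by exact: mY.
have mfE k : measurable_fun [set: measurableTypeR R] (fun x => ((x - m) ^+ k)%:E).
  by apply/measurable_EFinP; exact: mf.
have nuE (g : measurableTypeR R -> \bar R) :
    (\int[nu]_x g x = \int[pushforward P Y']_x g x)%E.
  by apply: eq_measure_integral => B mB _; rewrite -YE.
have iY k : P.-integrable [set: T] (fun w => ((Y w - m) ^+ k)%:E).
  apply/integrableP; split.
    apply/measurable_EFinP; apply: measurable_funX; exact: measurable_funB.
  have /integrableP[_] := inu k; rewrite nuE (ge0_integral_pushforward mY')//.
  by apply: measurableT_comp => //; exact: mfE.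
have aY : all_moments P (fun w => Y w - m).
  split; first exact: measurable_funB.
  move=> k; have := integrable_abse (iY k).
  by apply: eq_integrable => // w _ /=; rewrite normrX.
split.
  apply: (eq_all_moments _ (all_momentsD aY (all_moments_cst P m))) => w.
  by rewrite subrK.
move=> k; apply: EFin_inj.
rewrite -(integral_ex (all_moments_exp k aY)) -Inu nuE.
by rewrite (integral_pushforward mY' (mfE k) (iY k) measurableT).
Qed.

Lemma gaussian_law_moments (Y : T -> R) : measurable_fun [set: T] Y ->
  gaussian_law P Y -> exists m s, all_moments P Y /\
  forall k, ex P (fun w => (Y w - m) ^+ k) = (gaussian_moment k)%:R * s ^+ k.
Proof.
move=> mY [m [s YE]]; exists m, s.
have [s0|s0] := eqVneq s 0; last first.
  refine (law_moments (nu := normal_prob m s) mY _ _ _).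
  - by move=> B mB; rewrite YE// (negbTE s0).
  - exact: integrable_normal_prob.
  - exact: normal_prob_moment.
have mf k : measurable_fun [set: R] (fun x : R => (x - m) ^+ k).
  by apply: measurable_funX; exact: measurable_funB.
have mfE k : measurable_fun [set: measurableTypeR R] (fun x => ((x - m) ^+ k)%:E).
  by apply/measurable_EFinP; exact: mf.
have Id k : (\int[@dirac _ (measurableTypeR R) m R]_x ((x - m) ^+ k)%:E =
    ((gaussian_moment k)%:R * s ^+ k)%:E)%E.
  rewrite integral_dirac//.
  rewrite diracT mul1e subrr s0; case: k => [|k] /=.
    by rewrite !expr0 mulr1.
  by rewrite !expr0n /= mulr0.
refine (law_moments (nu := @dirac _ (measurableTypeR R) m R) mY _ _ _).
- by move=> B mB; rewrite YE// s0 eqxx.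
- move=> k; apply/integrableP; split => //.
  rewrite integral_dirac//; last exact: measurableT_comp.
  by rewrite diracT mul1e ltry.
- exact: Id.
Qed.

Lemma centered_gaussian_moment (Y : T -> R) : measurable_fun [set: T] Y ->
  gaussian_law P Y -> ex P Y = 0 ->
  forall k, ex P (fun w => Y w ^+ k) =
    (gaussian_moment k)%:R * ex P (fun w => Y w ^+ 2) ^+ k./2.
Proof.
move=> mY gY Y0.
have [m [s [aY H]]] := gaussian_law_moments mY gY.
have m0 : m = 0.
  have := H 1%N; rewrite /= mul0r.
  under eq_ex do rewrite expr1.
  rewrite exB//; last exact: all_moments_cst.
  by rewrite Y0 ex_cst sub0r => /eqP; rewrite oppr_eq0 => /eqP.
have {}H k : ex P (fun w => Y w ^+ k) = (gaussian_moment k)%:R * s ^+ k.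
  by rewrite -H m0; apply: eq_ex => w; rewrite subr0.
move=> k; rewrite !H /= muln1 mul1r -exprM mul2n.
have [ok|ek] := boolP (odd k); last by rewrite even_halfK.
suff -> : gaussian_moment k = 0%N by rewrite !mul0r.
by rewrite gaussian_moment_odd.
Qed.

End GaussianLaw.

Section Independence.
Context {R : realType} {disp : measure_display} {T : measurableType disp}.
Variable P : probability T R.
Local Notation RR := (measurableTypeR R).

Lemma ex_independentM (U V : T -> R) : all_moments P U -> all_moments P V ->
  (forall A B : set R, measurable A -> measurable B ->
    P (U @^-1` A `&` V @^-1` B) = (P (U @^-1` A) * P (V @^-1` B))%E) ->
  ex P (fun w => U w * V w) = ex P U * ex P V.
Proof.
move=> aU aV UV.
have mU := all_moments_measurable aU; have mV := all_moments_measurable aV.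
pose U' : {mfun T >-> RR} := MeasurableFun.Pack (MeasurableFun.Class
  (isMeasurableFun.Build _ _ T RR U mU)).
pose V' : {mfun T >-> RR} := MeasurableFun.Pack (MeasurableFun.Class
  (isMeasurableFun.Build _ _ T RR V mV)).
pose W (w : T) : RR * RR := (U w, V w).
have mW : measurable_fun [set: T] W by exact: measurable_fun_pair.
pose W' : {mfun T >-> (RR * RR)%type} := MeasurableFun.Pack (MeasurableFun.Class
  (isMeasurableFun.Build _ _ T (RR * RR)%type W mW)).
pose m1 := distribution P U'; pose m2 := distribution P V'.
have prodE (A : set (RR * RR)) : measurable A ->
    (m1 \x m2)%E A = distribution P W' A.
  apply: product_measure_unique => B C mB mC.
  rewrite /distribution /pushforward /= -UV//.
pose f (z : RR * RR) : \bar R := (z.1 * z.2)%:E.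
have mf : measurable_fun [set: RR * RR] f.
  apply/measurable_EFinP; apply: measurable_funM.
    exact: measurable_fst.
  exact: measurable_snd.
have iUV := all_moments_integrable (all_momentsM aU aV).
have intf : (m1 \x m2)%E.-integrable [set: RR * RR] f.
  have := @integrable_pushforward _ _ _ _ _ W mW P setT f mf iUV measurableT.
  move=> /integrableP[_ fin]; apply/integrableP; split => //.
  rewrite (@eq_measure_integral _ _ _ _ (pushforward P W))// => A mA _.
  exact: prodE.
have E1 : (\int[m1 \x m2]_z f z = (ex P (fun w => U w * V w))%:E)%E.
  rewrite -(integral_ex (all_momentsM aU aV)).
  rewrite (@eq_measure_integral _ _ _ _ (pushforward P W)); last first.
    by move=> A mA _; exact: prodE.
  by rewrite (integral_pushforward mW mf iUV measurableT).
apply: EFin_inj; rewrite -E1 -(integral12_prod_meas1 intf).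
have mid : measurable_fun [set: RR] (fun y : RR => y%:E).
  by apply/measurable_EFinP; exact: measurable_id.
have idV : (\int[m2]_y y%:E = (ex P V)%:E)%E.
  rewrite -(integral_ex aV).
  by rewrite (@integral_pushforward _ _ T RR R V mV P setT _ mid
    (all_moments_integrable aV) measurableT).
have idU : (\int[m1]_y y%:E = (ex P U)%:E)%E.
  rewrite -(integral_ex aU).
  by rewrite (@integral_pushforward _ _ T RR R U mU P setT _ mid
    (all_moments_integrable aU) measurableT).
transitivity (\int[m1]_x ((ex P V)%:E * x%:E))%E.
  apply: eq_integral => x _; rewrite /fubini_F /f -idV -[RHS]muleC.
  rewrite -integralZl//.
  exact: (@integrable_pushforward _ _ T RR R V mV P setT _ mid (all_moments_integrable aV) measurableT).
rewrite integralZl//; last first.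
  exact: (@integrable_pushforward _ _ T RR R U mU P setT _ mid (all_moments_integrable aU) measurableT).
by rewrite idU -EFinM mulrC.
Qed.

End Independence.

Section Polarization.
Context {R : realType}.

Lemma horner_inj (p q : {poly R}) : (forall t, p.[t] = q.[t]) -> p = q.
Proof.
move=> pq; apply/eqP; rewrite -subr_eq0; apply/negPn/negP => d0.
pose rs := [seq k%:R : R | k <- iota 0 (size (p - q))].
have r1 : all (root (p - q)) rs.
  by apply/allP => x _; rewrite /root hornerD hornerN pq subrr.
have r2 : uniq rs.
  rewrite map_inj_uniq ?iota_uniq// => a b /eqP.
  by rewrite eqr_nat => /eqP.
by have := max_poly_roots d0 r1 r2; rewrite size_map size_iota ltnn.
Qed.

Context {d1 d2 : measure_display} {T1 : measurableType d1} {T2 : measurableType d2}.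
Variables (P1 : probability T1 R) (P2 : probability T2 R).
Variables (I : finType) (x : I -> T1 -> R) (y : I -> T2 -> R).
Hypothesis ax : forall i, all_moments P1 (x i).
Hypothesis ay : forall i, all_moments P2 (y i).
Hypothesis xy : forall c k, ex P1 (fun w => (\sum_i c i * x i w) ^+ k) =
  ex P2 (fun w => (\sum_i c i * y i w) ^+ k).

Lemma lin_coefD d (T : measurableType d) (z : I -> T -> R) c i t w :
  \sum_j (c j + t * (j == i)%:R) * z j w = \sum_j c j * z j w + t * z i w.
Proof.
under eq_bigr do rewrite mulrDl.
rewrite big_split /=; congr (_ + _).
rewrite (bigD1 i)//= eqxx mulr1 big1 ?addr0// => j /negbTE ->.
by rewrite mulr0 mul0r.
Qed.

Lemma ex_poly_expansion d (T : measurableType d) (P : probability T R)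
    (l z r : T -> R) a t :
  all_moments P l -> all_moments P z -> all_moments P r ->
  ex P (fun w => (l w + t * z w) ^+ a * r w) =
  (\poly_(k < a.+1) ('C(a, k)%:R *
    ex P (fun w => l w ^+ (a - k) * z w ^+ k * r w))).[t].
Proof.
move=> al az ar; rewrite horner_poly.
have am k : all_moments P (fun w => l w ^+ (a - k) * z w ^+ k * r w).
  by apply: all_momentsM => //; apply: all_momentsM; exact: all_moments_exp.
transitivity (ex P (fun w => \sum_(k < a.+1) ('C(a, k)%:R * t ^+ k) *
   (l w ^+ (a - k) * z w ^+ k * r w))).
  apply: eq_ex => w; rewrite exprDn mulr_suml; apply: eq_bigr => k _.
  by rewrite exprMn -mulr_natl; ring.
rewrite ex_sum; last by move=> k _; exact: all_momentsZ.
by apply: eq_bigr => k _; rewrite exZ//; ring.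
Qed.

Lemma polarization (s : seq I) :
  ex P1 (fun w => \prod_(i <- s) x i w) = ex P2 (fun w => \prod_(i <- s) y i w).
Proof.
have alin d (T : measurableType d) (P : probability T R) (z : I -> T -> R) c :
    (forall i, all_moments P (z i)) -> all_moments P (fun w => \sum_i c i * z i w).
  by move=> az; apply: all_moments_sum => i _; exact: all_momentsZ.
suff H : forall c a,
    ex P1 (fun w => (\sum_i c i * x i w) ^+ a * \prod_(i <- s) x i w) =
    ex P2 (fun w => (\sum_i c i * y i w) ^+ a * \prod_(i <- s) y i w).
  have := H (fun=> 0) 0%N.
  by under eq_ex do rewrite expr0 mul1r; under [RHS]eq_ex do rewrite expr0 mul1r.
elim: s => [|i s ih] c a.
  under eq_ex do rewrite big_nil mulr1.
  by under [RHS]eq_ex do rewrite big_nil mulr1.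
have a1 : all_moments P1 (fun w => \prod_(i <- s) x i w).
  by apply: all_moments_prod.
have a2 : all_moments P2 (fun w => \prod_(i <- s) y i w).
  by apply: all_moments_prod.
have /horner_inj /(congr1 (fun p : {poly R} => p`_1)) : forall t,
  (\poly_(k < a.+2) ('C(a.+1, k)%:R * ex P1 (fun w =>
     (\sum_i c i * x i w) ^+ (a.+1 - k) * x i w ^+ k * \prod_(i <- s) x i w))).[t] =
  (\poly_(k < a.+2) ('C(a.+1, k)%:R * ex P2 (fun w =>
     (\sum_i c i * y i w) ^+ (a.+1 - k) * y i w ^+ k * \prod_(i <- s) y i w))).[t].
  move=> t; rewrite -!ex_poly_expansion//; [|exact: alin|exact: alin].
  have := ih (fun j => c j + t * (j == i)%:R) a.+1.
  by under eq_ex do rewrite lin_coefD; under [RHS]eq_ex do rewrite lin_coefD.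
rewrite !coef_poly /= bin1 subSS subn0.
have a0 : a.+1%:R != 0 :> R by rewrite pnatr_eq0.
move=> /(mulfI a0) h.
under eq_ex do rewrite big_cons mulrA.
under [RHS]eq_ex do rewrite big_cons mulrA.
by move: h; under eq_ex do rewrite expr1; under [RHS]eq_ex do rewrite expr1.
Qed.

End Polarization.

Section Cholesky.
Context {R : rcfType}.

Definition psd n (C : 'M[R]_n) := forall u : 'rV[R]_n, 0 <= (u *m C *m u^T) 0 0.

Lemma cholesky n (C : 'M[R]_n) : C^T = C -> psd C ->
  exists L : 'M[R]_n, C = L^T *m L.
Proof.
elim: n C => [|n ih] C symC posC; first by exists 0; apply/matrixP => -[].
rewrite -[n.+1]/(1 + n)%N in C symC posC *.
have [a [b [D CE]]] : exists a b D, C = block_mx a%:M b b^T D.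
  exists (ulsubmx C 0 0), (ursubmx C), (drsubmx C).
  rewrite -mx11_scalar -[LHS]submxK; congr block_mx.
  by rewrite -{1}symC trmx_ursub.
have symD : D^T = D.
  by have := symC; rewrite CE tr_block_mx => /eq_block_mx[].
have quad (t : R) (v : 'rV[R]_n) :
    0 <= t ^+ 2 * a + (2 * t) * (v *m b^T) 0 0 + (v *m D *m v^T) 0 0.
  have := posC (row_mx t%:M v); rewrite CE tr_row_mx mul_row_block mul_row_col.
  rewrite tr_scalar_mx !mul_scalar_mx mul_mx_scalar mulmxDl -scalemxAl.
  have -> : b *m v^T = (v *m b^T)^T by rewrite trmx_mul trmxK.
  set p := v *m b^T; set q := _ *m v^T; rewrite !mxE eqxx mulr1n.
  by congr (_ <= _); ring.
have a0 : 0 <= a.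
  by have := quad 1 0; rewrite !mul0mx !mxE expr1n mul1r mulr0 !addr0.
have b0 : a = 0 -> b = 0.
  move=> aE; apply/rowP => j; rewrite mxE.
  pose v : 'rV[R]_n := delta_mx 0 j.
  have vb : (v *m b^T) 0 0 = b 0 j.
    by rewrite -rowE mxE mxE.
  apply/eqP/negPn/negP => bj0.
  set q := (v *m D *m v^T) 0 0.
  have := quad (- (q + 1) / (2 * b 0 j)) v; rewrite vb -/q aE mulr0 add0r.
  have -> : 2 * (- (q + 1) / (2 * b 0 j)) * b 0 j = - (q + 1) by field.
  by lra.
pose S := D - a^-1 *: (b^T *m b).
have symS : S^T = S.
  by rewrite /S linearB linearZ /= trmx_mul trmxK symD.
have posS : psd S.
  move=> v; rewrite /S mulmxBr mulmxBl.
  have -> : v *m (a^-1 *: (b^T *m b)) *m v^T =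
      a^-1 *: ((v *m b^T) *m (v *m b^T)^T).
    by rewrite trmx_mul trmxK -scalemxAr -scalemxAl !mulmxA.
  have [aE|a1] := eqVneq a 0.
    rewrite aE invr0 scale0r subr0; have := quad 0 v.
    by rewrite expr0n /= mul0r mulr0 mul0r !add0r.
  have := quad (- a^-1 * (v *m b^T) 0 0) v.
  set p := v *m b^T; set q := v *m D *m v^T.
  rewrite !mxE big_ord1 !mxE.
  by congr (_ <= _); field.
have [L SE] := ih S symS posS.
pose r := Num.sqrt a.
have rr : r * r = a by rewrite -expr2 sqr_sqrtr.
have rb : (r * r^-1) *: b = b.
  have [r0|r0] := eqVneq r 0; last by rewrite divff// scale1r.
  by rewrite b0 ?scaler0// -rr r0 mul0r.
exists (block_mx r%:M (r^-1 *: b) 0 L).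
rewrite tr_block_mx mulmx_block CE !trmx0 tr_scalar_mx !mul0mx !mulmx0.
rewrite !mul_scalar_mx !mul_mx_scalar !addr0.
rewrite (scalerA r r^-1 b) rb; congr block_mx.
- by rewrite scale_scalar_mx rr.
- by rewrite linearZ /= (scalerA r r^-1) -linearZ /= rb.
- rewrite -scalemxAr [(_ *: b)^T]linearZ /= -scalemxAl scalerA -invfM rr -SE /S.
  by rewrite addrC subrK.
Qed.

End Cholesky.

Section PowerInequalities.
Context {R : realType}.

(* Chebyshev's sum inequality gives the induction step. *)
Lemma weighted_power_mean N (w b : 'I_N -> R) p :
  (forall i, 0 <= w i) -> (forall i, 0 <= b i) ->
  (\sum_i w i * b i) ^+ p.+1 <= (\sum_i w i) ^+ p * \sum_i w i * b i ^+ p.+1.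
Proof.
move=> w0 b0; elim: p => [|p ih].
  by rewrite !expr1 mul1r; under [leRHS]eq_bigr do rewrite expr1.
have S0 : 0 <= \sum_i w i * b i by apply: sumr_ge0 => i _; rewrite mulr_ge0.
have W0 : 0 <= \sum_i w i by apply: sumr_ge0.
have cheb : (\sum_i w i * b i) * (\sum_i w i * b i ^+ p.+1) <=
    (\sum_i w i) * \sum_i w i * b i ^+ p.+2.
  have e1 : \sum_i \sum_j w i * w j * (b i ^+ p.+1 - b j ^+ p.+1) * (b i - b j) =
    2 * ((\sum_i w i) * (\sum_i w i * b i ^+ p.+2) -
     (\sum_i w i * b i) * (\sum_i w i * b i ^+ p.+1)).
    transitivity (\sum_i \sum_j (w i * b i ^+ p.+2 * w j + w i * (w j * b j ^+ p.+2)
       - w i * b i * (w j * b j ^+ p.+1) - w i * b i ^+ p.+1 * (w j * b j))).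
      apply: eq_bigr => i _; apply: eq_bigr => j _.
      by rewrite !exprS; ring.
    have dist (f g : 'I_N -> R) :
        \sum_i \sum_j f i * g j = (\sum_i f i) * (\sum_j g j).
      by rewrite mulr_suml; apply: eq_bigr => i _; rewrite mulr_sumr.
    under eq_bigr do rewrite !(sumrB, big_split) /=.
    by rewrite !(sumrB, big_split) /= !dist; ring.
  rewrite -subr_ge0 -(pmulr_rge0 _ (ltr0Sn R 1)) -e1.
  apply: sumr_ge0 => i _; apply: sumr_ge0 => j _.
  rewrite -mulrA; apply: mulr_ge0; first by rewrite mulr_ge0.
  have [bij|bij] := leP (b i) (b j).
    by rewrite mulr_le0// subr_le0// lerXn2r ?nnegrE.
  by rewrite mulr_ge0// subr_ge0 ?lerXn2r ?nnegrE// ltW.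
rewrite exprS; apply: le_trans (ler_wpM2l S0 ih) _.
rewrite mulrCA exprSr -mulrA ler_wpM2l ?exprn_ge0//.
Qed.

Lemma power_tangent (A B : R) p : 0 <= A -> 0 <= B ->
  B ^+ p.+1 + p.+1%:R * B ^+ p * (A - B) <= A ^+ p.+1.
Proof.
move=> A0 B0; elim: p => [|p ih]; first by rewrite !expr1 expr0; lra.
rewrite [leRHS]exprS; apply: le_trans (ler_wpM2l A0 ih).
rewrite -subr_ge0 [X in 0 <= X](_ : _ = p.+1%:R * B ^+ p * (A - B) ^+ 2).
  by apply: mulr_ge0; [rewrite mulr_ge0// exprn_ge0|exact: sqr_ge0].
by rewrite -[p.+2%:R]natr1 !exprS; ring.
Qed.

Lemma even_power_tangent (a b : R) p :
  a ^+ (2 * p.+1) - (2 * p.+1)%:R * (a ^+ (2 * p).+1 * b) <= (a - b) ^+ (2 * p.+1).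
Proof.
rewrite [leRHS]exprM; apply: le_trans (power_tangent p (sqr_ge0 _) (sqr_ge0 a)).
rewrite -exprM lerD2l -subr_ge0.
rewrite [X in 0 <= X](_ : _ = p.+1%:R * (a ^+ 2) ^+ p * b ^+ 2).
  apply: mulr_ge0; last exact: sqr_ge0.
  by rewrite mulr_ge0// exprn_ge0// sqr_ge0.
by rewrite natrM -exprM !exprS; ring.
Qed.

End PowerInequalities.

Section GaussianChaos.
Context {R : realType}.

Definition gaussian_family {d} {T : measurableType d} (P : probability T R)
    (I : finType) (U : I -> T -> R) :=
  (forall i, all_moments P (U i)) /\
  forall (c : I -> R) k, ex P (fun w => (\sum_i c i * U i w) ^+ k) =
    (gaussian_moment k)%:R * ex P (fun w => (\sum_i c i * U i w) ^+ 2) ^+ k./2.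

Definition moment_independent {d} {T : measurableType d} (P : probability T R)
    (I J : finType) (U : I -> T -> R) (V : J -> T -> R) :=
  forall n (f : 'I_n -> I) (g : 'I_n -> J),
    ex P (fun w => \prod_k U (f k) w * \prod_k V (g k) w) =
    ex P (fun w => \prod_k U (f k) w) * ex P (fun w => \prod_k V (g k) w).

Section Bilinear.
Context {d : measure_display} {T : measurableType d} (P : probability T R).

Lemma all_moments_lin (I : finType) (U : I -> T -> R) c :
  (forall i, all_moments P (U i)) -> all_moments P (fun w => \sum_i c i * U i w).
Proof. by move=> aU; apply: all_moments_sum => i _; exact: all_momentsZ. Qed.

Lemma ex_lin_sqr (I : finType) (U : I -> T -> R) c :
  (forall i, all_moments P (U i)) ->
  ex P (fun w => (\sum_i c i * U i w) ^+ 2) =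
  \sum_i \sum_j c i * c j * ex P (fun w => U i w * U j w).
Proof.
move=> aU.
transitivity (ex P (fun w => \sum_i \sum_j c i * c j * (U i w * U j w))).
  apply: eq_ex => w; rewrite expr2 mulr_suml; apply: eq_bigr => i _.
  by rewrite mulr_sumr; apply: eq_bigr => j _; ring.
rewrite ex_sum => [|i _].
  apply: eq_bigr => i _; rewrite ex_sum => [|j _].
    by apply: eq_bigr => j _; rewrite exZ//; exact: all_momentsM.
  by apply: all_momentsZ; exact: all_momentsM.
by apply: all_moments_sum => j _; apply: all_momentsZ; exact: all_momentsM.
Qed.

Lemma ex_sum_power N (a : 'I_N -> T -> R) K p : 0 <= K ->
  (forall i, all_moments P (a i)) -> (forall i w, 0 <= a i w) ->
  (forall i, ex P (fun w => a i w ^+ p.+1) <= K * ex P (a i) ^+ p.+1) ->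
  ex P (fun w => (\sum_i a i w) ^+ p.+1) <= K * (\sum_i ex P (a i)) ^+ p.+1.
Proof.
move=> K0 aa a0 aK; set W := \sum_i _.
have w0 i : 0 <= ex P (a i) by exact: ex_ge0.
suff H e : 0 < e ->
    ex P (fun w => (\sum_i a i w) ^+ p.+1) <= K * (W + N%:R * e) ^+ p.+1.
  have cf : K * (W + N%:R * e) ^+ p.+1 @[e --> 0^'+] --> K * W ^+ p.+1.
    have c1 : (W + N%:R * e : R) @[e --> 0^'+] --> W.
      rewrite -[X in _ --> X]addr0 -[X in _ --> _ + X](mulr0 N%:R).
      apply: cvgD; first exact: cvg_cst.
      apply: cvgM; first exact: cvg_cst.
      by apply: cvg_at_right_filter; exact: cvg_id.
    have c2 := continuous_cvg _ (@exprn_continuous R p.+1 W) c1.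
    by apply: cvgM; [exact: cvg_cst|exact: c2].
  rewrite -(cvg_lim _ cf)//; apply: limr_ge; first by apply/cvg_ex; eexists; exact: cf.
  by near=> e; apply: H; near: e; exact: nbhs_right_gt.
move=> e0; pose wt i := ex P (a i) + e.
have wt0 i : 0 < wt i by rewrite /wt ltr_wpDl.
have Wt : \sum_i wt i = W + N%:R * e.
  by rewrite big_split /= sumr_const card_ord mulr_natl.
rewrite -Wt.
pose g w := (\sum_i wt i) ^+ p * \sum_i (wt i ^- p) * a i w ^+ p.+1.
have ag : all_moments P g.
  apply: all_momentsZ; apply: all_moments_sum => i _.
  by apply: all_momentsZ; exact: all_moments_exp.
apply: (@le_trans _ _ (ex P g)).
  apply: le_ex => //.
    by apply: all_moments_exp; exact: all_moments_sum.
  move=> w; have := @weighted_power_mean R N wt (fun i => a i w / wt i) p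
    (fun i => ltW (wt0 i)) (fun i => divr_ge0 (a0 i w) (ltW (wt0 i))).
  under eq_bigr do rewrite mulrC divfK ?gt_eqF//.
  move=> /le_trans; apply; rewrite /g ler_wpM2l//.
    by rewrite exprn_ge0// sumr_ge0// => i _; rewrite ltW.
  apply: ler_sum => i _; rewrite expr_div_n [wt i ^+ p.+1]exprS.
  rewrite le_eqVlt; apply/orP; left; apply/eqP; field.
  by rewrite expf_neq0 ?gt_eqF.
rewrite /g exZ; last first.
  by apply: all_moments_sum => i _; apply: all_momentsZ; exact: all_moments_exp.
rewrite ex_sum; last by move=> i _; apply: all_momentsZ; exact: all_moments_exp.
rewrite exprSr mulrCA ler_wpM2l//.
  by rewrite exprn_ge0// sumr_ge0// => i _; rewrite ltW.
rewrite mulr_sumr; apply: ler_sum => i _; rewrite exZ; last exact: all_moments_exp.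
rewrite ler_pdivrMl ?exprn_gt0//; apply: le_trans (aK i) _.
have wl : ex P (a i) <= wt i by rewrite /wt lerDl ltW.
rewrite [leRHS]mulrCA ler_wpM2l// -exprSr.
by apply: lerXn2r => //; rewrite nnegrE ?w0// ltW.
Unshelve. all: by end_near. Qed.

Variables (N : nat) (U V : 'I_N -> T -> R).
Hypothesis aU : forall i, all_moments P (U i).
Hypothesis aV : forall i, all_moments P (V i).

Lemma sum_mul_exp (x y : 'I_N -> R) n : (\sum_i x i * y i) ^+ n =
  \sum_(f : {ffun 'I_n -> 'I_N}) (\prod_k x (f k)) * \prod_k y (f k).
Proof.
transitivity (\prod_(k < n) \sum_i x i * y i); first by rewrite prodr_const card_ord.
by rewrite bigA_distr_bigA; apply: eq_bigr => f _; rewrite big_split.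
Qed.

Lemma ex_sum_mul_exp n : ex P (fun w => (\sum_i U i w * V i w) ^+ n) =
  \sum_(f : {ffun 'I_n -> 'I_N})
    ex P (fun w => (\prod_k U (f k) w) * \prod_k V (f k) w).
Proof.
under eq_ex do rewrite sum_mul_exp.
by rewrite ex_sum// => f _; apply: all_momentsM; exact: all_moments_prod.
Qed.

Hypothesis gU : gaussian_family P U.
Hypothesis gV : gaussian_family P V.
Hypothesis UV : moment_independent P U V.

Lemma bilinear_variance : ex P (fun w => (\sum_i U i w * V i w) ^+ 2) =
  \sum_i \sum_j ex P (fun w => U i w * U j w) * ex P (fun w => V i w * V j w).
Proof.
have aUV i : all_moments P (fun w => U i w * V i w) by exact: all_momentsM.
have := ex_lin_sqr (fun=> 1) aUV; under eq_ex do under eq_bigr do rewrite mul1r.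
move=> ->; apply: eq_bigr => i _; apply: eq_bigr => j _; rewrite !mul1r.
pose f (k : 'I_2) := if k == 0 :> nat then i else j.
have := UV f f.
under eq_ex do rewrite !big_ord_recl !big_ord0 /f /= !mulr1.
under [X in _ = X * _ -> _]eq_ex do rewrite !big_ord_recl !big_ord0 /f /= !mulr1.
under [X in _ = _ * X -> _]eq_ex do rewrite !big_ord_recl !big_ord0 /f /= !mulr1.
by move=> <-; apply: eq_ex => w; ring.
Qed.

Lemma bilinear_moment p :
  ex P (fun w => (\sum_i U i w * V i w) ^+ (2 * p.+1)) <=
  (gaussian_moment (2 * p.+1))%:R ^+ 2 *
  (\sum_i \sum_j ex P (fun w => U i w * U j w) * ex P (fun w => V i w * V j w)) ^+ p.+1.
Proof.
set n := (2 * p.+1)%N; set g := _%:R.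
have n2 : n./2 = p.+1 by rewrite /n mul2n doubleK.
pose C : 'M[R]_N := \matrix_(i, j) ex P (fun w => V i w * V j w).
have CE u : (u *m C *m u^T) 0 0 = ex P (fun w => (\sum_i u 0 i * V i w) ^+ 2).
  rewrite ex_lin_sqr// !mxE exchange_big /=; apply: eq_bigr => i _.
  rewrite !mxE mulr_suml; apply: eq_bigr => j _; rewrite !mxE.
  by rewrite (eq_ex P (fun w => mulrC (V j w) (V i w))); ring.
have symC : C^T = C.
  by apply/matrixP => i j; rewrite !mxE; apply: eq_ex => w; rewrite mulrC.
have posC : psd C by move=> u; rewrite CE; apply: ex_ge0 => w; rewrite sqr_ge0.
have [L CL] := cholesky symC posC.
have CLE i j : ex P (fun w => V i w * V j w) = \sum_m L m i * L m j.
  have := congr1 (fun M : 'M[R]_N => M i j) CL; rewrite !mxE => ->.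
  by apply: eq_bigr => m _; rewrite !mxE.
pose l m w := \sum_i L m i * U i w.
have al m : all_moments P (l m) by exact: all_moments_lin.
have -> : ex P (fun w => (\sum_i U i w * V i w) ^+ n) =
    g * ex P (fun w => (\sum_m l m w ^+ 2) ^+ p.+1).
  rewrite ex_sum_mul_exp; under eq_bigr do rewrite UV.
  rewrite -exZ; last first.
    by apply/all_moments_exp/all_moments_sum => m _; exact: all_moments_exp.
  transitivity (ex P (fun w => \sum_(f : {ffun 'I_n -> 'I_N})
      ex P (fun v => \prod_k V (f k) v) * \prod_k U (f k) w)).
    rewrite ex_sum => [|f _]; last exact/all_momentsZ/all_moments_prod.
    apply: eq_bigr => f _; rewrite exZ; first exact: mulrC.
    exact: all_moments_prod.
  apply: eq_ex => w.
  transitivity (ex P (fun v => (\sum_i U i w * V i v) ^+ n)).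
    under [RHS]eq_ex do rewrite sum_mul_exp.
    rewrite ex_sum => [|f _]; last exact/all_momentsZ/all_moments_prod.
    by apply: eq_bigr => f _; rewrite exZ; [exact: mulrC|exact: all_moments_prod].
  rewrite gV.2 n2; congr (_ * _ ^+ _).
  rewrite (ex_lin_sqr (fun i => U i w) aV).
  under eq_bigr do under eq_bigr do rewrite CLE mulr_sumr.
  under eq_bigr do rewrite exchange_big /=.
  rewrite exchange_big /=; apply: eq_bigr => m _.
  rewrite /l expr2 mulr_suml; apply: eq_bigr => i _.
  by rewrite mulr_sumr; apply: eq_bigr => j _; ring.
rewrite expr2 -mulrA ler_wpM2l//.
have -> : \sum_i \sum_j ex P (fun w => U i w * U j w) * ex P (fun w => V i w * V j w)
    = \sum_m ex P (fun w => l m w ^+ 2).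
  under [RHS]eq_bigr do rewrite ex_lin_sqr//.
  rewrite [RHS]exchange_big /=; apply: eq_bigr => i _.
  rewrite [RHS]exchange_big /=; apply: eq_bigr => j _.
  rewrite CLE mulr_sumr; apply: eq_bigr => m _; ring.
apply: ex_sum_power => //.
- by move=> m; exact: all_moments_exp.
- by move=> m w; rewrite sqr_ge0.
move=> m; under eq_ex do rewrite -exprM -/n.
by rewrite gU.2 -/n n2.
Qed.

End Bilinear.
End GaussianChaos.

Section GaussianBinomial.
Context {R : realType}.

Lemma gaussian_moment_fact p :
  (gaussian_moment (2 * p) * (2 ^ p * p`!) = (2 * p)`!)%N.
Proof.
elim: p => [//|p ih]; rewrite mulnS !addSn add0n [RHS]factS [((2 * p).+1)`!]factS -ih.
rewrite [gaussian_moment _]/= expnS factS.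
have -> : (2 * p).+2 = (2 * p.+1)%N by rewrite mulnS.
ring.
Qed.

Lemma gaussian_moment_bin p i : (i <= p)%N ->
  ('C(2 * p, 2 * i) * (gaussian_moment (2 * (p - i)) * gaussian_moment (2 * i)) =
   gaussian_moment (2 * p) * 'C(p, i))%N.
Proof.
move=> ip.
have ip2 : (2 * i <= 2 * p)%N by rewrite leq_mul2l ip orbT.
have := bin_fact ip2; rewrite -mulnBr -!gaussian_moment_fact.
have := bin_fact ip; set a := 'C(_, _); set b := 'C(_, _) => E1 E2.
have pos : (0 < 2 ^ p * (i`! * (p - i)`!))%N.
  by rewrite !muln_gt0 expn_gt0 !fact_gt0.
apply/eqP; rewrite -(eqn_pmul2r pos); apply/eqP.
rewrite -[RHS]mulnA [('C(p, i) * _)%N]mulnCA E1 -E2.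
have E3 : (2 ^ p = 2 ^ i * 2 ^ (p - i))%N by rewrite -expnD subnKC.
rewrite E3; ring.
Qed.

Lemma sum_even_index (V : nmodType) (G : nat -> V) p :
  (forall j, odd j -> G j = 0) ->
  \sum_(j < (2 * p).+1) G j = \sum_(i < p.+1) G (2 * i)%N.
Proof.
move=> G0; elim: p => [|p ih]; first by rewrite !big_ord_recr !big_ord0.
rewrite [RHS]big_ord_recr /= -ih mulnS !addSn add0n 2!big_ord_recr /=.
by rewrite (G0 (2 * p).+1) ?addr0//= mul2n odd_double.
Qed.

Lemma gaussian_moment_binomial k (A B : R) :
  \sum_(j < k.+1) 'C(k, j)%:R * ((gaussian_moment (k - j))%:R * A ^+ (k - j)./2 *
    ((gaussian_moment j)%:R * B ^+ j./2)) =
  (gaussian_moment k)%:R * (A + B) ^+ k./2.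
Proof.
have [ok|] := boolP (odd k).
  rewrite gaussian_moment_odd// mul0r big1// => j _.
  have [oj|ej] := boolP (odd j); first by rewrite (gaussian_moment_odd oj) !(mul0r, mulr0).
  rewrite (@gaussian_moment_odd (k - j)) ?(mul0r, mulr0)//.
  by rewrite oddB ?leq_ord// ok (negbTE ej).
move=> ek; have [p ->] : exists p, k = (2 * p)%N.
  by exists k./2; rewrite mul2n even_halfK.
rewrite (@sum_even_index R (fun j => 'C(2 * p, j)%:R * ((gaussian_moment (2 * p - j))%:R *
   A ^+ (2 * p - j)./2 * ((gaussian_moment j)%:R * B ^+ j./2))) p); last first.
  by move=> j oj; rewrite (gaussian_moment_odd oj) !(mul0r, mulr0).
rewrite mul2n doubleK exprDn mulr_sumr; apply: eq_bigr => i _.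
have ip : (i <= p)%N by rewrite -ltnS.
rewrite -mul2n -mulnBr !mul2n !doubleK -!mul2n -mulr_natl.
have := congr1 (fun n => n%:R : R) (gaussian_moment_bin ip).
rewrite !natrM => E.
transitivity (('C(2 * p, 2 * i)%:R * ((gaussian_moment (2 * (p - i)))%:R *
  (gaussian_moment (2 * i))%:R)) * (A ^+ (p - i) * B ^+ i) : R); first by ring.
by rewrite E; ring.
Qed.

End GaussianBinomial.

Section Decoupling.
Context {R : realType}.

Lemma transfer_moments {d1 d2} {T1 : measurableType d1} {T2 : measurableType d2}
    (P1 : probability T1 R) (P2 : probability T2 R) (phi : T1 -> T2) (f : T2 -> R) :
  measurable_fun [set: T1] phi ->
  (forall A, measurable A -> P1 (phi @^-1` A) = P2 A) ->
  all_moments P2 f ->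
  all_moments P1 (fun w => f (phi w)) /\ ex P1 (fun w => f (phi w)) = ex P2 f.
Proof.
move=> mphi phiE af; have mf := all_moments_measurable af.
have pE (g : T2 -> \bar R) : (\int[P2]_x g x = \int[pushforward P1 phi]_x g x)%E.
  by apply: eq_measure_integral => A mA _; exact/esym/phiE.
have tr g : measurable_fun [set: T2] g -> P2.-integrable [set: T2] (EFin \o g) ->
    P1.-integrable [set: T1] (EFin \o (fun w => g (phi w))).
  move=> mg /integrableP[_]; rewrite pE ge0_integral_pushforward//; last first.
    by apply: measurableT_comp => //; exact/measurable_EFinP.
  by move=> ig; apply/integrableP; split => //; apply/measurable_EFinP; exact: measurableT_comp.
have a1 : all_moments P1 (fun w => f (phi w)).
  split; first exact: measurableT_comp.
  move=> k; apply: (tr (fun x => `|f x| ^+ k)); last exact: af.2.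
  by apply: measurable_funX; exact: measurableT_comp.
split => //; apply: EFin_inj; rewrite -!integral_ex// pE.
rewrite (@integral_pushforward _ _ _ _ _ phi mphi P1 setT (EFin \o f))//.
  exact/measurable_EFinP.
exact: tr (all_moments_integrable af).
Qed.

Context {d : measure_display} {T : measurableType d} (P : probability T R).
Local Notation PP := ((P \x P)%E : probability (T * T)%type R).

Let PPE A B : measurable A -> measurable B -> PP (A `*` B) = (P A * P B)%E.
Proof. exact: product_measure1E. Qed.

Lemma fst_moments f : all_moments P f ->
  all_moments PP (fun w => f w.1) /\ ex PP (fun w => f w.1) = ex P f.
Proof.
apply: transfer_moments => [|A mA]; first exact: measurable_fst.
have -> : fst @^-1` A = A `*` [set: T].
  by apply/seteqP; split => [[x y]|[x y] []].
rewrite PPE// probability_setT mule1//.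
Qed.

Lemma snd_moments f : all_moments P f ->
  all_moments PP (fun w => f w.2) /\ ex PP (fun w => f w.2) = ex P f.
Proof.
apply: transfer_moments => [|A mA]; first exact: measurable_snd.
have -> : snd @^-1` A = [set: T] `*` A.
  by apply/seteqP; split => [[x y]|[x y] []].
rewrite PPE// probability_setT mul1e//.
Qed.

Lemma ex_prod f g : all_moments P f -> all_moments P g ->
  ex PP (fun w => f w.1 * g w.2) = ex P f * ex P g.
Proof.
move=> af ag; have [a1 e1] := fst_moments af; have [a2 e2] := snd_moments ag.
rewrite ex_independentM// ?e1 ?e2// => A B mA mB.
have mfA : measurable (f @^-1` A).
  by rewrite -[X in measurable X]setTI; apply: (all_moments_measurable af).
have mgB : measurable (g @^-1` B).
  by rewrite -[X in measurable X]setTI; apply: (all_moments_measurable ag).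
have -> : (fun w : T * T => f w.1) @^-1` A = (f @^-1` A) `*` [set: T].
  by apply/seteqP; split => [[x y]|[x y] []].
have -> : (fun w : T * T => g w.2) @^-1` B = [set: T] `*` (g @^-1` B).
  by apply/seteqP; split => [[x y]|[x y] []].
rewrite -setXI setIT setTI !PPE// !probability_setT.
by rewrite mule1 mul1e.
Qed.

Variables (N : nat) (x : 'I_N -> T -> R).
Hypothesis gx : gaussian_family P x.
Let ax := gx.1.
Let V (c : 'I_N -> R) := ex P (fun w => (\sum_i c i * x i w) ^+ 2).

Lemma ex_prod_gaussian (a b : 'I_N -> R) k :
  ex PP (fun w => (\sum_i a i * x i w.1 + \sum_i b i * x i w.2) ^+ k) =
  (gaussian_moment k)%:R * (V a + V b) ^+ k./2.
Proof.
have al c : all_moments P (fun w => \sum_i c i * x i w) by exact: all_moments_lin.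
transitivity (ex PP (fun w => \sum_(j < k.+1) 'C(k, j)%:R *
   ((\sum_i a i * x i w.1) ^+ (k - j) * (\sum_i b i * x i w.2) ^+ j))).
  by apply: eq_ex => w; rewrite exprDn; apply: eq_bigr => j _; rewrite mulr_natl.
rewrite -gaussian_moment_binomial ex_sum => [|j _]; last first.
  apply/all_momentsZ/all_momentsM.
    by have [] := fst_moments (all_moments_exp (k - j) (al a)).
  by have [] := snd_moments (all_moments_exp j (al b)).
apply: eq_bigr => j _; rewrite exZ; last first.
  apply/all_momentsM.
    by have [] := fst_moments (all_moments_exp (k - j) (al a)).
  by have [] := snd_moments (all_moments_exp j (al b)).
by rewrite (ex_prod (all_moments_exp (k - j) (al a)) (all_moments_exp j (al b))) (gx.2 a) (gx.2 b).
Qed.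

(* The rotation ((x + x') / sqrt 2, (x - x') / sqrt 2) of an independent copy x'
   turns x^2 - x'^2 into twice a product of independent variables. *)
Let r2 : R := (Num.sqrt 2)^-1.
Let r2E : r2 ^+ 2 = 2^-1.
Proof. by rewrite /r2 exprVn sqr_sqrtr. Qed.

Let X (s : 'I_N + 'I_N) (w : T * T) : R :=
  match s with inl i => x i w.1 | inr i => x i w.2 end.
Let Y (s : 'I_N + 'I_N) (w : T * T) : R :=
  match s with inl i => r2 * (x i w.1 + x i w.2)
  | inr i => r2 * (x i w.1 - x i w.2) end.

Let aX s : all_moments PP (X s).
Proof.
by case: s => i; [have [] := fst_moments (ax i)|have [] := snd_moments (ax i)].
Qed.

Let aY s : all_moments PP (Y s).
Proof.
have a1 i : all_moments PP (fun w => x i w.1) by have [] := fst_moments (ax i).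
have a2 i : all_moments PP (fun w => x i w.2) by have [] := snd_moments (ax i).
by case: s => i; apply: all_momentsZ; [exact: all_momentsD|exact: all_momentsB].
Qed.

Let VE a b : V (fun i => r2 * (a i + b i)) + V (fun i => r2 * (a i - b i)) =
  V a + V b.
Proof.
have al c : all_moments P (fun w => (\sum_i c i * x i w) ^+ 2).
  exact/all_moments_exp/all_moments_lin.
rewrite /V -!exD//; apply: eq_ex => w.
set p := \sum_i a i * x i w; set q := \sum_i b i * x i w.
have -> : \sum_i r2 * (a i + b i) * x i w = r2 * (p + q).
  by rewrite -big_split mulr_sumr; apply: eq_bigr => i _ /=; ring.
have -> : \sum_i r2 * (a i - b i) * x i w = r2 * (p - q).
  by rewrite -sumrB mulr_sumr; apply: eq_bigr => i _ /=; ring.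
by rewrite !exprMn r2E; field.
Qed.

Let XY (s : seq ('I_N + 'I_N)) :
  ex PP (fun w => \prod_(i <- s) X i w) = ex PP (fun w => \prod_(i <- s) Y i w).
Proof.
apply: polarization => // c k.
pose a i := c (inl i); pose b i := c (inr i).
have sumE (Z : 'I_N + 'I_N -> T * T -> R) w : \sum_s c s * Z s w =
    \sum_i a i * Z (inl i) w + \sum_i b i * Z (inr i) w.
  by rewrite big_sumType.
under eq_ex do rewrite sumE; under [RHS]eq_ex do rewrite sumE.
rewrite ex_prod_gaussian -VE -ex_prod_gaussian; apply: eq_ex => w.
congr (_ ^+ _); rewrite -!big_split; apply: eq_bigr => i _ /=.
by rewrite /Y; ring.
Qed.

Lemma quadratic_moment p :
  ex P (fun w => (\sum_i x i w ^+ 2 - \sum_i ex P (fun v => x i v ^+ 2)) ^+ (2 * p.+1))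
  <= 2 ^+ (2 * p.+1) * (gaussian_moment (2 * p.+1))%:R ^+ 2 *
     (\sum_i \sum_j ex P (fun w => x i w * x j w) ^+ 2) ^+ p.+1.
Proof.
pose c := \sum_i ex P (fun v => x i v ^+ 2).
pose Q w := \sum_i x i w ^+ 2 - c.
have aQ : all_moments P Q.
  apply: all_momentsB; last exact: all_moments_cst.
  by apply: all_moments_sum => i _; exact: all_moments_exp.
have Q0 : ex P Q = 0.
  rewrite /Q exB ?ex_cst; last exact: all_moments_cst.
    by rewrite ex_sum ?subrr// => i _; exact: all_moments_exp.
  by apply: all_moments_sum => i _; exact: all_moments_exp.
set n := (2 * p.+1)%N.
have [aQ1 eQ1] := fst_moments aQ; have [aQ2 eQ2] := snd_moments aQ.
apply: (@le_trans _ _ (ex PP (fun w => (Q w.1 - Q w.2) ^+ n))).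
  have [_ <-] := fst_moments (all_moments_exp n aQ).
  have e0 : ex PP (fun w => Q w.1 ^+ (2 * p).+1 * Q w.2) = 0.
    by rewrite (ex_prod (all_moments_exp _ aQ) aQ) Q0 mulr0.
  have [aQ1n _] := fst_moments (all_moments_exp n aQ).
  have [aQ1n' _] := fst_moments (all_moments_exp (2 * p).+1 aQ).
  have am : all_moments PP (fun w => n%:R * (Q w.1 ^+ (2 * p).+1 * Q w.2)).
    by apply: all_momentsZ; exact: all_momentsM.
  have -> : ex PP (fun w => Q w.1 ^+ n) =
      ex PP (fun w => Q w.1 ^+ n - n%:R * (Q w.1 ^+ (2 * p).+1 * Q w.2)).
    by rewrite exB// exZ ?e0 ?mulr0 ?subr0//; exact: all_momentsM.
  apply: le_ex; first exact: all_momentsB.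
    by apply: all_moments_exp; exact: all_momentsB.
  by move=> w; exact: even_power_tangent.
have -> : ex PP (fun w => (Q w.1 - Q w.2) ^+ n) =
    2 ^+ n * ex PP (fun w => (\sum_i X (inl i) w * X (inr i) w) ^+ n).
  transitivity (2 ^+ n * ex PP (fun w => (\sum_i Y (inl i) w * Y (inr i) w) ^+ n)).
    rewrite -exZ; last first.
      by apply: all_moments_exp; apply: all_moments_sum => i _; exact: all_momentsM.
    apply: eq_ex => w; rewrite -exprMn mulr_sumr; congr (_ ^+ _).
    have E (a b : R) : a - c - (b - c) = a - b by ring.
    rewrite /Q E -sumrB; apply: eq_bigr => i _.
    rewrite /Y; transitivity (2 * r2 ^+ 2 * (x i w.1 ^+ 2 - x i w.2 ^+ 2)); last by ring.
    by rewrite r2E; field.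
  congr (_ * _); rewrite !ex_sum_mul_exp//; apply: eq_bigr => f _.
  have E (Z : 'I_N + 'I_N -> T * T -> R) w :
    \prod_(k < n) Z (inl (f k)) w * \prod_(k < n) Z (inr (f k)) w =
    \prod_(i <- [seq inl (f k) | k : 'I_n] ++ [seq inr (f k) | k : 'I_n]) Z i w.
    by rewrite big_cat !big_image.
  by under eq_ex do rewrite E; under [RHS]eq_ex do rewrite E; rewrite XY.
rewrite -mulrA ler_wpM2l ?exprn_ge0//.
have gX (h : 'I_N -> 'I_N + 'I_N) b : (forall i, h i = if b then inl i else inr i) ->
    gaussian_family PP (fun i => X (h i)).
  move=> hE; split => [i|cc k]; first exact: aX.
  have E w : \sum_i cc i * X (h i) w = (fun v => \sum_i cc i * x i v) (if b then w.1 else w.2).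
    by apply: eq_bigr => i _; rewrite hE; case: (b).
  under eq_ex do rewrite E; under [in RHS]eq_ex do rewrite E.
  have al m : all_moments P (fun v => (\sum_i cc i * x i v) ^+ m).
    exact/all_moments_exp/all_moments_lin.
  case: (b).
    by rewrite (fst_moments (al k)).2 (fst_moments (al 2%N)).2 gx.2.
  by rewrite (snd_moments (al k)).2 (snd_moments (al 2%N)).2 gx.2.
have [g1 g2] := (gX inl true (fun=> erefl), gX inr false (fun=> erefl)).
apply: le_trans (bilinear_moment _ _ g1 g2 _ _) _ => //.
  move=> m f g /=.
  have a1 : all_moments P (fun v => \prod_(k < m) x (f k) v) by exact: all_moments_prod.
  have a2 : all_moments P (fun v => \prod_(k < m) x (g k) v) by exact: all_moments_prod.
  by rewrite (ex_prod a1 a2) (fst_moments a1).2 (snd_moments a2).2.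
rewrite le_eqVlt; apply/orP; left; apply/eqP; congr (_ * _ ^+ _).
apply: eq_bigr => i _; apply: eq_bigr => j _ /=.
have am := all_momentsM (ax i) (ax j).
by rewrite (fst_moments am).2 (snd_moments am).2 expr2.
Qed.

End Decoupling.

Section PowerConcavity.
Context {R : realType}.
Variable h : R.
Hypothesis h_gt0 : 0 < h.
Hypothesis h_le1 : h <= 1.

Lemma powR_bernoulli (x : R) : 0 <= x -> x `^ h <= 1 + h * (x - 1).
Proof.
rewrite le_eqVlt => /predU1P[<-|x0]; first by rewrite powR0 ?gt_eqF//; move: h_le1; lra.
rewrite /powR gt_eqF//; set u := ln x; set E := expR (h * u).
have e1 : x = E * expR ((1 - h) * u).
  by rewrite -expRD -mulrDl addrCA subrr addr0 mul1r lnK.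
have e2 : 1 = E * expR (- (h * u)) by rewrite -expRD subrr expR0.
have E0 : 0 < E by exact: expR_gt0.
have g1 : E * (1 + (1 - h) * u) <= x by rewrite [leRHS]e1 ler_pM2l// expR_ge1Dx.
have g2 : E * (1 - h * u) <= 1 by rewrite [leRHS]e2 ler_pM2l// expR_ge1Dx.
have h1 : 0 <= 1 - h by rewrite subr_ge0.
apply: (@le_trans _ _ (h * x + (1 - h) * 1)); last by lra.
apply: le_trans (lerD (ler_wpM2l (ltW h_gt0) g1) (ler_wpM2l h1 g2)).
by rewrite le_eqVlt; apply/orP; left; apply/eqP; ring.
Qed.

Lemma powR_tangent (x y : R) : 0 <= x -> 0 < y ->
  x `^ h <= y `^ h + h * y `^ h / y * (x - y).
Proof.
move=> x0 y0; have y0' := ltW y0.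
have {1}-> : x = (x / y) * y by rewrite divfK ?gt_eqF.
rewrite powRM ?divr_ge0//.
apply: le_trans (ler_wpM2r (powR_ge0 _ _) (powR_bernoulli (divr_ge0 x0 y0'))) _.
rewrite le_eqVlt; apply/orP; left; apply/eqP; field.
by rewrite gt_eqF.
Qed.

Lemma powR_concave (u v z : R) : 0 <= u -> u <= z -> z <= v -> 0 < z ->
  (v - z) * u `^ h + (z - u) * v `^ h <= (v - u) * z `^ h.
Proof.
move=> u0 uz zv z0.
have v0 : 0 <= v by rewrite (le_trans u0)// (le_trans uz).
have a1 := powR_tangent u0 z0; have a2 := powR_tangent v0 z0.
set q := h * _ / _ in a1 a2.
have vz : 0 <= v - z by rewrite subr_ge0.
have zu : 0 <= z - u by rewrite subr_ge0.
apply: le_trans (lerD (ler_wpM2l vz a1) (ler_wpM2l zu a2)) _.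
by rewrite le_eqVlt; apply/orP; left; apply/eqP; ring.
Qed.

Lemma powR_increment (x y c : R) : 0 <= x -> x <= y -> 0 <= c ->
  (y + c) `^ h - y `^ h <= (x + c) `^ h - x `^ h.
Proof.
move=> x0 xy; rewrite le_eqVlt => /predU1P[<-|c0]; first by rewrite !addr0 !subrr.
move: xy; rewrite le_eqVlt => /predU1P[<-//|xy].
have y0 : 0 < y by exact: le_lt_trans xy.
have xc0 : 0 < x + c by rewrite ltr_wpDl.
have L0 : 0 < y + c - x by rewrite subr_gt0 ltr_wpDr ?ltW.
have a1 := @powR_concave x (y + c) (x + c) x0 ltac:(lra) ltac:(lra) xc0.
have a2 := @powR_concave x (y + c) y x0 ltac:(lra) ltac:(lra) y0.
by rewrite -(ler_pM2l L0); lra.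
Qed.

Lemma powR_mono (x y : R) : 0 <= x -> x <= y -> x `^ h <= y `^ h.
Proof.
move=> x0 xy; apply: ge0_ler_powR; rewrite ?nnegrE ?(ltW h_gt0)//.
exact: le_trans xy.
Qed.

Lemma powR_subadditive (x y : R) : 0 <= x -> x <= y -> y `^ h - x `^ h <= (y - x) `^ h.
Proof.
move=> x0 xy; have := powR_increment (lexx 0) x0 (_ : 0 <= y - x).
rewrite subr_ge0 add0r powR0 ?gt_eqF// subr0 => /(_ xy).
by have -> : x + (y - x) = y by ring.
Qed.

(* The covariance of fractional Brownian motion over [a, b] and [c, d], up to
   the factor 1/2; psi x = |x|^2H. *)
Definition psi (x : R) := `|x| `^ h.
Definition incr_cov (a b c d : R) :=
  2^-1 * (psi (b - c) + psi (a - d) - psi (b - d) - psi (a - c)).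

Lemma psiN x : psi (- x) = psi x.
Proof. by rewrite /psi normrN. Qed.

Lemma psiB x y : psi (x - y) = psi (y - x).
Proof. by rewrite -psiN opprB. Qed.

Lemma psi0 : psi 0 = 0.
Proof. by rewrite /psi normr0 powR0// gt_eqF. Qed.

Lemma psi_ge0 x : 0 <= psi x.
Proof. exact: powR_ge0. Qed.

Lemma psi_pos x : 0 <= x -> psi x = x `^ h.
Proof. by move=> x0; rewrite /psi ger0_norm. Qed.

Lemma psi1 : psi 1 = 1.
Proof. by rewrite /psi normr1 powR1. Qed.

Lemma psiM x y : psi (x * y) = psi x * psi y.
Proof. by rewrite /psi normrM powRM. Qed.

Lemma incr_covC a b c d : incr_cov a b c d = incr_cov c d a b.
Proof.
rewrite /incr_cov (psiB b c) (psiB a d) (psiB b d) (psiB a c).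
by congr (_ * _); ring.
Qed.

Lemma incr_covDr a b c d e : incr_cov a b c d + incr_cov a b d e = incr_cov a b c e.
Proof. by rewrite /incr_cov; ring. Qed.

Lemma incr_cov_id a b : incr_cov a b a b = psi (b - a).
Proof. by rewrite /incr_cov !subrr psi0 (psiB a b); field. Qed.

Lemma incr_cov_shift t a b c d :
  incr_cov (t + a) (t + b) (t + c) (t + d) = incr_cov a b c d.
Proof.
have E x y : t + x - (t + y) = x - y by ring.
by rewrite /incr_cov !E.
Qed.

Lemma incr_cov_scale t a b c d :
  incr_cov (t * a) (t * b) (t * c) (t * d) = psi t * incr_cov a b c d.
Proof. by rewrite /incr_cov -!mulrBr !psiM; ring. Qed.

Lemma incr_cov_disjoint a b c d : a <= b -> b <= c -> c <= d ->
  incr_cov a b c d <= 0.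
Proof.
move=> ab bc cd; rewrite /incr_cov (psiB b c) (psiB a d) (psiB b d) (psiB a c).
have [p1 p2 p3 p4] : [/\ 0 <= c - b, 0 <= d - a, 0 <= d - b & 0 <= c - a].
  by split; lra.
rewrite !psi_pos//.
have := @powR_increment (c - b) (c - a) (d - c).
rewrite !subr_ge0 lerD2l lerN2 => /(_ bc ab cd).
have -> : c - a + (d - c) = d - a by ring.
have -> : c - b + (d - c) = d - b by ring.
by lra.
Qed.

Lemma incr_cov_disjoint' a b c d : a <= b -> d <= a -> c <= d ->
  incr_cov a b c d <= 0.
Proof. by move=> ab da cd; rewrite incr_covC; exact: incr_cov_disjoint. Qed.

Lemma sum_incr_cov a b (t : nat -> R) m n : (m <= n)%N ->
  \sum_(m <= k < n) incr_cov a b (t k) (t k.+1) = incr_cov a b (t m) (t n).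
Proof.
elim: n => [|n ih].
  by rewrite leqn0 => /eqP ->; rewrite big_geq// /incr_cov; ring.
rewrite leq_eqVlt => /predU1P[->|].
  by rewrite big_geq// /incr_cov; ring.
by rewrite ltnS => mn; rewrite big_nat_recr//= ih// incr_covDr.
Qed.

End PowerConcavity.

Section CovarianceSums.
Context {R : realType}.
Variable h : R.
Hypothesis h_gt : 2^-1 < h.
Hypothesis h_le1 : h <= 1.

Let h_gt0 : 0 < h. Proof. by apply: lt_trans h_gt. Qed.
Local Notation psi := (psi h).
Local Notation incr_cov := (incr_cov h).
Local Notation rr i j :=
  (incr_cov (i : nat)%:R i.+1%:R (j : nat)%:R j.+1%:R).

Let psiS m : psi (m%:R : R) <= psi m.+1%:R.
Proof. by rewrite !psi_pos//; apply: powR_mono => //; rewrite ler_nat. Qed.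

Let psiS1 m : psi (m.+1%:R : R) - psi m%:R <= 1.
Proof.
rewrite !psi_pos//; have := @powR_subadditive _ h h_gt0 h_le1 m%:R m.+1%:R (ler0n _ _).
by rewrite ler_nat leqnSn -natrB// subSnn powR1; exact.
Qed.

Let rr_id i : rr i i = 1.
Proof. by rewrite incr_cov_id// -natrB// subSnn psi1. Qed.

Let rr_lt (i j : nat) : (i < j)%N -> rr i j <= 0.
Proof. by move=> ij; apply: incr_cov_disjoint => //; rewrite ler_nat. Qed.

Let rr_gt (i j : nat) : (j < i)%N -> rr i j <= 0.
Proof. by move=> ij; apply: incr_cov_disjoint' => //; rewrite ler_nat. Qed.

Let natB (i j : nat) : (i <= j)%N -> psi (i%:R - j%:R) = psi (j - i)%:R.
Proof. by move=> ij; rewrite psiB natrB. Qed.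

Let rr_ne (i j : nat) : i != j -> rr i j <= 0.
Proof. by rewrite neq_ltn => /orP[/rr_lt|/rr_gt]. Qed.

Let sum_rr (i n : nat) : (i < n)%N -> -1 <= \sum_(j < n | j != i :> nat) rr i j.
Proof.
move=> ni; have -> : \sum_(j < n | j != i :> nat) rr i j =
    incr_cov i%:R i.+1%:R 0%:R i%:R + incr_cov i%:R i.+1%:R i.+1%:R n%:R.
  rewrite -(@sum_incr_cov _ h _ _ (fun k => k%:R) _ _ (leq0n i)).
  rewrite -(@sum_incr_cov _ h _ _ (fun k => k%:R) _ _ ni).
  rewrite -(big_mkord (fun j => j != i) (fun j => rr i j)).
  rewrite (big_cat_nat (n := i))//=; last exact: ltnW.
  rewrite [X in _ + X]big_ltn_cond//= eqxx /=; congr (_ + _).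
    rewrite big_nat_cond [RHS]big_nat_cond; apply: eq_bigl => j.
    by case: ltngtP => //; rewrite !andbT.
  rewrite big_nat_cond [RHS]big_nat_cond; apply: eq_bigl => j.
  by case: ltngtP; rewrite ?andbF ?andbT//.
rewrite /incr_cov !subr0 !subrr (psi0 h_gt0) -(natrB _ (leqnSn i)) subSnn psi1.
have -> : psi (i%:R - i.+1%:R) = 1 by rewrite natB// subSnn psi1.
rewrite !natB//; last exact: ltnW.
have := psiS i; have := psiS (n - i.+1)%N.
by rewrite -subSn// subSS; lra.
Qed.

Let rr_sqr i j n : i != j -> (i < n)%N -> (j < n)%N -> rr i j ^+ 2 <= - rr i j.
Proof.
move=> ij ni nj; have := sum_rr ni; rewrite (bigD1 (Ordinal nj)) 1?eq_sym//=.
set S := \sum_(_ < _ | _) _ => S1.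
have S0 : S <= 0 by apply: sumr_le0 => k /andP[ki _]; apply: rr_ne; rewrite eq_sym.
have r0 := rr_ne ij.
have : -1 <= rr i j by lra.
rewrite expr2 => r1; rewrite -subr_ge0.
have -> : - rr i j - rr i j * rr i j = - rr i j * (1 + rr i j) by ring.
by rewrite mulr_ge0//; lra.
Qed.

Lemma sum_cov_sqr_off n (i : nat) : (i < n)%N ->
  \sum_(j < n | j != i :> nat) rr i j ^+ 2 <= 1.
Proof.
move=> ni; apply: (@le_trans _ _ (\sum_(j < n | j != i :> nat) - rr i j)).
  by apply: ler_sum => j ji; apply: (@rr_sqr _ _ n) => //; rewrite eq_sym.
by rewrite sumrN lerNl; exact: sum_rr.
Qed.

Lemma sum_cov_sqr n : \sum_(i < n) \sum_(j < n) rr i j ^+ 2 <= 2 * n%:R.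
Proof.
apply: (@le_trans _ _ (\sum_(i < n) (2 : R))); last by rewrite sumr_const card_ord mulr_natr.
apply: ler_sum => i _; rewrite (bigD1 i)//= rr_id expr1n.
have := sum_cov_sqr_off (ltn_ord i).
rewrite (eq_bigl (fun j : 'I_n => j != i))//.
by lra.
Qed.

End CovarianceSums.

Section LevyAreaCovariance.
Context {R : realType}.
Variable h : R.
Hypothesis h_gt : 2^-1 < h.
Hypothesis h_le1 : h <= 1.

Let h_gt0 : 0 < h. Proof. by apply: lt_trans h_gt. Qed.
Let theta : R := 2 * h - 1.
Let theta_gt0 : 0 < theta. Proof. by move: h_gt; rewrite /theta; lra. Qed.
Let theta_le1 : theta <= 1. Proof. by move: h_le1; rewrite /theta; lra. Qed.
Local Notation psi := (psi h).
Local Notation incr_cov := (incr_cov h).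
Local Notation rr i j :=
  (incr_cov (i : nat)%:R i.+1%:R (j : nat)%:R j.+1%:R).
Local Notation alpha m := (psi m.+1%:R - psi m%:R : R).

Let alpha_ge0 m : 0 <= alpha m.
Proof. by rewrite subr_ge0 !psi_pos//; apply: powR_mono => //; rewrite ler_nat. Qed.

Let alpha_dec m : alpha m.+1 <= alpha m.
Proof.
have := @powR_increment _ h h_gt0 h_le1 m%:R m.+1%:R 1 (ler0n _ _) _ ler01.
rewrite ler_nat leqnSn !natr1 => /(_ isT).
by rewrite !psi_pos.
Qed.

Let alpha_sqr k : alpha k ^+ 2 <= (k.+1%:R `^ theta - k%:R `^ theta) / theta.
Proof.
have k0 : 0 < k.+1%:R :> R by rewrite ltr0n.
have a1 : alpha k <= k.+1%:R `^ h / k.+1%:R.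
  rewrite !psi_pos// ler_pdivlMr//.
  have [->|kp] := posnP k; first by rewrite powR0 ?gt_eqF// subr0 mulr1.
  have kp' : 0 < k%:R :> R by rewrite ltr0n.
  have := @powR_concave _ h h_gt0 h_le1 0 k.+1%:R k%:R (lexx 0) (ltW kp') _ kp'.
  rewrite ler_nat leqnSn powR0 ?gt_eqF// => /(_ isT).
  by rewrite -[k.+1%:R]natr1; lra.
have a2 := @powR_tangent _ theta theta_gt0 theta_le1 k%:R k.+1%:R (ler0n _ _) k0.
have e : k.+1%:R `^ theta = (k.+1%:R `^ h) ^+ 2 / k.+1%:R.
  rewrite /theta powRB ?pnatr_eq0 ?implybT// powRr1// -powR_mulrn ?powR_ge0//.
  by rewrite -powRrM [h * _]mulrC.
rewrite ler_pdivlMr// mulrC.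
have : alpha k ^+ 2 <= (k.+1%:R `^ h / k.+1%:R) ^+ 2.
  by rewrite lerXn2r ?nnegrE ?alpha_ge0// divr_ge0// powR_ge0.
have -> : (k.+1%:R `^ h / k.+1%:R) ^+ 2 = k.+1%:R `^ theta / k.+1%:R :> R.
  by rewrite e; field; rewrite gt_eqF.
move=> /(ler_wpM2l (ltW theta_gt0)) /le_trans; apply.
have e1 : k%:R - k.+1%:R = -1 :> R by rewrite -[k.+1%:R]natr1; ring.
rewrite mulrA; move: a2; rewrite e1 mulrN1; set Q := theta * _ / _ => a2.
by rewrite lerBrDl -lerBrDr.
Qed.

Let sum_alpha_sqr M : \sum_(k < M) alpha k ^+ 2 <= M%:R `^ theta / theta.
Proof.
apply: (@le_trans _ _ (\sum_(k < M) (k.+1%:R `^ theta - k%:R `^ theta) / theta)).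
  by apply: ler_sum => k _; exact: alpha_sqr.
rewrite -mulr_suml ler_pM2r ?invr_gt0//.
rewrite -(big_mkord xpredT (fun k => k.+1%:R `^ theta - k%:R `^ theta)).
by rewrite telescope_sumr// powR0 ?subr0// gt_eqF.
Qed.

Let G m : R := psi m%:R * (2^-1 * (alpha m.-1 - alpha m)).

Let G_ge0 m : 0 <= G m.
Proof.
rewrite /G mulr_ge0 ?psi_ge0// mulr_ge0// subr_ge0.
by case: m => [|m] //=; exact: alpha_dec.
Qed.

Let sum_G M : \sum_(k < M) G k.+1 <= M%:R `^ theta / theta / 2.
Proof.
have -> : \sum_(k < M) G k.+1 =
    2^-1 * (\sum_(k < M) alpha k ^+ 2 - psi M%:R * alpha M).
  elim: M => [|M ih]; first by rewrite !big_ord0 psi0// mul0r subr0 mulr0.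
  by rewrite !big_ord_recr /= ih /G /=; field.
rewrite [leRHS]mulrC ler_pM2l ?invr_gt0//.
apply: le_trans (sum_alpha_sqr M).
by rewrite gerBl mulr_ge0 ?psi_ge0.
Qed.

Let rr_G (i j : nat) : (i < j)%N -> - rr i j * psi (j - i)%:R = G (j - i).
Proof.
move=> ij; rewrite /G mulrC; congr (_ * _).
have [m jE] : exists m, j = (i + m.+1)%N.
  by exists (j - i).-1; rewrite prednK ?subn_gt0// subnKC// ltnW.
rewrite jE addKn /=.
have -> : rr i (i + m.+1)%N = incr_cov 0 1 m.+1%:R m.+2%:R.
  by rewrite -[RHS](incr_cov_shift h i%:R) addr0 natr1 -!natrD !addnS.
rewrite /incr_cov !sub0r !psiN -[1]/(1%:R) psiB -natrB// subn1.
by rewrite (psiB h 1%:R) -natrB// subn1 /=; field.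
Qed.

Let rr_C (i j : nat) : rr i j = rr j i. Proof. exact: incr_covC. Qed.

Let cov0 (u v : nat) := incr_cov 0 u%:R 0 v%:R.

Let cov0_diff (u v : nat) : - psi (u%:R - v%:R) <= cov0 u v - cov0 u u.
Proof.
rewrite /cov0 /incr_cov !subr0 !sub0r !psiN !subrr !(psi0 h_gt0).
have u0 := ler0n R u; have v0 := ler0n R v.
have [uv|vu] := leP (u%:R : R) v%:R.
  have uv' : 0 <= (v%:R - u%:R : R) by rewrite subr_ge0.
  rewrite (psiB h u%:R) (psi_pos h uv') (psi_pos h u0) (psi_pos h v0).
  have := powR_mono h_gt0 u0 uv.
  have := powR_ge0 (v%:R - u%:R : R) h; lra.
have vu' : 0 <= (u%:R - v%:R : R) by rewrite subr_ge0 ltW.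
rewrite (psi_pos h vu') (psi_pos h u0) (psi_pos h v0).
have := powR_subadditive h_gt0 h_le1 v0 (ltW vu).
by lra.
Qed.

Let sum_G_dist (u M : nat) : (u < M)%N ->
  \sum_(v < M | v != u :> nat) - rr u v * psi (u%:R - v%:R) <= M%:R `^ theta / theta.
Proof.
move=> uM.
have GM n : (n <= M)%N -> \sum_(k < n) G k.+1 <= M%:R `^ theta / theta / 2.
  move=> nM; apply: le_trans (sum_G M).
  rewrite -!(big_mkord xpredT (fun k => G k.+1)) (big_cat_nat (n := n) (p := M))//=.
  by rewrite lerDl sumr_ge0.
have e2 : M%:R `^ theta / theta =
    M%:R `^ theta / theta / 2 + M%:R `^ theta / theta / 2 :> R by field; rewrite gt_eqF.
rewrite -(big_mkord (fun v => v != u) (fun v => - rr u v * psi (u%:R - v%:R))).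
rewrite (big_cat_nat (n := u))//=; last exact: ltnW.
rewrite [X in _ + X]big_ltn_cond//= eqxx /= e2.
apply: lerD.
  apply: le_trans (GM u (ltnW uM)).
  rewrite (reindex_inj rev_ord_inj) /=.
  rewrite -(big_mkord xpredT (fun k => G (u - k.+1).+1)).
  rewrite big_nat_cond [leRHS]big_nat_cond le_eqVlt; apply/orP; left; apply/eqP.
  apply: eq_big => k; first by case: ltngtP; rewrite ?andbF ?andbT.
  move=> /andP[/andP[_ ku] _].
  by rewrite rr_C subnSK// -rr_G// natrB// ltnW.
apply: le_trans (GM (M - u.+1)%N (leq_subr _ _)).
rewrite -(big_mkord xpredT (fun k => G k.+1)) -{1}[u.+1]add0n big_addn.
rewrite big_nat_cond [leRHS]big_nat_cond le_eqVlt; apply/orP; left; apply/eqP.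
apply: eq_big => k.
  rewrite [(_ == u)%N](_ : _ = false) ?andbT//.
  by rewrite addnS -addSn; apply/negbTE; rewrite -{2}(add0n u) eqn_add2r.
move=> /andP[/andP[_ kM] _].
have uk : (u < k + u.+1)%N by rewrite addnS ltnS leq_addl.
rewrite (psiB h u%:R) -natrB; last exact: ltnW.
by rewrite rr_G// addnS -addSn addnK.
Qed.

Lemma diagonal_block (M : nat) :
  \sum_(u < M) \sum_(v < M) cov0 u v * rr u v <= (1 + theta^-1) * psi M%:R ^+ 2.
Proof.
have rr_ne (u v : nat) : v != u -> rr u v <= 0.
  rewrite neq_ltn => /orP[vu|uv].
    by apply: incr_cov_disjoint'; rewrite ?ler_nat.
  by apply: incr_cov_disjoint; rewrite ?ler_nat.
have nn M' : M'%:R * (M'%:R `^ theta / theta) = theta^-1 * psi M'%:R ^+ 2 :> R.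
  rewrite psi_pos//; have [->|m0] := posnP M'.
    by rewrite mul0r powR0 ?gt_eqF// expr0n /= mulr0.
  have m0' : 0 < M'%:R :> R by rewrite ltr0n.
  rewrite -powR_mulrn ?powR_ge0// -powRrM /theta [h * _]mulrC.
  rewrite powRB ?pnatr_eq0 -?lt0n ?m0 ?implybT// powRr1//.
  by field; rewrite -/theta !gt_eqF.
apply: (@le_trans _ _ (\sum_(u < M) (psi M%:R * incr_cov u%:R u.+1%:R 0 M%:R +
    M%:R `^ theta / theta))).
  apply: ler_sum => u _.
  have -> : \sum_(v < M) cov0 u v * rr u v = cov0 u u * \sum_(v < M) rr u v +
      \sum_(v < M | v != u) (cov0 u u - cov0 u v) * - rr u v.
    rewrite mulr_sumr [in RHS](bigD1 u)//= [LHS](bigD1 u)//= -addrA -big_split /=.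
    by congr (_ + _); apply: eq_bigr => v _; ring.
  apply: lerD.
    rewrite -(big_mkord xpredT (fun v => rr u v)).
    rewrite (@sum_incr_cov _ h _ _ (fun k => k%:R) _ _ (leq0n M)).
    have c0 : 0 <= incr_cov u%:R u.+1%:R 0 M%:R.
      rewrite /incr_cov !subr0 (psiB h u%:R) (psiB h u.+1%:R) -!natrB//; last exact: ltnW.
      rewrite mulr_ge0// !psi_pos//.
      have p1 : u%:R `^ h <= u.+1%:R `^ h :> R by apply: powR_mono => //; rewrite ler_nat.
      have p2 : (M - u.+1)%:R `^ h <= (M - u)%:R `^ h :> R.
        by apply: powR_mono => //; rewrite ler_nat leq_sub2l.
      by lra.
    apply: ler_wpM2r => //; rewrite /cov0 incr_cov_id// subr0 !psi_pos//.
    by apply: powR_mono => //; rewrite ler_nat ltnW.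
  apply: le_trans (sum_G_dist (ltn_ord u)).
  apply: ler_sum => v vu; rewrite mulrC; apply: ler_wpM2l.
    by rewrite oppr_ge0; exact: rr_ne.
  by have := cov0_diff u v; lra.
rewrite big_split /= -mulr_sumr sumr_const card_ord -[X in _ + X]mulr_natl nn.
under eq_bigr do rewrite incr_covC.
rewrite -(big_mkord xpredT (fun u => incr_cov 0 M%:R u%:R u.+1%:R)).
rewrite (@sum_incr_cov _ h _ _ (fun k => k%:R) _ _ (leq0n M)) incr_cov_id//.
by rewrite subr0 mulrDl mul1r expr2.
Qed.

Lemma incr_cov_mono (a b c d : R) b' d' : a <= b -> b <= b' -> b' <= c -> c <= d ->
  d <= d' -> incr_cov a b' c d' <= incr_cov a b c d.
Proof.
move=> ab bb bc cd dd.
have -> : incr_cov a b' c d' = incr_cov a b c d + incr_cov a b d d' + incr_cov b b' c d'.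
  by rewrite /incr_cov; ring.
rewrite -addrA gerDl; have : incr_cov a b d d' <= 0.
  by apply: incr_cov_disjoint => //; lra.
have : incr_cov b b' c d' <= 0 by apply: incr_cov_disjoint => //; lra.
by lra.
Qed.

Let cell (M c : nat) : R := (c * M)%:R.

Lemma off_diagonal_block (M c c' : nat) : (c < c')%N ->
  \sum_(u < M) \sum_(v < M)
    incr_cov (cell M c) (c * M + u)%:R (cell M c') (c' * M + v)%:R *
    rr (c * M + u) (c' * M + v) <= psi M%:R ^+ 2 * rr c c' ^+ 2.
Proof.
move=> cc; pose K := psi M%:R * rr c c'.
have KE : incr_cov (cell M c) (cell M c.+1) (cell M c') (cell M c'.+1) = K.
  by rewrite /K /cell !natrM ![_ * M%:R]mulrC incr_cov_scale.
have cM : (c * M + M <= c' * M)%N by rewrite addnC -mulSn leq_mul2r cc orbT.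
have rr0 u v : (u < M)%N -> rr (c * M + u) (c' * M + v) <= 0.
  move=> uM; apply: incr_cov_disjoint; rewrite ?ler_nat// -addnS.
  by rewrite (leq_trans _ (leq_addr _ _))// (leq_trans _ cM)// leq_add2l.
apply: (@le_trans _ _ (\sum_(u < M) \sum_(v < M) K * rr (c * M + u) (c' * M + v))).
  apply: ler_sum => u _; apply: ler_sum => v _.
  apply: ler_wnM2r; first exact: rr0.
  rewrite -KE; apply: incr_cov_mono; rewrite ler_nat ?leq_addr//.
  - by rewrite mulSn addnC leq_add2r ltnW.
  - by rewrite mulSn addnC.
  - by rewrite mulSn addnC leq_add2r ltnW.
under eq_bigr do rewrite -mulr_sumr.
rewrite -mulr_sumr -exprMn -/K expr2 le_eqVlt; apply/orP; left; apply/eqP.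
congr (_ * _); rewrite -KE /cell.
transitivity (\sum_(u < M) incr_cov (c * M + u)%:R (c * M + u.+1)%:R
    (cell M c') (cell M c'.+1)).
  apply: eq_bigr => u _.
  rewrite -(big_mkord xpredT (fun v => rr (c * M + u) (c' * M + v))).
  under eq_bigr do rewrite -!addnS.
  rewrite (@sum_incr_cov _ h _ _ (fun k => (c' * M + k)%:R) _ _ (leq0n M)).
  by rewrite addn0 /cell mulSn [(M + _)%N]addnC.
under eq_bigr do rewrite incr_covC.
rewrite -(big_mkord xpredT (fun u => incr_cov _ _ (c * M + u)%:R (c * M + u.+1)%:R)).
rewrite (@sum_incr_cov _ h _ _ (fun k => (c * M + k)%:R) _ _ (leq0n M)) incr_covC.
by rewrite addn0 mulSn [(M + _)%N]addnC.
Qed.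

Lemma levy_cov_sum (N M : nat) :
  \sum_(c < N) \sum_(c' < N) \sum_(u < M) \sum_(v < M)
    incr_cov (cell M c) (c * M + u)%:R (cell M c') (c' * M + v)%:R *
    rr (c * M + u) (c' * M + v) <= (2 + theta^-1) * N%:R * psi M%:R ^+ 2.
Proof.
apply: (@le_trans _ _ (\sum_(c < N) (2 + theta^-1) * psi M%:R ^+ 2)); last first.
  by rewrite sumr_const card_ord -mulr_natr le_eqVlt; apply/orP; left; apply/eqP; ring.
apply: ler_sum => c _; rewrite (bigD1 c)//=.
have -> : (2 + theta^-1) * psi M%:R ^+ 2 =
  (1 + theta^-1) * psi M%:R ^+ 2 + psi M%:R ^+ 2 by ring.
apply: lerD.
  apply: le_trans (diagonal_block M); rewrite le_eqVlt; apply/orP; left; apply/eqP.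
  apply: eq_bigr => u _; apply: eq_bigr => v _.
  rewrite /cov0 /cell -!addnS !natrD -[RHS]mulr1 -(incr_cov_shift h (c * M)%:R 0).
  by rewrite -[in RHS](incr_cov_shift h (c * M)%:R u%:R) addr0 mulr1.
apply: (@le_trans _ _ (\sum_(c' < N | c' != c) psi M%:R ^+ 2 * rr c c' ^+ 2)).
  apply: ler_sum => c' cc'.
  have : (c != c')%N by rewrite eq_sym.
  rewrite neq_ltn => /orP[lt|gt]; first exact: off_diagonal_block.
  rewrite exchange_big /= rr_C; apply: le_trans (off_diagonal_block M gt).
  rewrite le_eqVlt; apply/orP; left; apply/eqP.
  apply: eq_bigr => v _; apply: eq_bigr => u _.
  by rewrite incr_covC [X in _ * X]incr_covC.
rewrite -mulr_sumr -[leRHS]mulr1 ler_wpM2l ?sqr_ge0//.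
exact: (sum_cov_sqr_off h_gt h_le1 (ltn_ord c)).
Qed.

End LevyAreaCovariance.

Section FractionalBrownianMotion.
Context {R : realType} {disp : measure_display} {T : measurableType disp}.
Variables (P : probability T R) (H : R) (B : R -> {RV P >-> R}).
Hypothesis H_gt0 : 0 < H.
Hypothesis hB : fbm H B.
Local Notation h := (2 * H).

Let h_neq0 : h != 0. Proof. by rewrite mulf_neq0// gt_eqF. Qed.

Lemma fbm_lin_law k (t c : 'I_k -> R) : (forall i, 0 <= t i <= 1) ->
  gaussian_law P (fun w => \sum_(i < k) c i * B (t i) w).
Proof. by have [_ g _ _] := hB; exact: g. Qed.

Lemma fbm_all_moments t : 0 <= t <= 1 -> all_moments P (B t).
Proof.
move=> t01.
have g : gaussian_law P (B t).
  have := fbm_lin_law (k := 1) (fun=> 1) (fun=> t01); congr gaussian_law.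
  by apply/funext => w; rewrite big_ord1 mul1r.
have mB : measurable_fun [set: T] (B t) by [].
by have [m [s []]] := gaussian_law_moments mB g.
Qed.

Lemma fbm_ex t : 0 <= t <= 1 -> ex P (B t) = 0.
Proof.
move=> t01; have [_ _ e0 _] := hB; apply: EFin_inj.
rewrite -integral_ex; last exact: fbm_all_moments.
by have := e0 t t01; rewrite unlock.
Qed.

Lemma fbm_exM s t : 0 <= s <= 1 -> 0 <= t <= 1 ->
  ex P (fun w => B s w * B t w) = fbm_cov H s t.
Proof.
move=> s01 t01; have [_ _ e0 cv] := hB; apply: EFin_inj.
rewrite -integral_ex; last by apply: all_momentsM; exact: fbm_all_moments.
rewrite -(cv s t s01 t01) [in RHS]unlock !e0//= unlock.
have E (x y : R) : x * y = (x - 0) * (y - 0) by rewrite !subr0.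
by apply: eq_integral => w _; exact: (congr1 EFin (E _ _)).
Qed.

Section Increments.
Variables (N : nat) (a b : 'I_N -> R).
Hypothesis a01 : forall i, 0 <= a i <= 1.
Hypothesis b01 : forall i, 0 <= b i <= 1.

Definition increments (i : 'I_N) (w : T) : R := B (b i) w - B (a i) w.

Lemma increments_all_moments i : all_moments P (increments i).
Proof. by apply: all_momentsB; exact: fbm_all_moments. Qed.

Lemma increments_ex i : ex P (increments i) = 0.
Proof. by rewrite exB ?fbm_ex ?subrr//; exact: fbm_all_moments. Qed.

Lemma increments_exM i j : ex P (fun w => increments i w * increments j w) =
  incr_cov h (a i) (b i) (a j) (b j).
Proof.
have am s t : 0 <= s <= 1 -> 0 <= t <= 1 -> all_moments P (fun w => B s w * B t w).
  by move=> s01 t01; apply: all_momentsM; exact: fbm_all_moments.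
transitivity (ex P (fun w => (B (b i) w * B (b j) w - B (b i) w * B (a j) w)
    - (B (a i) w * B (b j) w - B (a i) w * B (a j) w))).
  by apply: eq_ex => w; rewrite /increments; ring.
rewrite exB; [|by apply: all_momentsB; exact: am..].
rewrite exB; [|exact: am..]. rewrite exB; [|exact: am..].
rewrite !fbm_exM// /fbm_cov /incr_cov /psi.
rewrite (distrC (b j)) (distrC (b j)) (distrC (a j)) (distrC (a j)).
by ring.
Qed.

Lemma increments_gaussian : gaussian_family P increments.
Proof.
split; first exact: increments_all_moments.
move=> c; apply: centered_gaussian_moment.
- by apply: all_moments_measurable; apply: all_moments_lin; exact: increments_all_moments.
- pose t (k : 'I_(N + N)) := match fintype.split k with inl i => b i | inr i => a i end.
  pose e (k : 'I_(N + N)) := match fintype.split k with inl i => c i | inr i => - c i end.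
  have t01 k : 0 <= t k <= 1 by rewrite /t; case: (fintype.split k).
  have := fbm_lin_law e t01; congr gaussian_law; apply/funext => w.
  rewrite big_split_ord /= -big_split /=; apply: eq_bigr => i _.
  rewrite /e /t /increments.
  have -> : fintype.split (lshift N i) = inl i by rewrite -[lshift N i]/(unsplit (inl i)) unsplitK.
  have -> : fintype.split (rshift N i) = inr i by rewrite -[rshift N i]/(unsplit (inr i)) unsplitK.
  by ring.
rewrite ex_sum => [|i _]; last exact/all_momentsZ/increments_all_moments.
rewrite big1// => i _; rewrite exZ ?increments_ex ?mulr0//.
exact: increments_all_moments.
Qed.

End Increments.
End FractionalBrownianMotion.

Section IndependentProcesses.
Context {R : realType} {disp : measure_display} {T : measurableType disp}.
Variables (P : probability T R) (d : nat) (X : 'I_d -> R -> {RV P >-> R}).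
Hypothesis X_indep : independent_processes P X.

Definition process_measurable (Y : R -> T -> R) (f : T -> R) :=
  forall A : set R, measurable A -> process_sigma_algebra Y (f @^-1` A).

Lemma process_measurable_prod (Y : R -> T -> R) n (a b : 'I_n -> R) :
  (forall i, 0 <= a i <= 1) -> (forall i, 0 <= b i <= 1) ->
  process_measurable Y (fun w => \prod_(k < n) (Y (b k) w - Y (a k) w)).
Proof.
move=> a01 b01 A mA.
set G := [set E | exists t S, [/\ 0 <= t <= 1, measurable S & E = Y t @^-1` S]].
pose TG := g_sigma_algebraType G.
have mY t : 0 <= t <= 1 -> measurable_fun [set: TG] (Y t : TG -> R).
  move=> t01 _ S mS; rewrite setTI; apply: sub_sigma_algebra.
  by exists t, S.
have mf : measurable_fun [set: TG]
    ((fun w => \prod_(k < n) (Y (b k) w - Y (a k) w)) : TG -> R).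
  apply: measurable_prod => k _.
  by apply: measurable_funB; exact: mY.
by have := mf measurableT A mA; rewrite setTI.
Qed.

Lemma ex_process_independent (i j : 'I_d) f g : i != j ->
  all_moments P f -> all_moments P g ->
  process_measurable (X i) f -> process_measurable (X j) g ->
  ex P (fun w => f w * g w) = ex P f * ex P g.
Proof.
move=> ij af ag mf mg; apply: ex_independentM => // A C mA mC.
pose E k := if k == i then f @^-1` A else if k == j then g @^-1` C else [set: T].
have ji : (j == i) = false by rewrite eq_sym (negbTE ij).
have Em k : process_sigma_algebra (X k) (E k).
  rewrite /E; case: eqVneq => [->|_]; first exact: mf.
  case: eqVneq => [->|_]; first exact: mg.
  have := @measurableT _ (g_sigma_algebraType
    [set E | exists t S, [/\ 0 <= t <= 1, measurable S & E = X k t @^-1` S]]).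
  exact.
have := X_indep Em.
rewrite (bigD1 i)//= (bigD1 j) ?ji//= big1 => [|k /andP[ki kj]]; last first.
  by rewrite /E (negbTE ki) (negbTE kj) probability_setT.
rewrite mule1 /E eqxx ji eqxx => <-; congr (P _).
apply/seteqP; split => [w [Aw Cw] k _ /=|w Ew].
  by case: eqVneq => // _; case: eqVneq.
have := Ew i I; rewrite eqxx => Ai; have := Ew j I; rewrite ji eqxx.
by move=> Cj.
Qed.

Lemma increments_independent (H : R) (hX : forall i, fbm H (X i)) (i j : 'I_d)
    N M (a b : 'I_N -> R) (c e : 'I_M -> R) : i != j ->
  (forall i, 0 <= a i <= 1) -> (forall i, 0 <= b i <= 1) ->
  (forall i, 0 <= c i <= 1) -> (forall i, 0 <= e i <= 1) ->
  moment_independent P (increments (X i) a b) (increments (X j) c e).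
Proof.
move=> ij a01 b01 c01 e01 n f g; apply: (ex_process_independent ij).
- by apply: all_moments_prod => k _; exact: (increments_all_moments (hX i) a01 b01).
- by apply: all_moments_prod => k _; exact: (increments_all_moments (hX j) c01 e01).
- by apply: (@process_measurable_prod _ n (fun k => a (f k)) (fun k => b (f k))).
- by apply: (@process_measurable_prod _ n (fun k => c (g k)) (fun k => e (g k))).
Qed.

End IndependentProcesses.

Lemma sum_mulnE {V : nmodType} (N M : nat) (F : nat -> V) :
  \sum_(v < N * M) F v = \sum_(c < N) \sum_(u < M) F (c * M + u)%N.
Proof.
elim: N => [|N ih]; first by rewrite !big_ord0.
rewrite big_ord_recr /= -ih -(big_mkord xpredT F) mulSn addnC.
rewrite (big_cat_nat (n := (N * M)%N)) ?leq_addr//= big_mkord; congr (_ + _).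
by rewrite -{1}[(N * M)%N]add0n big_addn addKn big_mkord; apply: eq_bigr => u _; rewrite addnC.
Qed.

Section GridMoments.
Context {R : realType} {disp : measure_display} {T : measurableType disp}.
Variables (P : probability T R) (d : nat) (X : 'I_d -> R -> {RV P >-> R}) (H : R).
Hypothesis hH_gt : 4^-1 < H.
Hypothesis hH_le : H <= 2^-1.
Hypothesis hX : forall i, fbm H (X i).
Hypothesis X_indep : independent_processes P X.
Local Notation h := (2 * H).

Let h_gt : 2^-1 < h. Proof. by move: hH_gt; lra. Qed.
Let h_le1 : h <= 1. Proof. by move: hH_le; lra. Qed.
Let h_gt0 : 0 < h. Proof. by apply: lt_trans h_gt. Qed.

Definition grid (n k : nat) : R := k%:R / n%:R.

Lemma grid01 n k : (k <= n)%N -> 0 <= grid n k <= 1.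
Proof.
move=> kn; rewrite /grid divr_ge0//=.
have [->|n0] := posnP n; first by rewrite invr0 mulr0.
by rewrite ler_pdivrMr ?ltr0n// mul1r ler_nat.
Qed.

Lemma gridM n M k : (0 < M)%N -> grid (n * M) (k * M) = grid n k.
Proof.
move=> M0; rewrite /grid !natrM -mulf_div divff ?mulr1//.
by rewrite pnatr_eq0 -lt0n.
Qed.

Lemma incr_cov_grid n p (a b c e : nat) :
  incr_cov h (grid n (p + a)) (grid n (p + b)) (grid n (p + c)) (grid n (p + e)) =
  psi h n%:R^-1 * incr_cov h (a%:R : R) b%:R c%:R e%:R.
Proof.
by rewrite /grid !natrD ![_ / _]mulrC incr_cov_scale incr_cov_shift.
Qed.

Definition dX (n : nat) (i : 'I_d) (k : nat) (w : T) : R :=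
  X i (grid n k.+1) w - X i (grid n k) w.

Lemma fbm_increment_moment i s t p : 0 <= s <= 1 -> 0 <= t <= 1 ->
  ex P (fun w => (X i t w - X i s w) ^+ (2 * p)) =
  (gaussian_moment (2 * p))%:R * psi h (t - s) ^+ p.
Proof.
move=> s01 t01.
pose U := increments (X i) (fun _ : 'I_1 => s) (fun _ : 'I_1 => t).
have [_ /(_ (fun=> 1) (2 * p)%N)] := increments_gaussian (hX i)
  (fun _ : 'I_1 => s01) (fun _ : 'I_1 => t01).
have E w : \sum_(k < 1) 1 * U k w = X i t w - X i s w by rewrite big_ord1 mul1r.
under eq_ex do rewrite E; move=> ->.
have -> : ((2 * p)./2 = p)%N by rewrite mul2n doubleK.
congr (_ * _ ^+ _); rewrite -(incr_cov_id h_gt0 s t).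
rewrite -(increments_exM (hX i) (fun _ : 'I_1 => s01) (fun _ : 'I_1 => t01) ord0 ord0).
by apply: eq_ex => w; rewrite E expr2.
Qed.

Lemma fbm_increment_sqr i n k : (k < n)%N ->
  ex P (fun w => dX n i k w ^+ 2) = psi h n%:R^-1.
Proof.
move=> kn; have := fbm_increment_moment i 1 (grid01 (ltnW kn)) (grid01 kn).
rewrite muln1 expr1 /= muln1 mul1r => ->.
by rewrite /grid -mulrBl -natrB// subSnn mul1r.
Qed.

Section Sums.
Variables (n p N : nat).
Hypothesis pN : (p + N <= n)%N.

Let t01 k : (k <= N)%N -> 0 <= grid n (p + k) <= 1.
Proof. by move=> kN; apply: grid01; apply: leq_trans pN; rewrite leq_add2l. Qed.

Let a (k : 'I_N) := grid n (p + k).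
Let b (k : 'I_N) := grid n (p + k.+1).
Let a01 k : 0 <= a k <= 1. Proof. by apply: t01; exact: ltnW. Qed.
Let b01 k : 0 <= b k <= 1. Proof. exact: t01. Qed.

Let incE i k w : increments (X i) a b k w = dX n i (p + k) w.
Proof. by rewrite /increments /a /b /dX addnS. Qed.

Let sum_sqr : \sum_(k < N) \sum_(l < N) incr_cov h (a k) (b k) (a l) (b l) ^+ 2 <=
  2 * N%:R * psi h n%:R^-1 ^+ 2.
Proof.
have -> : \sum_(k < N) \sum_(l < N) incr_cov h (a k) (b k) (a l) (b l) ^+ 2 =
    psi h n%:R^-1 ^+ 2 * \sum_(k < N) \sum_(l < N)
      incr_cov h (k%:R : R) k.+1%:R l%:R l.+1%:R ^+ 2.
  rewrite mulr_sumr; apply: eq_bigr => k _; rewrite mulr_sumr; apply: eq_bigr => l _.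
  by rewrite incr_cov_grid exprMn.
by rewrite mulrC ler_wpM2r ?sqr_ge0// (sum_cov_sqr h_gt h_le1).
Qed.

Lemma quadratic_variation_moment (i j : 'I_d) q :
  ex P (fun w => (\sum_(k < N) (dX n i (p + k) w * dX n j (p + k) w -
    (i == j)%:R * psi h n%:R^-1)) ^+ (2 * q.+1)) <=
  2 ^+ (2 * q.+1) * (gaussian_moment (2 * q.+1))%:R ^+ 2 *
    (2 * N%:R * psi h n%:R^-1 ^+ 2) ^+ q.+1.
Proof.
have S0 : 0 <= \sum_(k < N) \sum_(l < N) incr_cov h (a k) (b k) (a l) (b l) ^+ 2.
  by apply: sumr_ge0 => k _; apply: sumr_ge0 => l _; exact: sqr_ge0.
have SS : (\sum_(k < N) \sum_(l < N) incr_cov h (a k) (b k) (a l) (b l) ^+ 2) ^+ q.+1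
    <= (2 * N%:R * psi h n%:R^-1 ^+ 2) ^+ q.+1.
  by apply: lerXn2r; rewrite ?nnegrE//; apply: le_trans S0 _.
have [<-|ij] := eqVneq i j.
  have := quadratic_moment (increments_gaussian (hX i) a01 b01) q.
  have E w : (\sum_k increments (X i) a b k w ^+ 2 -
      \sum_k ex P (fun v => increments (X i) a b k v ^+ 2)) =
      \sum_(k < N) (dX n i (p + k) w * dX n i (p + k) w - 1 * psi h n%:R^-1).
    rewrite -sumrB; apply: eq_bigr => k _; rewrite incE expr2 mul1r; congr (_ - _).
    rewrite -(fbm_increment_sqr i (k := p + k) (n := n)).
      by apply: eq_ex => v; rewrite incE.
    by rewrite (leq_trans _ pN)// ltn_add2l.
  under eq_ex do rewrite E; move=> /le_trans; apply.
  rewrite ler_wpM2l ?mulr_ge0 ?exprn_ge0//; apply: le_trans SS.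
  rewrite le_eqVlt; apply/orP; left; apply/eqP; congr (_ ^+ _).
  by apply: eq_bigr => k _; apply: eq_bigr => l _; rewrite (increments_exM (hX i)).
have E w : \sum_(k < N) (dX n i (p + k) w * dX n j (p + k) w - 0 * psi h n%:R^-1) =
    \sum_k increments (X i) a b k w * increments (X j) a b k w.
  by apply: eq_bigr => k _; rewrite mul0r subr0 !incE.
under eq_ex do rewrite E.
have aU i' := increments_all_moments (hX i') a01 b01.
have := bilinear_moment (aU i) (aU j) (increments_gaussian (hX i) a01 b01)
  (increments_gaussian (hX j) a01 b01)
  (increments_independent X_indep hX ij a01 b01 a01 b01) q.
move=> /le_trans; apply.
apply: (@le_trans _ _ ((gaussian_moment (2 * q.+1))%:R ^+ 2 *
  (2 * N%:R * psi h n%:R^-1 ^+ 2) ^+ q.+1)).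
  rewrite ler_wpM2l ?exprn_ge0//; apply: le_trans SS.
  rewrite le_eqVlt; apply/orP; left; apply/eqP; congr (_ ^+ _).
  apply: eq_bigr => k _; apply: eq_bigr => l _.
  by rewrite (increments_exM (hX i))// (increments_exM (hX j))// expr2.
rewrite -[leRHS]mulrA ler_peMl//; last by rewrite exprn_ege1// ler1n.
by rewrite mulr_ge0 ?exprn_ge0// mulr_ge0 ?mulr_ge0 ?exprn_ge0 ?psi_ge0.
Qed.

Definition riemann_area M (i j : 'I_d) (c : nat) (w : T) : R :=
  \sum_(u < M) (X i (grid (n * M) (c * M + u)) w - X i (grid (n * M) (c * M)) w) *
    dX (n * M) j (c * M + u) w.

Lemma riemann_area_moment M (i j : 'I_d) q : (0 < n)%N -> (0 < M)%N -> i != j ->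
  ex P (fun w => (\sum_(c < N) riemann_area M i j (p + c) w) ^+ (2 * q.+1)) <=
  (gaussian_moment (2 * q.+1))%:R ^+ 2 *
    ((2 + (2 * h - 1)^-1) * N%:R * psi h n%:R^-1 ^+ 2) ^+ q.+1.
Proof.
move=> n0 M0 ij.
have tM01 k : (k <= N * M)%N -> 0 <= grid (n * M) (p * M + k) <= 1.
  move=> kN; apply: grid01; apply: (@leq_trans (p * M + N * M)).
    by rewrite leq_add2l.
  by rewrite -mulnDl leq_mul2r pN orbT.
pose a1 (v : 'I_(N * M)) := grid (n * M) (p * M + v %/ M * M).
pose t1 (v : 'I_(N * M)) := grid (n * M) (p * M + v).
pose t2 (v : 'I_(N * M)) := grid (n * M) (p * M + v.+1).
have a101 v : 0 <= a1 v <= 1.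
  by apply: tM01; apply: leq_trans (leq_trunc_div v M) _; exact: ltnW.
have t101 v : 0 <= t1 v <= 1 by apply: tM01; exact: ltnW.
have t201 v : 0 <= t2 v <= 1 by exact: tM01.
have divE c u : (u < M)%N -> ((c * M + u) %/ M = c)%N.
  by move=> uM; rewrite divnMDl// divn_small ?addn0.
pose FU v w := X i (grid (n * M) (p * M + v)) w - X i (grid (n * M) (p * M + v %/ M * M)) w.
pose FV v w := X j (grid (n * M) (p * M + v.+1)) w - X j (grid (n * M) (p * M + v)) w.
have E w : \sum_(c < N) riemann_area M i j (p + c) w =
    \sum_v increments (X i) a1 t1 v w * increments (X j) t1 t2 v w.
  rewrite -[RHS]/(\sum_(v < N * M) FU v w * FV v w).
  rewrite (sum_mulnE N M (fun v => FU v w * FV v w)).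
  apply: eq_bigr => c _; apply: eq_bigr => u _.
  by rewrite /FU /FV /dX divE// mulnDl -!addnA -addnS.
under eq_ex do rewrite E.
have := bilinear_moment (increments_all_moments (hX i) a101 t101)
  (increments_all_moments (hX j) t101 t201) (increments_gaussian (hX i) a101 t101)
  (increments_gaussian (hX j) t101 t201)
  (increments_independent X_indep hX ij a101 t101 t101 t201) q.
move=> /le_trans; apply; rewrite ler_wpM2l ?exprn_ge0//.
have v0 := ex_ge0 P (fun w => sqr_ge0 (\sum_v increments (X i) a1 t1 v w * increments (X j) t1 t2 v w)).
rewrite bilinear_variance in v0; last 3 first.
- exact: (increments_all_moments (hX i) a101 t101).
- exact: (increments_all_moments (hX j) t101 t201).
- exact: (increments_independent X_indep hX ij a101 t101 t101 t201).
move: v0.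
have -> : \sum_k \sum_l ex P (fun w => increments (X i) a1 t1 k w * increments (X i) a1 t1 l w) *
    ex P (fun w => increments (X j) t1 t2 k w * increments (X j) t1 t2 l w) =
    psi h (n * M)%:R^-1 ^+ 2 * \sum_(c < N) \sum_(c' < N) \sum_(u < M) \sum_(v < M)
    incr_cov h ((c * M)%:R : R) (c * M + u)%:R (c' * M)%:R (c' * M + v)%:R *
    incr_cov h ((c * M + u)%:R : R) (c * M + u).+1%:R (c' * M + v)%:R (c' * M + v).+1%:R.
  pose F k l : R := incr_cov h ((k %/ M * M)%:R : R) k%:R (l %/ M * M)%:R l%:R *
    incr_cov h (k%:R : R) k.+1%:R l%:R l.+1%:R.
  transitivity (psi h (n * M)%:R^-1 ^+ 2 * \sum_(k < N * M) \sum_(l < N * M) F k l).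
    rewrite mulr_sumr; apply: eq_bigr => k _; rewrite mulr_sumr; apply: eq_bigr => l _.
    rewrite (increments_exM (hX i))// (increments_exM (hX j))// !incr_cov_grid.
    by rewrite /F; ring.
  congr (_ * _); rewrite (sum_mulnE N M (fun k => \sum_(l < N * M) F k l)).
  apply: eq_bigr => c _.
  under eq_bigr do rewrite (sum_mulnE N M (F _)).
  rewrite exchange_big /=; apply: eq_bigr => c' _; apply: eq_bigr => u _.
  by apply: eq_bigr => v _; rewrite /F !divE.
move=> v0; apply: lerXn2r; rewrite ?nnegrE//.
  rewrite mulr_ge0 ?sqr_ge0// mulr_ge0// addr_ge0// invr_ge0; move: h_gt; lra.
have := levy_cov_sum h_gt h_le1 N M.
move=> /(ler_wpM2l (sqr_ge0 (psi h (n * M)%:R^-1))) /le_trans; apply.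
rewrite le_eqVlt; apply/orP; left; apply/eqP.
have -> : psi h (n%:R^-1 : R) = psi h (n * M)%:R^-1 * psi h M%:R.
  by rewrite -psiM natrM invfM -mulrA mulVf ?mulr1// pnatr_eq0 -lt0n.
by ring.
Qed.

End Sums.
End GridMoments.

Section ConvergenceInProbability.
Context {R : realType} {disp : measure_display} {T : measurableType disp}.
Variable P : probability T R.
Implicit Types (Yn Zn : nat -> T -> R) (Y Z : T -> R).

Definition cvg_prob Yn Y := forall eps : R, 0 < eps ->
  P [set w | eps <= `|Yn n w - Y w|] @[n --> \oo] --> 0%E.

Lemma measurable_dev (f g : T -> R) (eps : R) : measurable_fun [set: T] f ->
  measurable_fun [set: T] g -> measurable [set w | eps <= `|f w - g w|].
Proof.
move=> mf mg; have mfg : measurable_fun [set: T] (fun w => `|f w - g w|).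
  by apply: measurableT_comp => //; exact: measurable_funB.
rewrite -[X in measurable X]setTI.
have -> : [set w | eps <= `|f w - g w|] = (fun w => `|f w - g w|) @^-1` `[eps, +oo[%classic.
  by apply/seteqP; split => w /=; rewrite in_itv/= andbT.
by apply: mfg => //; exact: measurable_itv.
Qed.

Lemma cvg_prob_cst Y : cvg_prob (fun=> Y) Y.
Proof.
move=> eps e0; rewrite (_ : [set w | _] = set0).
  by rewrite measure0; exact: cvg_cst.
by apply/seteqP; split => // w /=; rewrite subrr normr0 leNgt e0.
Qed.

Lemma cvg_probD Yn Zn Y Z :
  (forall n, measurable_fun [set: T] (Yn n)) ->
  (forall n, measurable_fun [set: T] (Zn n)) ->
  measurable_fun [set: T] Y -> measurable_fun [set: T] Z ->
  cvg_prob Yn Y -> cvg_prob Zn Z ->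
  cvg_prob (fun n w => Yn n w + Zn n w) (fun w => Y w + Z w).
Proof.
move=> mYn mZn mY mZ cY cZ eps e0.
have e20 : 0 < eps / 2 by rewrite divr_gt0.
apply: (@squeeze_cvge _ _ _ _ (cst 0%E) _ (fun n =>
  P [set w | (eps / 2 <= `|Yn n w - Y w|)%R] + P [set w | (eps / 2 <= `|Zn n w - Z w|)%R])%E).
- apply: nearW => n; rewrite measure_ge0 /=.
  have m1 := measurable_dev (eps / 2) (mYn n) mY.
  have m2 := measurable_dev (eps / 2) (mZn n) mZ.
  apply: le_trans (measureU2 P m1 m2).
  apply: le_measure; rewrite ?inE; [|exact: measurableU|].
    by apply: measurable_dev; exact: measurable_funD.
  move=> w /= ew.
  have [h|h] := leP (eps / 2) `|Yn n w - Y w|; first by left.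
  right => /=; have := ler_normD (Yn n w - Y w) (Zn n w - Z w).
  have -> : Yn n w - Y w + (Zn n w - Z w) = Yn n w + Zn n w - (Y w + Z w) by ring.
  by lra.
- exact: cvg_cst.
- by rewrite -[X in _ --> X]adde0; apply: cvgeD => //; [exact: cY|exact: cZ].
Qed.

Lemma cvg_prob_sum N (Yn : 'I_N -> nat -> T -> R) (Y : 'I_N -> T -> R) :
  (forall i n, measurable_fun [set: T] (Yn i n)) ->
  (forall i, measurable_fun [set: T] (Y i)) ->
  (forall i, cvg_prob (Yn i) (Y i)) ->
  cvg_prob (fun n w => \sum_i Yn i n w) (fun w => \sum_i Y i w).
Proof.
elim: N Yn Y => [|N ih] Yn Y mYn mY cY.
  have -> : (fun w => \sum_(i < 0) Y i w) = cst 0.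
    by apply/funext => w; rewrite big_ord0.
  have -> : (fun n w => \sum_(i < 0) Yn i n w) = fun=> cst 0.
    by apply/funext => n; apply/funext => w; rewrite big_ord0.
  exact: cvg_prob_cst.
have -> : (fun w => \sum_(i < N.+1) Y i w) =
    fun w => Y ord0 w + \sum_(i < N) Y (lift ord0 i) w.
  by apply/funext => w; rewrite big_ord_recl.
have -> : (fun n w => \sum_(i < N.+1) Yn i n w) =
    fun n w => Yn ord0 n w + \sum_(i < N) Yn (lift ord0 i) n w.
  by apply/funext => n; apply/funext => w; rewrite big_ord_recl.
apply: cvg_probD => //; last exact: ih.
- by move=> n; exact: measurable_sum.
- exact: measurable_sum.
Qed.

Lemma cvg_prob_unique Yn Y Z : (forall n, measurable_fun [set: T] (Yn n)) ->
  measurable_fun [set: T] Y -> measurable_fun [set: T] Z ->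
  cvg_prob Yn Y -> cvg_prob Yn Z -> {ae P, forall w, Y w = Z w}.
Proof.
move=> mYn mY mZ cY cZ.
have P0 (eps : R) : 0 < eps -> P [set w | eps <= `|Y w - Z w|] = 0%E.
  move=> e0; have e20 : 0 < eps / 2 by rewrite divr_gt0.
  apply/eqP; rewrite eq_le measure_ge0 andbT.
  have c0 : (P [set w | (eps / 2 <= `|Yn n w - Y w|)%R] +
      P [set w | (eps / 2 <= `|Yn n w - Z w|)%R] @[n --> \oo] --> 0)%E.
    by rewrite -[X in _ --> X]adde0; apply: cvgeD => //; [exact: cY|exact: cZ].
  rewrite -(cvg_lim _ c0)//; apply: lime_ge; first by apply/cvg_ex; exists 0%E.
  apply: nearW => n.
  have m1 := measurable_dev (eps / 2) (mYn n) mY.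
  have m2 := measurable_dev (eps / 2) (mYn n) mZ.
  apply: le_trans (measureU2 P m1 m2).
  apply: le_measure; rewrite ?inE; [exact: measurable_dev|exact: measurableU|].
  move=> w /= ew.
  have [h|h] := leP (eps / 2) `|Yn n w - Y w|; first by left.
  right => /=; have := ler_normD (Y w - Yn n w) (Yn n w - Z w).
  by rewrite (distrC (Y w)) addrA subrK; lra.
apply: (@negligibleS _ _ _ _ (\bigcup_k [set w | k.+1%:R^-1 <= `|Y w - Z w|])); last first.
  apply: negligible_bigcup => k; apply/negligibleP; first exact: measurable_dev.
  exact: P0.
move=> w /= YZ; have YZ0 : 0 < `|Y w - Z w| by rewrite normr_gt0 subr_eq0; apply/eqP.
have [k _ kP] := near_infty_natSinv_lt (PosNum YZ0).
by exists k => //=; apply: ltW; apply: kP => /=.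
Qed.

Lemma cvg_prob_moment Yn Y q (B : R) :
  (forall n, all_moments P (Yn n)) -> measurable_fun [set: T] Y ->
  (forall n, ex P (fun w => Yn n w ^+ (2 * q.+1)) <= B) ->
  cvg_prob Yn Y ->
  (\int[P]_w (Y w ^+ (2 * q.+1))%:E <= (2 ^+ (2 * q.+1) * B)%:E)%E.
Proof.
move=> aYn mY BYn cY; set k := (2 * q.+1)%N.
have ke (x : R) : x ^+ k = `|x| ^+ k.
  by rewrite -normrX ger0_norm// /k exprM exprn_ge0// sqr_ge0.
have xk0 (x : R) : 0 <= x ^+ k by rewrite ke exprn_ge0.
have mYk : measurable_fun [set: T] (fun w => Y w ^+ k) by exact: measurable_funX.
have trunc (m : nat) : (\int[P]_w (Num.min (Y w ^+ k) m%:R)%:E <= (2 ^+ k * B)%:E)%E.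
  apply/lee_addgt0Pr => e e0.
  pose dl := Num.min 1 (e / 2 ^+ k).
  have dl0 : 0 < dl by rewrite lt_min ltr01 divr_gt0// exprn_gt0.
  have dlk : 2 ^+ k * dl ^+ k <= e.
    rewrite mulrC -ler_pdivlMr ?exprn_gt0//.
    apply: (@le_trans _ _ dl); last by rewrite ge_min lexx orbT.
    rewrite -[leRHS]expr1 ler_wiXn2l ?(ltW dl0)//.
    by rewrite ge_min lexx.
  pose D n := [set w | dl <= `|Yn n w - Y w|].
  have mD n : measurable (D n) by apply: measurable_dev => //; exact: all_moments_measurable.
  have c0 : ((2 ^+ k * B)%:E + e%:E + m%:R%:E * P (D n) @[n --> \oo] -->
      (2 ^+ k * B)%:E + e%:E)%E.
    rewrite -[X in _ --> X]adde0; apply: cvgeD => //; first exact: cvg_cst.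
    rewrite -(mule0 m%:R%:E); apply: cvgeZl => //.
    exact: cY.
  rewrite -(cvg_lim _ c0)//; apply: lime_ge; first by apply/cvg_ex; eexists; exact: c0.
  apply: nearW => n.
  have aYk : all_moments P (fun w => 2 ^+ k * (Yn n w ^+ k + dl ^+ k)).
    apply: all_momentsZ; apply: all_momentsD; last exact: all_moments_cst.
    exact: all_moments_exp.
  apply: (@le_trans _ _ (\int[P]_w ((2 ^+ k * (Yn n w ^+ k + dl ^+ k))%:E +
      m%:R%:E * (\1_(D n) w)%:E))%E).
    apply: ge0_le_integral => //.
    - by move=> w _; rewrite lee_fin le_min xk0 ler0n.
    - by apply/measurable_EFinP; apply: measurable_minr.
    - apply: emeasurable_funD.
        by apply/measurable_EFinP; exact: all_moments_measurable aYk.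
      by apply: emeasurable_funM => //; apply/measurable_EFinP; exact: measurable_indic.
    move=> w _; rewrite -EFinM -EFinD lee_fin indicE.
    have [Dw|Dw] := boolP (w \in D n).
      rewrite mulr1 (le_trans (_ : _ <= m%:R)) ?ge_min ?lexx ?orbT//.
      by rewrite lerDr mulr_ge0 ?exprn_ge0// addr_ge0// exprn_ge0// ltW.
    rewrite mulr0 addr0 ge_min; apply/orP; left.
    have -> : Y w = Yn n w + (Y w - Yn n w) by rewrite addrC subrK.
    rewrite ke; apply: le_trans (normrXD_le _ _ _) _.
    rewrite ler_pM2l ?exprn_gt0// -ke lerD2l.
    apply: lerXn2r; rewrite ?nnegrE ?(ltW dl0)// distrC ltW// ltNge.
    by apply: contra Dw => ?; rewrite inE.
  have g1 w : (0 <= (2 ^+ k * (Yn n w ^+ k + dl ^+ k))%:E)%E.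
    by rewrite lee_fin mulr_ge0 ?exprn_ge0// addr_ge0// exprn_ge0// ltW.
  have mg1 : measurable_fun [set: T] (fun w => (2 ^+ k * (Yn n w ^+ k + dl ^+ k))%:E).
    by apply/measurable_EFinP; exact: all_moments_measurable aYk.
  have g2 w : (0 <= (m%:R : R)%:E * (\1_(D n) w)%:E)%E by rewrite mule_ge0.
  have mg2 : measurable_fun [set: T] (fun w => ((m%:R : R)%:E * (\1_(D n) w)%:E)%E).
    by apply: emeasurable_funM => //; apply/measurable_EFinP; exact: measurable_indic.
  rewrite ge0_integralD//.
  apply: leeD; last first.
    rewrite ge0_integralZl//; last by apply/measurable_EFinP; exact: measurable_indic.
    by rewrite integral_indic// setIT.
  rewrite integral_ex// -EFinD lee_fin exZ; last first.
    by apply: all_momentsD; [exact: all_moments_exp|exact: all_moments_cst].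
  rewrite exD ?ex_cst; [|exact: all_moments_exp|exact: all_moments_cst].
  by rewrite mulrDr lerD// ler_pM2l ?exprn_gt0.
have -> : (\int[P]_w (Y w ^+ k)%:E =
    lim (\int[P]_w (Num.min (Y w ^+ k) m%:R)%:E @[m --> \oo]))%E.
  rewrite -monotone_convergence//.
  - apply: eq_integral => w _; apply/esym/cvg_lim => //.
    apply: cvg_near_cst; near=> m; congr EFin; apply/min_idPl.
    by near: m; exact: nbhs_infty_ger.
  - by move=> m; apply/measurable_EFinP; exact: measurable_minr.
  - by move=> m w _; rewrite lee_fin le_min xk0 ler0n.
  - move=> w _ m1 m2 m12; rewrite lee_fin le_min !ge_min lexx /=.
    by rewrite ler_nat m12 orbT.
apply: lime_le; last by apply: nearW => m; exact: trunc.
apply: ereal_nondecreasing_is_cvgn => m1 m2 m12; apply: ge0_le_integral => //.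
- by move=> w _; rewrite lee_fin le_min xk0 ler0n.
- by apply/measurable_EFinP; exact: measurable_minr.
- by apply/measurable_EFinP; exact: measurable_minr.
- move=> w _; rewrite lee_fin le_min !ge_min lexx /=.
  by rewrite ler_nat m12 orbT.
Unshelve. all: by end_near. Qed.

End ConvergenceInProbability.

Section PiecewiseAffine.
Context {R : realType} (m : nat).
Implicit Types (x : R -> 'rV[R]_m).
Local Notation mu := (@lebesgue_measure R).
Local Notation gridR := (@grid R).

Inductive pwaffine x : R -> R -> Prop :=
| pwaffine_affine a b (v : 'rV[R]_m) : a <= b ->
    (forall u, a <= u <= b -> x u = x a + (u - a) *: v) -> pwaffine x a b
| pwaffine_cat a b c : pwaffine x a b -> pwaffine x b c -> pwaffine x a c.

Lemma pwaffine_le x a b : pwaffine x a b -> a <= b.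
Proof. by elim=> // {}a {}b c _ ab _; exact: le_trans. Qed.

Lemma pwaffine_sub x a b : pwaffine x a b ->
  forall s t, a <= s -> s <= t -> t <= b -> pwaffine x s t.
Proof.
elim=> {a b} [a b v ab xE|a b c ab ihab bc ihbc] s t as_ st tb.
  apply: (@pwaffine_affine _ _ _ v) => // u /andP[su ut].
  rewrite (xE u) ?(xE s) ?as_ ?(le_trans st)//; last first.
    by rewrite (le_trans as_ su) (le_trans ut tb).
  by rewrite -addrA -scalerDl; congr (_ + _ *: _); ring.
have [tb'|bt] := leP t b; first exact: ihab.
have [bs|sb] := leP b s; first exact: ihbc.
apply: (@pwaffine_cat _ _ b).
  by apply: ihab => //; exact: ltW.
by apply: ihbc => //; exact: ltW.
Qed.

Let dx x j := derive1 (fun u => x u 0 j).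

Lemma affine_derive1 x a b v j r :
  (forall u, a <= u <= b -> x u = x a + (u - a) *: v) -> a < r < b ->
  dx x j r = v 0 j.
Proof.
move=> xE /andP[ar rb]; rewrite /dx derive1E.
have nE : \near r, (fun u => x u 0 j) r = x a 0 j + (r - a) * v 0 j.
  near=> u; rewrite (xE u) ?mxE//; apply/andP; split; apply: ltW.
    by near: u; exact: lt_nbhsr.
  by near: u; exact: lt_nbhsl.
rewrite (near_eq_derive _ nE).
have -> : (fun r : R => x a 0 j + (r - a) * v 0 j) =
    cst (x a 0 j) + (v 0 j \*: (id - cst a)).
  by apply/funext => u; rewrite !fctE /GRing.scale/= mulrC.
have dd : is_derive r (1 : R) (cst (x a 0 j) + (v 0 j \*: (id - cst a)) : R -> R) (v 0 j).
  by apply: is_derive_eq; rewrite add0r subr0 /GRing.scale/= mulr1.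
by have [] := dd.
Unshelve. all: by end_near. Qed.

Lemma integrable_itvoo_cc (f : R -> R) a b : mu.-integrable `]a, b[ (EFin \o f) ->
  mu.-integrable `[a, b] (EFin \o f).
Proof.
move=> /integrableP[mf fin].
have mcc : measurable_fun `[a, b] (EFin \o f).
  apply/emeasurable_fun_itv_bndo_bndcP.
  exact/emeasurable_fun_itv_obnd_cbndP.
apply/integrableP; split => //.
by rewrite integral_itv_bndoo//; exact: measurableT_comp.
Qed.

Lemma affine_integrable x a b v (i j : 'I_m) c0 c1 : a <= b ->
  (forall u, a <= u <= b -> x u = x a + (u - a) *: v) ->
  mu.-integrable `[a, b] (EFin \o (fun r => (c0 + c1 * x r 0 i) * dx x j r)).
Proof.
move=> ab xE; apply: integrable_itvoo_cc.
pose g r := (c0 + c1 * (x a 0 i + (r - a) * v 0 i)) * v 0 j.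
have ig : mu.-integrable `[a, b] (EFin \o g).
  apply: continuous_compact_integrable; first exact: segment_compact.
  apply: continuous_subspaceT => r.
  apply: cvgM; last exact: cvg_cst.
  apply: cvgD; first exact: cvg_cst.
  apply: cvgM; first exact: cvg_cst.
  apply: cvgD; first exact: cvg_cst.
  apply: cvgM; last exact: cvg_cst.
  by apply: cvgB; [exact: cvg_id|exact: cvg_cst].
have ig' : mu.-integrable `]a, b[ (EFin \o g).
  apply: (integrableS _ _ _ ig) => //; exact: subset_itv_oo_cc.
apply: eq_integrable ig' => // r; rewrite inE/= in_itv/= => /andP[ar rb].
by rewrite /g /= (affine_derive1 _ xE) ?ar// (xE r) ?(ltW ar) ?(ltW rb)// !mxE.
Qed.

Lemma pwaffine_integrable x a b (i j : 'I_m) c0 c1 : pwaffine x a b ->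
  mu.-integrable `[a, b] (EFin \o (fun r => (c0 + c1 * x r 0 i) * dx x j r)).
Proof.
elim=> {a b} [a b v ab xE|a b c ab ihab bc ihbc]; first exact: (affine_integrable _ _ _ _ ab xE).
have ab' := pwaffine_le ab; have bc' := pwaffine_le bc.
set f := EFin \o _ in ihab ihbc *.
have ihbc' : mu.-integrable `]b, c] f.
  apply: (integrableS _ _ _ ihbc) => // r /=; rewrite !in_itv/= => /andP[br ->].
  by rewrite andbT ltW.
have -> : `[a, c]%classic = `[a, b]%classic `|` `]b, c]%classic :> set R.
  apply/seteqP; split => r /=; rewrite !in_itv/=.
    by move=> /andP[ar rc]; have [rb|br] := leP r b; [left|right]; apply/andP.
  move=> [|] /andP[u w]; apply/andP; split => //; [exact: le_trans bc'|].
  by rewrite ltW// (le_lt_trans ab').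
move: ihab ihbc' => /integrableP[m1 f1] /integrableP[m2 f2].
have mU : measurable_fun (`[a, b] `|` `]b, c]) f by apply/measurable_funU.
apply/integrableP; split => //.
rewrite ge0_integral_setU//; first exact: lte_add_pinfty.
  exact: measurableT_comp.
rewrite disj_set2E; apply/eqP/seteqP; split => // r /=; rewrite !in_itv/=.
by move=> [/andP[_ rb] /andP[br _]]; move: rb; rewrite leNgt br.
Qed.

Lemma Rintegral_split (f : R -> R) a b c : a <= b -> b <= c ->
  mu.-integrable `[a, c] (EFin \o f) ->
  \int[mu]_(r in `[a, c]) f r = \int[mu]_(r in `[a, b]) f r + \int[mu]_(r in `[b, c]) f r.
Proof.
move=> ab bc fi; have := @Rintegral_itvB _ f (BLeft a) (BRight c) b fi.
rewrite !bnd_simp => /(_ ab bc) /eqP; rewrite subr_eq => /eqP ->.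
rewrite addrC; congr (_ + _); apply: Rintegral_itv_obnd_cbnd.
apply: (integrableS _ _ _ fi) => // r /=; rewrite !in_itv/= => /andP[br ->].
by rewrite andbT ltW// (le_lt_trans ab).
Qed.


Lemma pwaffine_increment x a b j : pwaffine x a b ->
  \int[mu]_(r in `[a, b]) dx x j r = x b 0 j - x a 0 j.
Proof.
have i1 c d : pwaffine x c d -> mu.-integrable `[c, d] (EFin \o dx x j).
  move=> /(@pwaffine_integrable x c d j j 1 0); apply: eq_integrable => // r _ /=.
  by rewrite mul0r addr0 mul1r.
elim=> {a b} [a b v ab xE|a b c ab ihab bc ihbc]; last first.
  rewrite (@Rintegral_split _ a b c) ?(pwaffine_le ab) ?(pwaffine_le bc)//.
    by rewrite ihab ihbc; ring.
  exact/i1/(pwaffine_cat ab bc).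
have iab := i1 _ _ (pwaffine_affine ab xE).
have moo : measurable_fun `]a, b[ (EFin \o dx x j).
  have /integrableP[mcc _] := iab.
  by apply: measurable_funS mcc => //; exact: subset_itv_oo_cc.
rewrite /Rintegral (integral_itv_bndoo _ _ moo).
transitivity (fine (\int[mu]_(r in `]a, b[) (v 0 j)%:E)).
  congr fine; apply: eq_integral => r; rewrite inE/= in_itv/= => arb.
  by rewrite (affine_derive1 _ xE).
rewrite integral_cst//= lebesgue_measure_itv/= lte_fin.
rewrite (xE b) ?ab ?lexx//= !mxE.
move: ab; rewrite le_eqVlt => /predU1P[->|ab].
  by rewrite ltxx mule0/= subrr mul0r addr0 subrr.
by rewrite ab -EFinD -EFinM /= addrAC subrr add0r mulrC.
Qed.

Lemma path_integralE x s t i j : pwaffine x s t -> path_integral x s t i j =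
  \int[mu]_(r in `[s, t]) (x r 0 i * dx x j r) - x s 0 i * (x t 0 j - x s 0 j).
Proof.
move=> xst; rewrite -(pwaffine_increment j xst) -RintegralZl//; last first.
  move: (@pwaffine_integrable x s t j j 1 0 xst); apply: eq_integrable => // r _ /=.
  by rewrite mul0r addr0 mul1r.
rewrite -RintegralB//.
- by apply: eq_Rintegral => r _; rewrite /incr !mxE mulrBl.
- move: (@pwaffine_integrable x s t i j 0 1 xst); apply: eq_integrable => // r _ /=.
  by rewrite mul1r add0r.
move: (@pwaffine_integrable x s t j j (x s 0 i) 0 xst); apply: eq_integrable => // r _ /=.
by rewrite mul0r addr0.
Qed.

Lemma levy_area_chen x s u t i j : pwaffine x s u -> pwaffine x u t ->
  levy_area x s t i j = levy_area x s u i j + levy_area x u t i j +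
  2^-1 * ((x u 0 i - x s 0 i) * (x t 0 j - x u 0 j) -
          (x u 0 j - x s 0 j) * (x t 0 i - x u 0 i)).
Proof.
move=> su ut; have st := pwaffine_cat su ut.
have [J JE] : exists J : 'I_m -> 'I_m -> R -> R -> R, forall i' j' a b,
    \int[mu]_(r in `[a, b]) (x r 0 i' * dx x j' r) = J i' j' a b.
  by exists (fun i' j' a b => \int[mu]_(r in `[a, b]) (x r 0 i' * dx x j' r)).
have split i' j' : J i' j' s t = J i' j' s u + J i' j' u t.
  rewrite -!JE.
  apply: Rintegral_split; rewrite ?(pwaffine_le su) ?(pwaffine_le ut)//.
  move: (@pwaffine_integrable x s t i' j' 0 1 st); apply: eq_integrable => // r _ /=.
  by rewrite mul1r add0r.
rewrite !mxE (path_integralE _ _ st) (path_integralE _ _ st).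
rewrite (path_integralE _ _ su) (path_integralE _ _ su).
rewrite (path_integralE _ _ ut) (path_integralE _ _ ut) !JE !split.
by ring.
Qed.

Lemma levy_area_affine x a b v i j : a <= b ->
  (forall u, a <= u <= b -> x u = x a + (u - a) *: v) -> levy_area x a b i j = 0.
Proof.
move=> ab xE; rewrite mxE; apply/eqP; rewrite mulf_eq0 subr_eq0; apply/orP; right.
apply/eqP; rewrite /path_integral /Rintegral; apply: (congr1 fine).
have moo i' j' : measurable_fun `]a, b[
    (fun r => (incr x a r 0 i' * derive1 (fun u => x u 0 j') r)%:E).
  have /integrableP[mcc _] : mu.-integrable `[a, b]
      (EFin \o (fun r => (- x a 0 i' + 1 * x r 0 i') * dx x j' r)).
    exact: affine_integrable xE.
  have : measurable_fun `]a, b[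
      (EFin \o (fun r => (- x a 0 i' + 1 * x r 0 i') * dx x j' r)).
    by apply: measurable_funS mcc => //; exact: subset_itv_oo_cc.
  by congr measurable_fun; apply/funext => r /=; rewrite /incr !mxE mul1r addrC.
rewrite (integral_itv_bndoo _ _ (moo i j)) (integral_itv_bndoo _ _ (moo j i)).
apply: eq_integral => r.
rewrite inE/= in_itv/= => arb; rewrite -/(dx x j) -/(dx x i).
rewrite !(affine_derive1 _ xE)// /incr (xE r) ?mxE; last first.
  by case/andP: arb => ar rb; rewrite !ltW.
by congr EFin; ring.
Qed.

Lemma levy_area_refl x a i j : levy_area x a a i j = 0.
Proof.
apply: (@levy_area_affine _ _ _ 0) => // u /andP[au ua].
by rewrite scaler0 addr0; congr x; apply: le_anti; rewrite au ua.
Qed.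

Lemma pwaffine_refl x a : pwaffine x a a.
Proof.
apply: (@pwaffine_affine _ _ _ 0) => // u /andP[au ua].
by rewrite scaler0 addr0; congr x; apply: le_anti; rewrite au ua.
Qed.

Lemma levy_area_lipschitz x a b L i j : 0 <= L ->
  pwaffine x a b ->
  (forall k s t, a <= s -> s <= t -> t <= b -> `|x t 0 k - x s 0 k| <= L * (t - s)) ->
  `|levy_area x a b i j| <= L ^+ 2 * (b - a) ^+ 2.
Proof.
move=> L0; elim=> {a b} [a b v ab xE|a b c ab ihab bc ihbc] lip.
  by rewrite (levy_area_affine _ _ ab xE) normr0 mulr_ge0 ?sqr_ge0.
have ab' := pwaffine_le ab; have bc' := pwaffine_le bc.
rewrite (levy_area_chen _ _ ab bc).
have h1 := ihab (fun k s t as_ st tb => lip k s t as_ st (le_trans tb bc')).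
have h2 := ihbc (fun k s t as_ st tb => lip k s t (le_trans ab' as_) st tb).
have p k : `|x b 0 k - x a 0 k| <= L * (b - a) by exact: lip.
have q k : `|x c 0 k - x b 0 k| <= L * (c - b) by exact: lip.
have pq k l : `|(x b 0 k - x a 0 k) * (x c 0 l - x b 0 l)| <= L * (b - a) * (L * (c - b)).
  by rewrite normrM ler_pM.
apply: le_trans (ler_normD _ _) _; apply: le_trans (lerD (ler_normD _ _) (lexx _)) _.
rewrite [X in _ + X]normrM (ger0_norm (_ : 0 <= 2^-1))//.
have h3 := le_trans (ler_normB _ _) (lerD (pq i j) (pq j i)).
apply: le_trans (lerD (lerD h1 h2) (ler_wpM2l (_ : 0 <= 2^-1) h3)) _ => //.
rewrite -subr_ge0.
have -> : L ^+ 2 * (c - a) ^+ 2 - (L ^+ 2 * (b - a) ^+ 2 + L ^+ 2 * (c - b) ^+ 2 +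
  2^-1 * (L * (b - a) * (L * (c - b)) + L * (b - a) * (L * (c - b)))) =
  L ^+ 2 * ((b - a) * (c - b)) by field.
by rewrite mulr_ge0 ?sqr_ge0// mulr_ge0// subr_ge0.
Qed.

Section Grid.
Variables (M : nat) (y : R -> 'rV[R]_m) (z : nat -> 'rV[R]_m).
Hypothesis M_gt0 : (0 < M)%N.
Hypothesis yE : forall k u, (k < M)%N -> gridR M k <= u <= gridR M k.+1 ->
  y u = z k + (u - gridR M k) *: (M%:R *: (z k.+1 - z k)).

Lemma grid_le k l : (k <= l)%N -> gridR M k <= gridR M l.
Proof. by move=> kl; rewrite /grid ler_pM2r ?invr_gt0 ?ltr0n// ler_nat. Qed.

Lemma gridS k : gridR M k.+1 - gridR M k = M%:R^-1.
Proof. by rewrite /grid -mulrBl -natrB// subSnn mul1r. Qed.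

Lemma grid_node k : (k <= M)%N -> y (gridR M k) = z k.
Proof.
move=> kM; have [kM'|] := ltnP k M.
  by rewrite (yE kM') ?lexx ?grid_le// subrr scale0r addr0.
case: k kM => [|k] kM Mk; first by rewrite leqn0 in Mk; move: M_gt0; rewrite (eqP Mk).
rewrite (yE kM) ?lexx ?grid_le// gridS scalerA mulVf ?scale1r ?pnatr_eq0 -?lt0n//.
by rewrite addrC subrK.
Qed.

Lemma grid_affine k : (k < M)%N -> forall u, gridR M k <= u <= gridR M k.+1 ->
  y u = y (gridR M k) + (u - gridR M k) *: (M%:R *: (z k.+1 - z k)).
Proof. by move=> kM u ku; rewrite (yE kM ku) grid_node// ltnW. Qed.

Lemma grid_pwaffine p k : (p + k <= M)%N -> pwaffine y (gridR M p) (gridR M (p + k)).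
Proof.
elim: k => [|k ih]; first by rewrite addn0 => _; exact: pwaffine_refl.
rewrite addnS => pk; apply: (pwaffine_cat (ih (ltnW pk))).
by apply: (pwaffine_affine (grid_le (leqnSn _))); exact: grid_affine.
Qed.

Lemma grid_levy_area p k i j : (p + k <= M)%N ->
  levy_area y (gridR M p) (gridR M (p + k)) i j =
  2^-1 * \sum_(u < k) ((z (p + u)%N 0 i - z p 0 i) * (z (p + u).+1 0 j - z (p + u)%N 0 j) -
    (z (p + u)%N 0 j - z p 0 j) * (z (p + u).+1 0 i - z (p + u)%N 0 i)).
Proof.
elim: k => [|k ih] pk; first by rewrite addn0 levy_area_refl big_ord0 mulr0.
have pk' : (p + k <= M)%N by rewrite (leq_trans _ pk)// leq_add2l.
have pM : (p <= M)%N by rewrite (leq_trans _ pk')// leq_addr.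
rewrite addnS in pk *.
have c1 : pwaffine y (gridR M (p + k)) (gridR M (p + k).+1).
  by apply: (pwaffine_affine (grid_le (leqnSn _))); exact: grid_affine.
rewrite (levy_area_chen _ _ (grid_pwaffine pk') c1) ih//.
rewrite (levy_area_affine _ _ (grid_le (leqnSn _)) (grid_affine pk)) addr0.
by rewrite !grid_node// big_ord_recr /= [RHS]mulrDr.
Qed.

End Grid.

Lemma pl_interp_iota (M : nat) (z : nat -> 'rV[R]_m) a l k u : (0 < M)%N ->
  (a <= k < a + l)%N -> gridR M k <= u <= gridR M k.+1 ->
  pl_interp (gridR M a, z a) [seq (gridR M i, z i) | i <- iota a.+1 l] u =
  z k + (u - gridR M k) *: (M%:R *: (z k.+1 - z k)).
Proof.
move=> M0; have M0' : M%:R != 0 :> R by rewrite pnatr_eq0 -lt0n.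
elim: l a => [|l ih] a; first by rewrite addn0; case: ltngtP.
have fE b w : z b + ((w - gridR M b) / (gridR M b.+1 - gridR M b)) *: (z b.+1 - z b) =
    z b + (w - gridR M b) *: (M%:R *: (z b.+1 - z b)).
  by rewrite gridS// invrK scalerA.
move=> /andP[ak kal] /andP[ku uk] /=.
move: ak; rewrite leq_eqVlt => /predU1P[->|ak].
  by rewrite uk fE.
have [ua|ua] := leP u (gridR M a.+1); last first.
  by apply: ih; rewrite ?ku// ak /= addSnnS.
have kE : k = a.+1.
  apply/eqP; rewrite eqn_leq ak andbT.
  have := le_trans ku ua; rewrite /grid ler_pM2r ?invr_gt0 ?ltr0n// ler_nat//.
have uE : u = gridR M a.+1 by apply: le_anti; rewrite ua -kE ku.
rewrite fE kE uE subrr scale0r addr0 gridS// scalerA mulVf// scale1r.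
by rewrite addrC subrK.
Qed.

Definition uniform_partition (M : nat) : seq R := [seq gridR M k | k <- iota 1 M].

Lemma pl_along_uniform M x k u : (k < M)%N -> gridR M k <= u <= gridR M k.+1 ->
  pl_along (uniform_partition M) x u = x (gridR M k) +
    (u - gridR M k) *: (M%:R *: (x (gridR M k.+1) - x (gridR M k))).
Proof.
move=> kM ku; have M0 : (0 < M)%N by exact: leq_ltn_trans kM.
rewrite /pl_along /uniform_partition -map_comp.
have g0 : gridR M 0 = 0 by rewrite /grid mul0r.
rewrite -{1}g0 -{1}g0.
exact: (@pl_interp_iota M (fun k => x (gridR M k)) 0 M k u M0).
Qed.

Lemma uniform_itv_partition M : (0 < M)%N -> itv_partition 0 1 (uniform_partition M).
Proof.
move=> M0; have M0' : M%:R != 0 :> R by rewrite pnatr_eq0 -lt0n.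
have g0 : gridR M 0 = 0 by rewrite /grid mul0r.
split.
  rewrite -g0 -/(map (gridR M) _); suff H a l : path <%R (gridR M a) (map (gridR M) (iota a.+1 l)).
    exact: H.
  elim: l a => //= l ih a; rewrite ih andbT -subr_gt0 gridS// invr_gt0 ltr0n//.
rewrite /uniform_partition -{1}g0 last_map.
case: M M0 M0' {g0} => // M _ M0'.
by rewrite -nth_last size_iota nth_iota// add1n /grid divff.
Qed.

Lemma uniform_mesh M : (0 < M)%N -> mesh (uniform_partition M) <= M%:R^-1.
Proof.
move=> M0; have g0 : gridR M 0 = 0 by rewrite /grid mul0r.
rewrite /mesh.
suff H a l : \big[Num.max/0]_(r <- pairmap (fun a b => b - a) (gridR M a)
    (map (gridR M) (iota a.+1 l))) r <= M%:R^-1.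
  by have := H 0%N M; rewrite g0.
elim: l a => [|l ih] a /=; first by rewrite big_nil invr_ge0.
by rewrite big_cons ge_max gridS// lexx ih.
Qed.

End PiecewiseAffine.

Section Chaining.
Context {R : realType}.
Local Notation gridR := (@grid R).

Definition simplex : set (R * R) := [set st | 0 <= st.1 /\ st.1 <= st.2 /\ st.2 <= 1].

Lemma grid_mono n k l : (k <= l)%N -> gridR n k <= gridR n l.
Proof. by move=> kl; rewrite /grid ler_wpM2r ?invr_ge0// ler_nat. Qed.

Lemma grid_expn j e k : gridR (2 ^ (j + e)) (k * 2 ^ e) = gridR (2 ^ j) k.
Proof. by rewrite expnD gridM// expn_gt0. Qed.

Definition dyadic_floor (t : R) (J : nat) : nat := Num.truncn (t * (2 ^ J)%:R).

Lemma dyadic_floor_le t J : 0 <= t -> gridR (2 ^ J) (dyadic_floor t J) <= t.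
Proof.
move=> t0; have p : 0 < (2 ^ J)%:R :> R by rewrite ltr0n expn_gt0.
by rewrite /grid ler_pdivrMr// truncn_le// mulr_ge0.
Qed.

Lemma dyadic_floor_gt t J : t - (2 ^ J)%:R^-1 < gridR (2 ^ J) (dyadic_floor t J).
Proof.
have p : 0 < (2 ^ J)%:R :> R by rewrite ltr0n expn_gt0.
rewrite /grid ltr_pdivlMr// mulrBl mulVf ?gt_eqF// ltrBlDr.
by rewrite natr1 truncnS_gt.
Qed.

Lemma dyadic_floor_mono s t J : s <= t -> (dyadic_floor s J <= dyadic_floor t J)%N.
Proof. by move=> st; apply: le_truncn; rewrite ler_wpM2r. Qed.

Lemma dyadic_floor_le1 t J : 0 <= t -> t <= 1 -> (dyadic_floor t J <= 2 ^ J)%N.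
Proof.
move=> t0 t1; rewrite -(ler_nat R); apply: (@le_trans _ _ (t * (2 ^ J)%:R)).
  by rewrite truncn_le mulr_ge0.
by rewrite ler_piMl.
Qed.

Lemma cvg_dyadic_floor t : 0 <= t ->
  gridR (2 ^ J) (dyadic_floor t J) @[J --> \oo] --> t.
Proof.
move=> t0; apply: (@squeeze_cvgr _ _ _ _ (fun J => t - (2 ^ J)%:R^-1) (cst t)).
- by apply: nearW => J; rewrite dyadic_floor_le// ltW// dyadic_floor_gt.
- rewrite -[X in _ --> X](subr0 t); apply: cvgB; first exact: cvg_cst.
  under eq_fun do rewrite natrX -exprVn.
  by apply: cvg_expr; rewrite ger0_norm ?invr_ge0// invf_lt1// ltr1n.
- exact: cvg_cst.
Qed.

Lemma within_cvg_seq (U : topologicalType) (S : set U) (F : U -> R) (p : nat -> U) q :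
  {within S, continuous F} -> (forall J, S (p J)) -> S q ->
  p J @[J --> \oo] --> q -> F (p J) @[J --> \oo] --> F q.
Proof.
move=> /subspace_continuousP cF Sp Sq pq.
have pw : p J @[J --> \oo] --> within S (nbhs q).
  move=> A /= /pq h; have : \forall J \near \oo, S (p J) -> A (p J) by exact: h.
  by apply: filterS => J SA; exact: (SA (Sp J)).
exact: (cvg_comp _ _ pw (cF q Sq)).
Qed.

Lemma cvg_dyadic_pair s t : 0 <= s -> 0 <= t ->
  (gridR (2 ^ J) (dyadic_floor s J), gridR (2 ^ J) (dyadic_floor t J))
    @[J --> \oo] --> (s, t).
Proof. by move=> s0 t0; exact: (cvg_pair (cvg_dyadic_floor s0) (cvg_dyadic_floor t0)). Qed.

Lemma dyadic_simplex s t J : 0 <= s -> s <= t -> t <= 1 ->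
  simplex (gridR (2 ^ J) (dyadic_floor s J), gridR (2 ^ J) (dyadic_floor t J)).
Proof.
move=> s0 st t1; split => /=; first by rewrite /grid divr_ge0.
split; first by apply: grid_mono; apply: dyadic_floor_mono.
apply: (@le_trans _ _ t) => //; apply: dyadic_floor_le; exact: le_trans st.
Qed.

Lemma powR2N_lt1 (th : R) : 0 < th -> 2 `^ (- th) < 1.
Proof.
move=> th0; rewrite powRN invf_lt1 ?powR_gt0//.
rewrite -[ltLHS](powRr0 2) /powR pnatr_eq0 /= ltr_expR mul0r mulr_gt0//.
by rewrite ln_gt0// ltr1n.
Qed.

Lemma dyadic_powR (th : R) j : (2 `^ (- th)) ^+ j = ((2 ^ j)%:R^-1) `^ th.
Proof.
have r1 : 2 `^ (- th) = 2^-1 `^ th :> R.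
  by rewrite -(powR_inv1 (ler0n R 2)) -powRrM mulN1r.
elim: j => [|j ih]; first by rewrite expr0 expn0 invr1 powR1.
by rewrite exprS ih expnS natrM invfM powRM ?invr_ge0// -r1.
Qed.

Variables (f : R -> R -> R) (th K M : R).
Hypothesis th0 : 0 < th.
Hypothesis K0 : 0 <= K.
Hypothesis M0 : 0 <= M.
Hypothesis f_add : forall s u t, 0 <= s -> s <= u -> u <= t -> t <= 1 ->
  `|f s t - f s u - f u t| <= K * (t - s) `^ th.
Hypothesis f_cont : {within simplex, continuous (fun st => f st.1 st.2)}.
Let rho : R := 2 `^ (- th).
Hypothesis f_cell : forall j k, (k < 2 ^ j)%N ->
  `|f (gridR (2 ^ j) k) (gridR (2 ^ j) k.+1)| <= M * rho ^+ j.

Let rho_gt0 : 0 < rho. Proof. exact: powR_gt0. Qed.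
Let rho_lt1 : rho < 1. Proof. exact: powR2N_lt1. Qed.

Let rhoE j : rho ^+ j = ((2 ^ j)%:R^-1) `^ th. Proof. exact: dyadic_powR. Qed.

Let B := (M + K) / (1 - rho).

Let B_eq : B * rho + (M + K) = B.
Proof. by rewrite /B; field; rewrite subr_eq0 gt_eqF. Qed.

Let MK_B : M + K <= B.
Proof.
rewrite /B ler_pdivlMr ?subr_gt0// ler_piMr ?addr_ge0//.
by rewrite gerBl ltW.
Qed.

Let B0 : 0 <= B. Proof. by apply: le_trans MK_B; rewrite addr_ge0. Qed.

Let f_refl s : 0 <= s -> s <= 1 -> f s s = 0.
Proof.
move=> s0 s1; have := f_add s0 (lexx s) (lexx s) s1.
rewrite (subrr s) powR0 ?gt_eqF// mulr0 normr_le0 subrr sub0r oppr_eq0.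
by move=> /eqP.
Qed.

Let f_tri s u t : 0 <= s -> s <= u -> u <= t -> t <= 1 ->
  `|f s t| <= `|f s u| + `|f u t| + K * (t - s) `^ th.
Proof.
move=> s0 su ut t1; have h := f_add s0 su ut t1.
have -> : f s t = (f s t - f s u - f u t) + (f s u + f u t) by ring.
apply: le_trans (ler_normD _ _) _; rewrite [leLHS]addrC.
by apply: lerD; [exact: ler_normD|exact: h].
Qed.

Let rho_le1 j : rho ^+ j.+1 <= rho ^+ j.
Proof. by rewrite exprS ler_piMl ?exprn_ge0 ?(ltW rho_gt0)// ltW. Qed.

Let one_sided e : forall j k l, (k < 2 ^ j)%N ->
  (k * 2 ^ e <= l)%N -> (l <= k.+1 * 2 ^ e)%N ->
  `|f (gridR (2 ^ j) k) (gridR (2 ^ (j + e)) l)| <= B * rho ^+ j /\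
  `|f (gridR (2 ^ (j + e)) l) (gridR (2 ^ j) k.+1)| <= B * rho ^+ j.
Proof.
have MB : M <= B by apply: le_trans MK_B; rewrite lerDl.
elim: e => [|e ih] j k l kj kl lk.
  rewrite !expn0 !muln1 addn0 in kl lk *.
  have g k' : (k' <= 2 ^ j)%N -> 0 <= gridR (2 ^ j) k' <= 1 by exact: grid01.
  have Br : 0 <= B * rho ^+ j by rewrite mulr_ge0 ?exprn_ge0 ?(ltW rho_gt0).
  have cell := le_trans (f_cell kj) (ler_wpM2r (exprn_ge0 j (ltW rho_gt0)) MB).
  have [/g/andP[k0 k1] /g/andP[k0' k1']] := (ltnW kj, kj).
  have [->|kl'] := eqVneq l k; first by rewrite f_refl// normr0.
  have -> : l = k.+1 by apply/eqP; rewrite eqn_leq lk ltn_neqAle eq_sym kl' kl.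
  by rewrite f_refl// normr0.
have e1 k' : gridR (2 ^ j) k' = gridR (2 ^ j.+1) (k' * 2).
  by rewrite -(grid_expn j 1) expn1 addn1.
have km : (k * 2 < 2 ^ j.+1)%N by rewrite expnSr ltn_pmul2r.
have km1 : ((k * 2).+1 < 2 ^ j.+1)%N.
  by rewrite expnSr; apply: (@leq_trans (k.+1 * 2)); [rewrite mulSn|rewrite leq_pmul2r].
have e2 : (k.+1 * 2 = (k * 2).+2)%N by rewrite mulSn.
rewrite addnS -addSn !e1 e2.
have kl' : (k * 2 * 2 ^ e <= l)%N by rewrite -mulnA -expnS.
have lk' : (l <= (k * 2).+2 * 2 ^ e)%N by rewrite -e2 -mulnA -expnS.
have lB : (l <= 2 ^ (j.+1 + e))%N.
  by rewrite (leq_trans lk')// expnD leq_mul2r km1 orbT.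
have g k' : (k' <= 2 ^ j.+1)%N -> 0 <= gridR (2 ^ j.+1) k' <= 1 by exact: grid01.
have [/g/andP[p0 p1] /g/andP[q0 q1]] := (ltnW km, ltnW km1).
have /g/andP[r0 r1] := km1.
have /andP[l0 l1] := @grid01 R _ _ lB.
have stepB : M * rho ^+ j.+1 + B * rho ^+ j.+1 + K * rho ^+ j <= B * rho ^+ j.
  rewrite exprS; apply: (@le_trans _ _ ((B * rho + (M + K)) * rho ^+ j)); last first.
    by rewrite B_eq.
  rewrite -subr_ge0.
  have -> : (B * rho + (M + K)) * rho ^+ j - (M * (rho * rho ^+ j) +
    B * (rho * rho ^+ j) + K * rho ^+ j) = M * (1 - rho) * rho ^+ j by ring.
  by rewrite !mulr_ge0 ?exprn_ge0 ?(ltW rho_gt0)// subr_ge0 ltW.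
have BS : B * rho ^+ j.+1 <= B * rho ^+ j by rewrite ler_wpM2l.
have wid s t : gridR (2 ^ j.+1) (k * 2) <= s -> s <= t ->
    t <= gridR (2 ^ j.+1) (k * 2).+2 -> K * (t - s) `^ th <= K * rho ^+ j.
  move=> as_ st tb; rewrite ler_wpM2l// rhoE; apply: powR_mono => //.
    by rewrite subr_ge0.
  apply: (@le_trans _ _ (gridR (2 ^ j) k.+1 - gridR (2 ^ j) k)).
    by rewrite !e1 e2; apply: lerB.
  by rewrite /grid -mulrBl -natrB// subSnn mul1r.
have lg k' : (k' * 2 ^ e <= l)%N -> gridR (2 ^ j.+1) k' <= gridR (2 ^ (j.+1 + e)) l.
  by move=> h; rewrite -(grid_expn j.+1 e); exact: grid_mono.
have gl k' : (l <= k' * 2 ^ e)%N -> gridR (2 ^ (j.+1 + e)) l <= gridR (2 ^ j.+1) k'.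
  by move=> h; rewrite -(grid_expn j.+1 e); exact: grid_mono.
have [lm|/ltnW ml] := leqP l ((k * 2).+1 * 2 ^ e)%N.
  have [h1 h2] := ih j.+1 (k * 2)%N l km kl' lm.
  split; first exact: le_trans BS.
  apply: le_trans (f_tri l0 (gl _ lm) (grid_mono _ (leqnSn _)) r1) _.
  apply: le_trans _ stepB; rewrite [X in _ <= X + _]addrC lerD//.
    by rewrite lerD// f_cell.
  by apply: wid; [exact: lg|exact: gl|].
have [h1 h2] := ih j.+1 (k * 2).+1 l km1 ml lk'.
split; last exact: le_trans BS.
apply: le_trans (f_tri p0 (grid_mono _ (leqnSn _)) (lg _ ml) l1) _.
apply: le_trans _ stepB; rewrite lerD//.
  by rewrite lerD// f_cell.
by apply: wid; [|exact: lg|exact: gl].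
Qed.

Let dyadic_bound J a b : (a < b)%N -> (b <= 2 ^ J)%N ->
  `|f (gridR (2 ^ J) a) (gridR (2 ^ J) b)| <=
  (3 * B + 2 * K) * (gridR (2 ^ J) b - gridR (2 ^ J) a) `^ th.
Proof.
move=> ab bJ; set s := gridR _ a; set t := gridR _ b.
pose e := trunc_log 2 (b - a).
have ba0 : (0 < b - a)%N by rewrite subn_gt0.
have e1 : (2 ^ e <= b - a)%N by exact: trunc_logP.
have e2 : (b - a < 2 ^ e.+1)%N by exact: trunc_log_ltn.
have eJ : (e <= J)%N.
  by rewrite -(@leq_exp2l 2)// (leq_trans e1)// (leq_trans (leq_subr _ _)).
pose j := (J - e)%N; have jE : (j + e = J)%N by rewrite subnK.
pose c := (a %/ 2 ^ e)%N.
have p0 : (0 < 2 ^ e)%N by rewrite expn_gt0.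
have ca : (c * 2 ^ e <= a)%N by exact: leq_trunc_div.
have ac : (a < c.+1 * 2 ^ e)%N by rewrite -ltn_divLR.
have cb : (c.+1 * 2 ^ e <= b)%N.
  by rewrite mulSn (leq_trans (leq_add e1 ca))// subnK// ltnW.
have bc : (b <= c.+3 * 2 ^ e)%N.
  move: e2; rewrite ltn_subLR ?(ltnW ab)// => /ltnW /leq_trans; apply.
  have -> : c.+3 = (c.+1 + 2)%N by rewrite addn2.
  by rewrite expnS mulnDl leq_add2r ltnW.
have cJ k : (k * 2 ^ e <= b)%N -> (k <= 2 ^ j)%N.
  move=> kb; rewrite -(leq_pmul2r p0) -expnD jE; exact: leq_trans bJ.
have gE k : gridR (2 ^ j) k = gridR (2 ^ J) (k * 2 ^ e) by rewrite -jE grid_expn.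
have st : s <= t by apply: grid_mono; exact: ltnW.
have ts : (2 ^ j)%:R^-1 <= t - s.
  rewrite /t /s /grid -mulrBl -natrB ?(ltnW ab)// ler_pdivlMr ?ltr0n ?expn_gt0//.
  rewrite -{1}jE expnD natrM mulKf ?ler_nat// pnatr_eq0 -lt0n expn_gt0//.
have rt : rho ^+ j <= (t - s) `^ th.
  by rewrite rhoE; apply: powR_mono => //; rewrite invr_ge0.
have s0 : 0 <= s by rewrite /s /grid divr_ge0.
have t1 : t <= 1 by have /andP[] := @grid01 R _ _ bJ.
set u := gridR (2 ^ j) c.+1.
have su : s <= u by rewrite /u gE; apply: grid_mono; exact: ltnW.
have ut : u <= t by rewrite /u gE; apply: grid_mono.
have [_ h1] := one_sided (cJ _ cb) (l := a) ca (ltnW ac).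
rewrite jE -/s -/u in h1.
have h2 : `|f u t| <= 2 * B * rho ^+ j + K * (t - s) `^ th.
  have Kr : 0 <= K * (t - s) `^ th by rewrite mulr_ge0 ?powR_ge0.
  have Brj : 0 <= B * rho ^+ j by rewrite mulr_ge0 ?exprn_ge0 ?(ltW rho_gt0).
  have [ub|ub] := eqVneq b (c.+1 * 2 ^ e)%N.
    have tu : t = u by rewrite /t /u gE ub.
    have -> : f u t = 0.
      by rewrite tu f_refl//; [exact: le_trans su|exact: le_trans t1].
    by rewrite normr0; lra.
  have cb' : (c.+1 * 2 ^ e < b)%N by rewrite ltn_neqAle eq_sym ub.
  have cj1 : (c.+1 < 2 ^ j)%N.
    rewrite -(ltn_pmul2r p0) -expnD jE; exact: leq_trans bJ.
  have [b2|/ltnW b2] := leqP b (c.+2 * 2 ^ e).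
    have [h _] := one_sided cj1 cb b2; rewrite jE -/t -/u in h; lra.
  have cj2 : (c.+2 < 2 ^ j.+1)%N.
    rewrite (@leq_ltn_trans (2 ^ j))// ?ltn_exp2l//.
  set u2 := gridR (2 ^ j) c.+2.
  have u2t : u2 <= t by rewrite /u2 gE; apply: grid_mono.
  have uu2 : u <= u2 by apply: grid_mono.
  apply: le_trans (f_tri (le_trans s0 su) uu2 u2t t1) _.
  have MB : M <= B by apply: le_trans MK_B; rewrite lerDl.
  have h3 := le_trans (f_cell cj1) (ler_wpM2r (exprn_ge0 j (ltW rho_gt0)) MB).
  have h4 : K * (t - u) `^ th <= K * (t - s) `^ th.
    rewrite ler_wpM2l//; apply: powR_mono; rewrite ?subr_ge0//.
    by rewrite lerB.
  have [c2|c2] := eqVneq b (c.+2 * 2 ^ e)%N.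
    have -> : f u2 t = 0.
      have tu : t = u2 by rewrite /t /u2 gE c2.
      rewrite tu f_refl//; last exact: le_trans t1.
      by apply: le_trans uu2; exact: le_trans su.
    by rewrite normr0; rewrite -/u -/u2 in h3; lra.
  have cj2' : (c.+2 < 2 ^ j)%N.
    rewrite -(ltn_pmul2r p0) -expnD jE; apply: leq_trans bJ.
    by rewrite ltn_neqAle eq_sym c2.
  have [h _] := one_sided cj2' b2 bc; rewrite jE -/t -/u2 in h.
  by rewrite -/u -/u2 in h3; lra.
apply: le_trans (f_tri s0 su ut t1) _.
have := ler_wpM2l B0 rt; move: h1 h2; lra.
Qed.

Lemma chaining s t : 0 <= s -> s <= t -> t <= 1 ->
  `|f s t| <= (3 / (1 - rho) + 2) * (M + K) * (t - s) `^ th.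
Proof.
move=> s0 st t1.
have C0 : 3 * B + 2 * K <= (3 / (1 - rho) + 2) * (M + K).
  rewrite /B -subr_ge0.
  have -> : (3 / (1 - rho) + 2) * (M + K) - (3 * ((M + K) / (1 - rho)) + 2 * K) = 2 * M.
    by ring.
  by rewrite mulr_ge0.
apply: (@le_trans _ _ ((3 * B + 2 * K) * (t - s) `^ th)); last first.
  by rewrite ler_wpM2r ?powR_ge0.
have t0 : 0 <= t by exact: le_trans st.
have s1 : s <= 1 by exact: le_trans t1.
move: st; rewrite le_eqVlt => /predU1P[<-|st].
  by rewrite f_refl// normr0 mulr_ge0 ?powR_ge0// addr_ge0// mulr_ge0.
have st' := ltW st.
have cst : simplex (s, t) by split.
have c1 : f (gridR (2 ^ J) (dyadic_floor s J)) (gridR (2 ^ J) (dyadic_floor t J))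
    @[J --> \oo] --> f s t.
  apply: (within_cvg_seq f_cont _ cst (cvg_dyadic_pair s0 t0)) => J.
  exact: dyadic_simplex.
have c2 : (3 * B + 2 * K) * (gridR (2 ^ J) (dyadic_floor t J) -
    gridR (2 ^ J) (dyadic_floor s J)) `^ th @[J --> \oo] --> (3 * B + 2 * K) * (t - s) `^ th.
  apply: cvgM; first exact: cvg_cst.
  have ts0 : 0 < t - s by rewrite subr_gt0.
  have cp : {for t - s, continuous (fun x : R => x `^ th)}.
    apply/differentiable_continuous/derivable1_diffP; apply: derivable_powR.
    by rewrite in_itv/= andbT.
  apply: (continuous_cvg _ cp); apply: cvgB; exact: cvg_dyadic_floor.
have c3 : `|f (gridR (2 ^ J) (dyadic_floor s J)) (gridR (2 ^ J) (dyadic_floor t J))|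
    @[J --> \oo] --> `|f s t| by exact: cvg_norm.
have cJ : (2 ^ J)%:R^-1 @[J --> \oo] --> (0 : R).
  under eq_fun do rewrite natrX -exprVn.
  by apply: cvg_expr; rewrite ger0_norm ?invr_ge0// invf_lt1// ltr1n.
have dt : 0 < t - s by rewrite subr_gt0.
apply: (ler_cvg_to c3 c2); near=> J.
apply: dyadic_bound; last exact: dyadic_floor_le1.
rewrite -(ltr_nat R).
have p : 0 < (2 ^ J)%:R :> R by rewrite ltr0n expn_gt0.
have h1 := dyadic_floor_le J s0; have h2 := dyadic_floor_gt t J.
have h3 : (2 ^ J)%:R^-1 < t - s.
  near: J; exact: (cvgr_lt _ cJ _ dt).
have : gridR (2 ^ J) (dyadic_floor s J) < gridR (2 ^ J) (dyadic_floor t J) by lra.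
by rewrite /grid ltr_pM2r ?invr_gt0.
Unshelve. all: by end_near. Qed.

End Chaining.

Section PowerScaling.
Context {R : realType}.
Variables (N tau a b : R).
Hypothesis N1 : 1 <= N.
Hypothesis tau0 : 0 < tau.
Hypothesis ab : a <= b.

Let N0 : 0 < N. Proof. exact: lt_le_trans N1. Qed.

Lemma powR_split (x p q : R) : 0 < x -> x `^ (p + q) = x `^ p * x `^ q.
Proof. by move=> x0; rewrite powRD// (gt_eqF x0) implybT. Qed.

Lemma powR_le1 (x p : R) : 0 <= x -> x <= 1 -> 0 <= p -> x `^ p <= 1.
Proof.
move=> x0 x1 p0; have <- : 1 `^ p = 1 :> R by rewrite powR1.
by apply: ge0_ler_powR; rewrite ?nnegrE. Qed.

Lemma scale_short : a <= 1 -> N * tau <= 1 ->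
  N `^ (1 - b) * tau <= N `^ (- (b - a)) * tau `^ a.
Proof.
move=> a1 Nt.
have -> : N `^ (1 - b) * tau = (N * tau) `^ (1 - a) * (N `^ (- (b - a)) * tau `^ a).
  rewrite powRM ?(ltW N0) ?(ltW tau0)// mulrACA -!powR_split//.
  by rewrite [1 - a + a]subrK powRr1 ?(ltW tau0)//; congr (N `^ _ * _); ring.
rewrite ler_piMl ?mulr_ge0 ?powR_ge0// powR_le1 ?subr_ge0//.
by rewrite mulr_ge0 ?ltW.
Qed.

Lemma scale_short_pow : N * tau <= 1 -> tau `^ b <= N `^ (- (b - a)) * tau `^ a.
Proof.
move=> Nt; have -> : tau `^ b = (N * tau) `^ (b - a) * (N `^ (- (b - a)) * tau `^ a).
  rewrite powRM ?(ltW N0) ?(ltW tau0)// mulrACA -!powR_split//.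
  by rewrite subrr powRr0 mul1r subrK.
rewrite ler_piMl ?mulr_ge0 ?powR_ge0// powR_le1 ?subr_ge0//.
by rewrite mulr_ge0 ?ltW.
Qed.

Lemma scale_long : 0 <= a -> 1 <= N * tau -> N `^ (- b) <= N `^ (- (b - a)) * tau `^ a.
Proof.
move=> a0 Nt; have -> : N `^ (- (b - a)) * tau `^ a = N `^ (- b) * (N * tau) `^ a.
  rewrite powRM ?(ltW N0) ?(ltW tau0)// mulrA -!powR_split//.
  by congr (N `^ _ * _); ring.
rewrite ler_peMr ?powR_ge0//; have <- : 1 `^ a = 1 :> R by rewrite powR1.
by apply: ge0_ler_powR; rewrite ?nnegrE// (le_trans ler01).
Qed.

End PowerScaling.

Section DeterministicBound.
Context {R : realType}.
Variables (d n : nat) (x : R -> 'rV[R]_d).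
Hypothesis n_gt0 : (0 < n)%N.
Local Notation gridR := (@grid R).
Implicit Types i j : 'I_(d + d).

Definition component i : 'I_d := match fintype.split i with inl k => k | inr k => k end.
Definition is_lead i : bool := match fintype.split i with inl _ => false | inr _ => true end.

Lemma diag_coord t i : diag_path x t 0 i = x t 0 (component i).
Proof. by rewrite /diag_path mxE /component; case: (fintype.split i). Qed.

Let z k := (lead_lag_node n x k).2.

Lemma node_coord k i : z k 0 i =
  x (gridR n (if is_lead i then uphalf k else k./2)) 0 (component i).
Proof. by rewrite /z mxE /component /is_lead; case: (fintype.split i). Qed.

Let n2 : (0 < n.*2)%N. Proof. by rewrite double_gt0. Qed.
Let N : R := n%:R.
Let N0 : 0 < N. Proof. by rewrite ltr0n. Qed.
Let N1 : 1 <= N. Proof. by rewrite ler1n. Qed.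
Let y := lead_lag n x.

Lemma lead_lagE k u : (k < n.*2)%N -> gridR n.*2 k <= u <= gridR n.*2 k.+1 ->
  y u = z k + (u - gridR n.*2 k) *: (n.*2%:R *: (z k.+1 - z k)).
Proof. by move=> kn ku; exact: (@pl_interp_iota R _ n.*2 z 0 n.*2 k u n2). Qed.

Lemma grid_double c : gridR n c = gridR n.*2 c.*2.
Proof. by rewrite -!muln2 gridM. Qed.

Lemma grid_last m : (0 < m)%N -> gridR m m = 1.
Proof. by move=> m0; rewrite /grid divff// pnatr_eq0 -lt0n. Qed.

Lemma lead_lag_pwaffine s t : 0 <= s -> s <= t -> t <= 1 -> pwaffine y s t.
Proof.
move=> s0 st t1; have := grid_pwaffine n2 (@lead_lagE) (leqnn (0 + n.*2)).
rewrite add0n grid_last// {1}/grid mul0r => h.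
exact: (pwaffine_sub h).
Qed.

Lemma lead_lag_grid c i : (c <= n)%N -> y (gridR n c) 0 i = x (gridR n c) 0 (component i).
Proof.
move=> cn; rewrite {1}grid_double (grid_node n2 (@lead_lagE)) ?leq_double//.
by rewrite node_coord doubleK uphalf_double if_same.
Qed.

Lemma lead_lag_cell_area c i j : (c < n)%N ->
  levy_area y (gridR n c) (gridR n c.+1) i j =
  2^-1 * ((is_lead i)%:R - (is_lead j)%:R) *
  ((x (gridR n c.+1) 0 (component i) - x (gridR n c) 0 (component i)) *
   (x (gridR n c.+1) 0 (component j) - x (gridR n c) 0 (component j))).
Proof.
move=> cn; rewrite !grid_double doubleS -addn2 (grid_levy_area n2 (@lead_lagE)); last first.
  by rewrite addn2 -doubleS leq_double.
rewrite big_ord_recl big_ord_recl big_ord0 !addn0 /bump /= addn1 !subrr !mul0r !subrr add0r.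
rewrite !node_coord addn2 /= !doubleK !uphalf_double -!grid_double.
rewrite -[c.*2.+2]doubleS -!grid_double.
by case: (is_lead i); case: (is_lead j); rewrite /= ?mulr1n ?mulr0n; ring.
Qed.

Variables (kappa beta : R).
Hypothesis kappa0 : 0 <= kappa.
Hypothesis beta0 : 0 < beta.
Hypothesis x_holder : forall k s t, 0 <= s -> s <= t -> t <= 1 ->
  `|x t 0 k - x s 0 k| <= kappa * (t - s) `^ beta.

Let Lip := 2 * kappa * N `^ (1 - beta).

Let Lip0 : 0 <= Lip. Proof. by rewrite mulr_ge0 ?powR_ge0// mulr_ge0. Qed.

Lemma node_diff k i : (k < n.*2)%N -> n.*2%:R * `|z k.+1 0 i - z k 0 i| <= Lip.
Proof.
move=> kn; rewrite !node_coord.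
have step c : (c < n)%N -> forall l,
    `|x (gridR n c.+1) 0 l - x (gridR n c) 0 l| <= kappa * N `^ (- beta).
  move=> cn l; have /andP[c0 c1] := @grid01 R _ _ (ltnW cn).
  have /andP[c0' c1'] := @grid01 R _ _ cn.
  have := x_holder l c0 (grid_mono _ (leqnSn c)) c1'.
  by rewrite gridS// -powR_inv1 ?ler0n// -powRrM mulN1r.
have bnd (p q : nat) : (q = p \/ q = p.+1 /\ p < n)%N -> forall l,
    n.*2%:R * `|x (gridR n q) 0 l - x (gridR n p) 0 l| <= Lip.
  have -> : Lip = n.*2%:R * (kappa * N `^ (- beta)).
    by rewrite /Lip -muln2 natrM powR_split// powRr1 ?(ltW N0)//; rewrite /N; ring.
  move=> [->|[-> pn]] l; rewrite ler_wpM2l//; last exact: step.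
  by rewrite subrr normr0 mulr_ge0 ?powR_ge0.
apply: bnd; case: (is_lead i) => /=; rewrite -?uphalfE.
- rewrite uphalf_half; case: (boolP (odd k)) => ok /=; last by right; lia.
  by left; lia.
- rewrite uphalf_half; case: (boolP (odd k)) => ok /=; last by left; lia.
  by right; lia.
Qed.

Lemma lead_lag_lipschitz i s t : 0 <= s -> s <= t -> t <= 1 ->
  `|y t 0 i - y s 0 i| <= Lip * (t - s).
Proof.
suff H k : (k <= n.*2)%N -> forall s t, 0 <= s -> s <= t -> t <= gridR n.*2 k ->
    `|y t 0 i - y s 0 i| <= Lip * (t - s).
  by move=> s0 st t1; apply: (H n.*2) => //; rewrite grid_last.
have cell k' u w : (k' < n.*2)%N -> gridR n.*2 k' <= u -> u <= w -> w <= gridR n.*2 k'.+1 ->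
    `|y w 0 i - y u 0 i| <= Lip * (w - u).
  move=> kn ku uw wk; rewrite (lead_lagE kn) ?(le_trans ku uw)//.
  rewrite (lead_lagE kn (u := u)) ?ku ?(le_trans uw)//.
  have lin (e f g : 'rV[R]_(d + d)) (b c : R) : (e + b *: (c *: (f - g))) 0 i =
      e 0 i + b * (c * (f 0 i - g 0 i)) by rewrite !mxE.
  rewrite !lin; set p := z k' 0 i; set q := z k'.+1 0 i.
  rewrite (_ : _ - _ = (w - u) * (n.*2%:R * (q - p))); last by ring.
  rewrite normrM mulrC (ger0_norm (_ : 0 <= w - u)) ?subr_ge0// ler_wpM2r ?subr_ge0//.
  by rewrite normrM ger0_norm//; exact: node_diff.
elim: k => [|k ih] kn {}s {}t s0 st tk.
  have g0 : gridR n.*2 0 = 0 by rewrite /grid mul0r.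
  have t0 : t = 0 by apply: le_anti; rewrite -{1}g0 tk (le_trans s0).
  have -> : s = t by apply: le_anti; rewrite st t0.
  by rewrite !subrr normr0 mulr0.
have [tk'|kt] := leP t (gridR n.*2 k); first exact: ih (ltnW kn) _ _ s0 st tk'.
have [ks|sk] := leP (gridR n.*2 k) s; first exact: (cell k).
have h1 := ih (ltnW kn) s (gridR n.*2 k) s0 (ltW sk) (lexx _).
have h2 := cell k _ _ kn (lexx _) (ltW kt) tk.
have := ler_normD (y t 0 i - y (gridR n.*2 k) 0 i) (y (gridR n.*2 k) 0 i - y s 0 i).
by rewrite addrA subrK; lra.
Qed.

Variable alpha : R.
Hypothesis alpha0 : 0 <= alpha.
Hypothesis alpha_beta : alpha < beta.
Hypothesis beta_half : beta <= 2^-1.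
Let eps := beta - alpha.
Let eps0 : 0 < eps. Proof. by rewrite subr_gt0. Qed.
Let alpha1 : alpha <= 1. Proof. by move: alpha_beta beta_half; lra. Qed.
Let ab : alpha <= beta. Proof. exact: ltW. Qed.

Let floor_grid t : 0 <= t -> t <= 1 -> exists q, [/\ (q <= n)%N, gridR n q <= t &
  t - gridR n q <= N^-1].
Proof.
move=> t0 t1; exists (Num.truncn (t * N)).
have tN0 : 0 <= t * N by rewrite mulr_ge0 ?(ltW N0).
have h1 : (Num.truncn (t * N))%:R <= t * N by rewrite truncn_le.
split.
- rewrite -(ler_nat R) (le_trans h1)// ler_piMl// ltW.
- by rewrite /grid ler_pdivrMr.
- rewrite lerBlDr /grid -/N; have -> m : N^-1 + m%:R / N = m.+1%:R / N.
    by rewrite -natr1 mulrDl mul1r addrC.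
  by rewrite ler_pdivlMr// ltW// truncnS_gt.
Qed.

Let short_grid s t : 0 <= s -> t <= 1 -> N^-1 <= t - s -> exists p q,
  [/\ (p <= q)%N, (q <= n)%N, [/\ s <= gridR n p & gridR n p - s <= N^-1] &
    [/\ gridR n q <= t & t - gridR n q <= N^-1]].
Proof.
move=> s0 t1 st.
have i0 : 0 < N^-1 by rewrite invr_gt0.
have t0 : 0 <= t by lra.
exists (Num.truncn (s * N)).+1, (Num.truncn (t * N)).
have sN0 : 0 <= s * N by rewrite mulr_ge0 ?(ltW N0).
have tN0 : 0 <= t * N by rewrite mulr_ge0 ?(ltW N0).
have h1 : (Num.truncn (t * N))%:R <= t * N by rewrite truncn_le.
have h2 : (Num.truncn (s * N))%:R <= s * N by rewrite truncn_le.
have h3 := truncnS_gt (t * N); have h4 := truncnS_gt (s * N).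
split.
- rewrite truncn_ge_nat// -natr1; apply: (@le_trans _ _ ((s + N^-1) * N)).
    by rewrite mulrDl mulVf ?gt_eqF// lerD2r.
  by rewrite ler_pM2r//; lra.
- by rewrite -(ler_nat R) (le_trans h1)// ler_piMl// ltW.
- split; rewrite /grid -/N; first by rewrite ler_pdivlMr// ltW.
  by rewrite lerBlDr ler_pdivrMr// mulrDl mulVf ?gt_eqF// -natr1 addrC lerD2l.
- split; rewrite /grid -/N; first by rewrite ler_pdivrMr.
  by rewrite lerBlDl -lerBlDr ler_pdivlMr// mulrBl mulVf ?gt_eqF// lerBlDr natr1 ltW.
Qed.

Let LipN s t : 0 <= t - s -> t - s <= N^-1 -> Lip * (t - s) <= 2 * kappa * N `^ (- beta).
Proof.
move=> ts0 ts; apply: le_trans (ler_wpM2l Lip0 ts) _.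
rewrite /Lip powR_split// powRr1 ?(ltW N0)// le_eqVlt; apply/orP; left; apply/eqP.
by field; rewrite gt_eqF.
Qed.

Let hol k s t : 0 <= s -> s <= t -> t <= 1 -> t - s <= N^-1 ->
  `|x t 0 k - x s 0 k| <= kappa * N `^ (- beta).
Proof.
move=> s0 st t1 ts; apply: le_trans (x_holder k s0 st t1) _; rewrite ler_wpM2l//.
rewrite -[- beta]mulN1r powRrM powR_inv1 ?(ltW N0)//.
by apply: powR_mono; rewrite ?subr_ge0.
Qed.

Lemma lead_lag_level1 i s t : 0 <= s -> s < t -> t <= 1 ->
  `|(y t 0 i - y s 0 i) - (x t 0 (component i) - x s 0 (component i))| <=
  6 * kappa * N `^ (- eps) * (t - s) `^ alpha.
Proof.
move=> s0 st t1; have ts0 : 0 < t - s by rewrite subr_gt0.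
have ts1 : t - s <= 1 by lra.
have st' := ltW st; have t0 : 0 <= t by exact: le_trans st'.
have s1 : s <= 1 by exact: le_trans t1.
have [short|long] := leP (N * (t - s)) 1.
  apply: le_trans (ler_normB _ _) _.
  apply: le_trans (lerD (lead_lag_lipschitz i s0 st' t1) (x_holder _ s0 st' t1)) _.
  have h1 := scale_short beta N1 ts0 alpha1 short.
  have h2 := scale_short_pow N1 ts0 ab short.
  rewrite /Lip -/eps in h1 h2 *.
  have h3 := ler_wpM2l (mulr_ge0 (ler0n R 2) kappa0) h1.
  have h4 := ler_wpM2l kappa0 h2.
  have h5 : 0 <= kappa * (N `^ (- eps) * (t - s) `^ alpha).
    by rewrite mulr_ge0// mulr_ge0 ?powR_ge0.
  by move: h3 h4 h5; lra.
have dev u : 0 <= u -> u <= 1 ->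
    `|y u 0 i - x u 0 (component i)| <= 3 * kappa * N `^ (- beta).
  move=> u0 u1; have [q [qn qu uq]] := floor_grid u0 u1.
  have /andP[g0 g1] := @grid01 R _ _ qn.
  have e : y u 0 i - x u 0 (component i) = (y u 0 i - y (gridR n q) 0 i) -
      (x u 0 (component i) - x (gridR n q) 0 (component i)).
    by rewrite (lead_lag_grid i qn); ring.
  rewrite e; apply: le_trans (ler_normB _ _) _.
  have h1 := lead_lag_lipschitz i g0 qu u1.
  have h2 := hol (component i) g0 qu u1 uq.
  have h3 : Lip * (u - gridR n q) <= 2 * kappa * N `^ (- beta).
    by apply: LipN => //; rewrite subr_ge0.
  by move: h1 h2 h3; lra.
have -> : (y t 0 i - y s 0 i) - (x t 0 (component i) - x s 0 (component i)) =
  (y t 0 i - x t 0 (component i)) - (y s 0 i - x s 0 (component i)) by ring.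
apply: le_trans (ler_normB _ _) _.
apply: le_trans (lerD (dev t t0 t1) (dev s s0 s1)) _.
have h := scale_long beta N1 ts0 alpha0 (ltW long); rewrite -/eps in h.
by have := ler_wpM2l kappa0 h; lra.
Qed.

Variables (a : R -> R -> 'M[R]_(d + d)) (v : 'M[R]_(d + d)) (kappa2 L : R).
Hypothesis kappa20 : 0 <= kappa2.
Hypothesis L0 : 0 <= L.
Hypothesis a_holder : forall i j s t, 0 <= s -> s <= t -> t <= 1 ->
  `|a s t i j| <= kappa2 * (t - s) `^ (2 * beta).
Hypothesis a_chen : forall i j s u t, 0 <= s -> s <= u -> u <= t -> t <= 1 ->
  a s t i j = a s u i j + a u t i j + 2^-1 *
    ((x u 0 (component i) - x s 0 (component i)) * (x t 0 (component j) - x u 0 (component j)) -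
     (x u 0 (component j) - x s 0 (component j)) * (x t 0 (component i) - x u 0 (component i))).
Hypothesis v_bound : forall i j, `|v i j| <= N `^ (1 - 2 * beta).

Definition area_error i j s t := levy_area y s t i j + (t - s) * v i j - a s t i j.

Lemma area_error_chen i j s u t : 0 <= s -> s <= u -> u <= t -> t <= 1 ->
  area_error i j s t = area_error i j s u + area_error i j u t + 2^-1 *
   (((y u 0 i - y s 0 i) * (y t 0 j - y u 0 j) - (y u 0 j - y s 0 j) * (y t 0 i - y u 0 i)) -
    ((x u 0 (component i) - x s 0 (component i)) * (x t 0 (component j) - x u 0 (component j)) -
     (x u 0 (component j) - x s 0 (component j)) * (x t 0 (component i) - x u 0 (component i)))).
Proof.
move=> s0 su ut t1; rewrite /area_error (a_chen i j s0 su ut t1).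
rewrite (levy_area_chen i j (lead_lag_pwaffine s0 su (le_trans ut t1))
  (lead_lag_pwaffine (le_trans s0 su) ut t1)).
by ring.
Qed.

Lemma area_error_refl i j s : 0 <= s -> s <= 1 -> area_error i j s s = 0.
Proof.
move=> s0 s1; rewrite /area_error levy_area_refl subrr mul0r add0r sub0r.
have := a_holder i j s0 (lexx s) s1; rewrite subrr powR0 ?mulf_neq0 ?gt_eqF//.
by rewrite mulr0 normr_le0 => /eqP ->; rewrite oppr0.
Qed.

Lemma area_error_grid i j p k : (p + k <= n)%N ->
  area_error i j (gridR n p) (gridR n (p + k)) =
  \sum_(c < k) area_error i j (gridR n (p + c)) (gridR n (p + c).+1).
Proof.
elim: k => [|k ih] pk.
  have /andP[g0 g1] : 0 <= gridR n p <= 1 by apply: grid01; rewrite addn0 in pk.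
  by rewrite addn0 big_ord0 area_error_refl.
rewrite addnS in pk *; rewrite big_ord_recr /= -ih; last exact: ltnW.
have /andP[g0 _] : 0 <= gridR n p <= 1.
  by apply: grid01; rewrite (leq_trans _ pk)// -addnS leq_addr.
have /andP[_ g1] := @grid01 R _ _ pk.
rewrite (@area_error_chen _ _ _ (gridR n (p + k)))//; [|exact/grid_mono/leq_addr|exact: grid_mono].
have pn : (p <= n)%N by rewrite (leq_trans _ pk)// -addnS leq_addr.
by rewrite !lead_lag_grid ?(ltnW pk)// subrr mulr0 addr0.
Qed.

Hypothesis grid_bound : forall i j p q, (p < q)%N -> (q <= n)%N ->
  `|area_error i j (gridR n p) (gridR n q)| <= L * (gridR n q - gridR n p) `^ (2 * alpha).

Let C1 := 4 * kappa ^+ 2 + 1 + kappa2.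
Let C10 : 0 <= C1. Proof. by rewrite !addr_ge0// mulr_ge0// sqr_ge0. Qed.

Let Ne1 : N `^ (- eps) <= 1.
Proof. by rewrite powRN invf_le1 ?powR_gt0// -(powRr0 N); apply: ler_powR => //; exact: ltW. Qed.

Let area_error_short i j s t : 0 <= s -> s <= t -> t <= 1 -> N * (t - s) <= 1 ->
  `|area_error i j s t| <= C1 * N `^ (- eps) * (t - s) `^ (2 * alpha).
Proof.
move=> s0; rewrite le_eqVlt => /predU1P[<-|st] t1 short.
  by rewrite area_error_refl// normr0 !mulr_ge0 ?powR_ge0.
have st' := ltW st; have ts0 : 0 < t - s by rewrite subr_gt0.
have h1 : `|levy_area y s t i j| <= Lip ^+ 2 * (t - s) ^+ 2.
  apply: levy_area_lipschitz => //; first exact: lead_lag_pwaffine.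
  move=> k u w su uw wt; apply: lead_lag_lipschitz => //; first exact: le_trans su.
  exact: le_trans t1.
have ab2 : 2 * alpha <= 2 * beta by rewrite ler_pM2l.
have a21 : 2 * alpha <= 1 by move: alpha_beta beta_half; lra.
have h2 := scale_short beta N1 ts0 alpha1 short.
have h3 := scale_short (2 * beta) N1 ts0 a21 short.
have h4 := scale_short_pow N1 ts0 ab2 short.
have W1 := Ne1; set W := N `^ (- eps) in W1 *; set V := (t - s) `^ (2 * alpha).
have W0 : 0 <= W by exact: powR_ge0.
have V0 : 0 <= V by exact: powR_ge0.
have WW : W ^+ 2 <= W by rewrite expr2 ler_piMl.
have N2e : N `^ (- (2 * beta - 2 * alpha)) = W ^+ 2.
  by rewrite /W -powR_mulrn ?powR_ge0// -powRrM; congr (_ `^ _); rewrite /eps; ring.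
have t2a : ((t - s) `^ alpha) ^+ 2 = V.
  by rewrite /V -powR_mulrn ?powR_ge0// -powRrM mulrC.
rewrite N2e -/V in h3 h4; rewrite -/eps -/W in h2.
have h5 : Lip ^+ 2 * (t - s) ^+ 2 <= 4 * kappa ^+ 2 * (W ^+ 2 * V).
  have -> : Lip ^+ 2 * (t - s) ^+ 2 = 4 * kappa ^+ 2 * (N `^ (1 - beta) * (t - s)) ^+ 2.
    by rewrite /Lip; ring.
  rewrite ler_wpM2l ?mulr_ge0 ?sqr_ge0// -t2a -exprMn.
  by apply: lerXn2r => //; rewrite nnegrE mulr_ge0 ?powR_ge0// ltW.
have h6 : `|(t - s) * v i j| <= W ^+ 2 * V.
  rewrite normrM ger0_norm ?(ltW ts0)// mulrC; apply: le_trans h3.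
  by rewrite ler_wpM2r// ltW.
have h7 := le_trans (a_holder i j s0 st' t1) (ler_wpM2l kappa20 h4).
have h8 : W ^+ 2 * V <= W * V by rewrite ler_wpM2r.
rewrite /area_error; apply: le_trans (ler_normB _ _) _.
apply: le_trans (lerD (ler_normD _ _) (lexx _)) _.
have h9 : C1 * (W ^+ 2 * V) <= C1 * (W * V) by rewrite ler_wpM2l.
rewrite -mulrA; apply: le_trans h9; rewrite /C1.
by move: h1 h5 h6 h7; lra.
Qed.

Lemma area_error_bound i j s t : 0 <= s -> s < t -> t <= 1 ->
  `|area_error i j s t| <=
  (18 * (kappa ^+ 2 + kappa2 + 1) * N `^ (- eps) + L) * (t - s) `^ (2 * alpha).
Proof.
move=> s0 st t1; have ts0 : 0 < t - s by rewrite subr_gt0.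
have ts1 : t - s <= 1 by lra.
have st' := ltW st; set V := (t - s) `^ (2 * alpha); set W := N `^ (- eps).
have W0 : 0 <= W by exact: powR_ge0.
have V0 : 0 <= V by exact: powR_ge0.
have WV : 0 <= W * V by rewrite mulr_ge0.
have k2 : 0 <= kappa ^+ 2 * (W * V) by rewrite mulr_ge0 ?sqr_ge0.
have k2' : 0 <= kappa2 * (W * V) by rewrite mulr_ge0.
have LV : 0 <= L * V by rewrite mulr_ge0.
have [short|/ltW long] := leP (N * (t - s)) 1.
  apply: le_trans (area_error_short i j s0 st' t1 short) _; rewrite -/V -/W /C1.
  by lra.
have iN : N^-1 <= t - s by rewrite -[leLHS]mul1r ler_pdivrMr// mulrC.
have [p [q [pq qn [sp ps] [qt tq]]]] := short_grid s0 t1 iN.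
set s' := gridR n p in sp ps *; set t' := gridR n q in qt tq *.
have s't' : s' <= t' by exact: grid_mono.
have pn : (p <= n)%N by exact: leq_trans qn.
have s'0 : 0 <= s' by exact: le_trans sp.
have t'1 : t' <= 1 by exact: le_trans t1.
have t'0 : 0 <= t' by exact: le_trans s't'.
have s't : s' <= t by exact: le_trans qt.
have s'1 : s' <= 1 by exact: le_trans t1.
have mono u w : s <= u -> u <= w -> w <= t -> (w - u) `^ (2 * alpha) <= V.
  move=> su uw wt; apply: ge0_ler_powR; rewrite ?nnegrE ?mulr_ge0 ?subr_ge0//.
  by rewrite lerB.
have mshort u w : s <= u -> u <= w -> w <= t -> w - u <= N^-1 ->
    `|area_error i j u w| <= C1 * (W * V).
  move=> su uw wt wu.
  have h : N * (w - u) <= 1 by rewrite -ler_pdivlMl// mulr1.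
  have u0 : 0 <= u by exact: le_trans su.
  have w1 : w <= 1 by exact: le_trans t1.
  apply: le_trans (area_error_short i j u0 uw w1 h) _; rewrite -/W -mulrA.
  by rewrite !ler_wpM2l// mono.
have d1 := mshort s s' (lexx s) sp s't ps.
have d3 := mshort t' t (le_trans sp s't') qt (lexx t) tq.
have d2 : `|area_error i j s' t'| <= L * V.
  move: pq; rewrite leq_eqVlt => /predU1P[pq|pq].
    by rewrite /s' /t' pq area_error_refl ?normr0//; have /andP[] := @grid01 R _ _ qn.
  by apply: le_trans (grid_bound i j pq qn) _; rewrite ler_wpM2l// mono.
set E := N `^ (- beta); set F := (t - s) `^ beta.
have E0 : 0 <= E by exact: powR_ge0.
have F0 : 0 <= F by exact: powR_ge0.
have EF : E <= F.
  rewrite /E -[- beta]mulN1r powRrM powR_inv1 ?(ltW N0)//.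
  by apply: powR_mono => //; rewrite invr_ge0 ltW.
have EFWV : E * F <= W * V.
  have h := scale_long beta N1 ts0 alpha0 long; rewrite -/eps -/W -/E in h.
  apply: le_trans (ler_wpM2r F0 h) _; rewrite -mulrA ler_wpM2l//.
  have -> : V = (t - s) `^ alpha * (t - s) `^ alpha.
    by rewrite -powR_split// /V; congr (_ `^ _); ring.
  rewrite ler_wpM2l ?powR_ge0// /F; apply: ger_powR => //.
  by rewrite ts0.
have ysh k u w : s <= u -> u <= w -> w <= t -> w - u <= N^-1 ->
    `|y w 0 k - y u 0 k| <= 2 * kappa * E.
  move=> su uw wt wu.
  have u0 : 0 <= u by exact: le_trans su.
  have w1 : w <= 1 by exact: le_trans t1.
  apply: le_trans (lead_lag_lipschitz k u0 uw w1) _.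
  by apply: LipN => //; rewrite subr_ge0.
have xsh k u w : s <= u -> u <= w -> w <= t -> w - u <= N^-1 ->
    `|x w 0 k - x u 0 k| <= kappa * E.
  move=> su uw wt wu; apply: hol => //; first exact: le_trans su.
  exact: le_trans t1.
have xlg k u w : s <= u -> u <= w -> w <= t -> `|x w 0 k - x u 0 k| <= kappa * F.
  move=> su uw wt; apply: le_trans (x_holder k _ uw _) _; first exact: le_trans su.
    exact: le_trans t1.
  rewrite ler_wpM2l//; apply: powR_mono; rewrite ?subr_ge0//; exact: lerB.
have ylg k : `|y t' 0 k - y s' 0 k| <= kappa * F.
  by rewrite !lead_lag_grid//; apply: xlg.
have ylg' k : `|y t 0 k - y s' 0 k| <= 3 * kappa * F.
  have h1 := ysh k t' t (le_trans sp s't') qt (lexx t) tq; have h2 := ylg k.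
  have := ler_normD (y t 0 k - y t' 0 k) (y t' 0 k - y s' 0 k).
  by have := ler_wpM2l kappa0 EF; rewrite addrA subrK; lra.
have prod (u w A B : R) : `|u| <= A -> `|w| <= B -> `|u * w| <= A * B.
  by move=> uA wB; rewrite normrM ler_pM.
have cross (u1 w1 u2 w2 u3 w3 u4 w4 A B : R) : `|u1 * w1| <= A -> `|u2 * w2| <= A ->
    `|u3 * w3| <= B -> `|u4 * w4| <= B ->
    `|2^-1 * ((u1 * w1 - u2 * w2) - (u3 * w3 - u4 * w4))| <= A + B.
  move=> h1 h2 h3 h4; rewrite normrM (ger0_norm (_ : 0 <= 2^-1))//.
  have := ler_normB (u1 * w1 - u2 * w2) (u3 * w3 - u4 * w4).
  have := ler_normB (u1 * w1) (u2 * w2); have := ler_normB (u3 * w3) (u4 * w4).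
  by lra.
rewrite (area_error_chen i j s0 sp s't t1) (area_error_chen i j s'0 s't' qt t1).
set c1 := 2^-1 * _; set c2 := 2^-1 * _.
have b2 : `|c2| <= (2 * kappa * E) * (3 * kappa * F) + (kappa * E) * (kappa * F).
  apply: cross; apply: prod; (try exact: ylg'); (try exact: ysh);
    (try exact: xsh); exact: xlg.
have b1 : `|c1| <= (kappa * F) * (2 * kappa * E) + (kappa * F) * (kappa * E).
  have sst' := le_trans sp s't'.
  apply: cross; apply: prod; (try exact: ylg); (try exact: ysh);
    (try exact: xsh); exact: xlg.
have kEF : kappa ^+ 2 * (E * F) <= kappa ^+ 2 * (W * V) by rewrite ler_wpM2l ?sqr_ge0.
apply: le_trans (ler_normD _ _) _.
apply: le_trans (lerD (ler_normD _ _) (lexx _)) _.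
apply: le_trans (lerD (lerD (lexx _) (ler_normD _ _)) (lexx _)) _.
apply: le_trans (lerD (lerD (lexx _) (lerD (ler_normD _ _) (lexx _))) (lexx _)) _.
by move: d1 d2 d3 b1 b2 kEF; rewrite /C1; lra.
Qed.

End DeterministicBound.

Section CanonicalArea.
Context {R : realType} {disp : measure_display} {T : measurableType disp}.
Variables (P : probability T R) (d : nat) (X : 'I_d -> R -> {RV P >-> R}) (H : R).
Hypothesis hH_gt : 4^-1 < H.
Hypothesis hH_le : H <= 2^-1.
Hypothesis hX : forall i, fbm H (X i).
Hypothesis X_indep : independent_processes P X.
Variable A : T -> R -> R -> 'M[R]_(d + d).
Hypothesis hA : canonical_levy_area P (fun w => diag_path (vec_path X w)) A.
Local Notation h := (2 * H).
Local Notation gridR := (@grid R).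
Implicit Types i j : 'I_(d + d).

Let H0 : 0 < H. Proof. by move: hH_gt; lra. Qed.

Lemma vec_path_diagE w t i : diag_path (vec_path X w) t 0 i = X (component i) t w.
Proof. by rewrite diag_coord mxE. Qed.

Let xt w := diag_path (vec_path X w).
Let pl M w := pl_along (uniform_partition M) (xt w).

Let plE M w : forall k u, (k < M)%N -> gridR M k <= u <= gridR M k.+1 ->
  pl M w u = (fun k => xt w (gridR M k)) k + (u - gridR M k) *:
    (M%:R *: ((fun k => xt w (gridR M k)) k.+1 - (fun k => xt w (gridR M k)) k)).
Proof. by move=> k u kM ku; exact: pl_along_uniform. Qed.

Let pl_area M p k i j w := levy_area (pl M w) (gridR M p) (gridR M (p + k)) i j.

Let pl_areaE M p k i j w : (0 < M)%N -> (p + k <= M)%N -> pl_area M p k i j w =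
  2^-1 * (\sum_(u < k)
    ((X (component i) (gridR M (p + u)) w - X (component i) (gridR M p) w) *
       dX X M (component j) (p + u) w -
     (X (component j) (gridR M (p + u)) w - X (component j) (gridR M p) w) *
       dX X M (component i) (p + u) w)).
Proof.
move=> M0 pk; rewrite /pl_area (grid_levy_area M0 (@plE M w))//.
by congr (_ * _); apply: eq_bigr => u _; rewrite /xt !vec_path_diagE.
Qed.

Let X_all_moments M k l : (k <= M)%N -> all_moments P (X l (gridR M k)).
Proof. by move=> kM; apply: (fbm_all_moments (hX l)); exact: grid01. Qed.

Lemma dX_all_moments M k l : (k < M)%N -> all_moments P (dX X M l k).
Proof. by move=> kM; apply: all_momentsB; apply: X_all_moments => //; exact: ltnW. Qed.

Let riemann_all_moments M p k l m : (p + k <= M)%N ->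
  all_moments P (fun w => \sum_(u < k) (X l (gridR M (p + u)) w - X l (gridR M p) w) *
       dX X M m (p + u) w).
Proof.
move=> pk; apply: all_moments_sum => u _.
have pu : (p + u < M)%N by rewrite (leq_trans _ pk)// ltn_add2l.
apply: all_momentsM; last exact: dX_all_moments.
apply: all_momentsB; apply: X_all_moments; first exact: ltnW.
by rewrite (leq_trans _ pk)// leq_addr.
Qed.

Let pl_area_all_moments M p k i j : (0 < M)%N -> (p + k <= M)%N ->
  all_moments P (pl_area M p k i j).
Proof.
move=> M0 pk; apply: (@eq_all_moments _ _ _ P (fun w => 2^-1 *
  (\sum_(u < k) (X (component i) (gridR M (p + u)) w - X (component i) (gridR M p) w) *
       dX X M (component j) (p + u) w -
   \sum_(u < k) (X (component j) (gridR M (p + u)) w - X (component j) (gridR M p) w) *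
       dX X M (component i) (p + u) w))).
  by move=> w; rewrite pl_areaE// sumrB.
by apply: all_momentsZ; apply: all_momentsB; exact: riemann_all_moments.
Qed.

Let pl_cvg n s t i j : (0 < n)%N -> 0 <= s -> s <= t -> t <= 1 ->
  cvg_prob P (fun k w => levy_area (pl (n * k.+1) w) s t i j) (fun w => A w s t i j).
Proof.
move=> n0 s0 st t1 eps e0; have [_ _ lim] := hA.
have nk k : (0 < n * k.+1)%N by rewrite muln_gt0 n0.
apply: (lim (fun k => uniform_partition (n * k.+1))) => // [k|].
  exact: uniform_itv_partition.
apply: (@squeeze_cvgr _ _ _ _ (fun=> 0) (fun k => k.+1%:R^-1)).
- apply: nearW => k; apply/andP; split.
    exact: bigmax_ge_id.
  apply: le_trans (uniform_mesh (nk k)) _.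
  by rewrite lef_pV2 ?posrE ?ltr0n// ler_nat leq_pmull.
- exact: cvg_cst.
- exact: cvg_harmonic.
Qed.

Lemma area_measurable s t i j : 0 <= s -> s <= t -> t <= 1 ->
  measurable_fun [set: T] (fun w => A w s t i j).
Proof. by have [mA _ _] := hA; exact: mA. Qed.

Let chen_grid n a b c i j : (0 < n)%N -> (a <= b)%N -> (b <= c)%N -> (c <= n)%N ->
  let s := gridR n a in let u := gridR n b in let t := gridR n c in
  {ae P, forall w, A w s t i j = A w s u i j + (A w u t i j + 2^-1 *
    ((X (component i) u w - X (component i) s w) * (X (component j) t w - X (component j) u w) -
     (X (component j) u w - X (component j) s w) *
     (X (component i) t w - X (component i) u w)))}.
Proof.
move=> n0 ab bc cn s u t.
have gE k p e : (p <= e)%N -> exists2 m, gridR n p = gridR (n * k.+1) (p * k.+1) &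
    (e * k.+1 = p * k.+1 + m)%N /\ gridR n e = gridR (n * k.+1) (p * k.+1 + m).
  move=> pe; exists ((e - p) * k.+1)%N; first by rewrite gridM.
  by split; rewrite -mulnDl subnKC// gridM.
have am p e k : (p <= e)%N -> (e <= n)%N ->
    all_moments P (fun w => levy_area (pl (n * k.+1) w) (gridR n p) (gridR n e) i j).
  move=> pe en; have [m -> [em ->]] := gE k p e pe.
  by apply: (@pl_area_all_moments _ _ m i j); rewrite ?muln_gt0 ?n0// -em leq_mul2r en orbT.
have g01 m : (m <= n)%N -> 0 <= gridR n m /\ gridR n m <= 1.
  by move=> mn; apply/andP; exact: grid01.
have [s0 _] := g01 _ (leq_trans ab (leq_trans bc cn)).
have [u0 u1] := g01 _ (leq_trans bc cn); have [_ t1] := g01 _ cn.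
have su : s <= u by exact: grid_mono.
have ut : u <= t by exact: grid_mono.
have mX l m : (m <= n)%N -> all_moments P (X l (gridR n m)) by exact: X_all_moments.
have mcross : measurable_fun [set: T] (fun w => 2^-1 *
    ((X (component i) u w - X (component i) s w) * (X (component j) t w - X (component j) u w) -
     (X (component j) u w - X (component j) s w) *
     (X (component i) t w - X (component i) u w))).
  apply: (all_moments_measurable (P := P)); apply: all_momentsZ.
  apply: all_momentsB; apply: all_momentsM; apply: all_momentsB; apply: mX => //;
    exact: leq_trans cn || exact: (leq_trans ab (leq_trans bc cn)).
have mAsu := area_measurable i j s0 su u1.
have mAut := area_measurable i j u0 ut t1.
have man p e k pe en := all_moments_measurable (am p e k pe en).
apply: (@cvg_prob_unique _ _ _ P
    (fun k w => levy_area (pl (n * k.+1) w) s t i j)).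
- by move=> k; apply: man; rewrite ?(leq_trans ab).
- exact: area_measurable (le_trans su ut) t1.
- by apply: measurable_funD => //; exact: measurable_funD.
- exact: pl_cvg (le_trans su ut) t1.
have -> : (fun k w => levy_area (pl (n * k.+1) w) s t i j) =
  (fun k w => levy_area (pl (n * k.+1) w) s u i j + (levy_area (pl (n * k.+1) w) u t i j + 2^-1 *
    ((X (component i) u w - X (component i) s w) * (X (component j) t w - X (component j) u w) -
     (X (component j) u w - X (component j) s w) *
     (X (component i) t w - X (component i) u w)))).
  apply/funext => k; apply/funext => w.
  have nk : (0 < n * k.+1)%N by rewrite muln_gt0 n0.
  have aff p e : (p <= e)%N -> (e <= n)%N -> pwaffine (pl (n * k.+1) w) (gridR n p) (gridR n e).
    move=> pe en; have [m -> [em ->]] := gE k p e pe.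
    by apply: (grid_pwaffine nk (@plE _ w)); rewrite -em leq_mul2r en orbT.
  have node e l : (e <= n)%N -> pl (n * k.+1) w (gridR n e) 0 l = X (component l) (gridR n e) w.
    move=> en; rewrite -(@gridM R n k.+1 e (ltn0Sn k)) (grid_node nk (@plE _ w)) ?leq_mul2r ?en ?orbT//.
    by rewrite /xt vec_path_diagE.
  rewrite (levy_area_chen i j (aff a b ab (leq_trans bc cn)) (aff b c bc cn)).
  by rewrite !node ?addrA// (leq_trans _ cn)// (leq_trans ab).
apply: cvg_probD => //.
- by move=> k; apply: man => //; exact: leq_trans cn.
- by move=> k; apply: measurable_funD => //; exact: man.
- exact: measurable_funD.
- exact: pl_cvg.
- apply: cvg_probD => //; [by move=> k; exact: man|exact: pl_cvg|exact: cvg_prob_cst].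
Qed.

Lemma area_cell_moment n p N q i j : (0 < n)%N -> (p + N <= n)%N ->
  (\int[P]_w ((\sum_(c < N) A w (gridR n (p + c)) (gridR n (p + c).+1) i j) ^+ (2 * q.+1))%:E <=
   (2 ^+ (2 * q.+1) * (2 * ((gaussian_moment (2 * q.+1))%:R ^+ 2 *
    ((2 + (2 * h - 1)^-1) * N%:R * psi h n%:R^-1 ^+ 2) ^+ q.+1)))%:E)%E.
Proof.
move=> n0 pN; set B := _ ^+ 2 * _ ^+ q.+1.
have g01 m : (m <= n)%N -> 0 <= gridR n m /\ gridR n m <= 1.
  by move=> mn; apply/andP; exact: grid01.
have pc (c : 'I_N) : (p + c < n)%N by rewrite (leq_trans _ pN)// ltn_add2l.
pose M k := k.+1.
have M0 k : (0 < M k)%N by [].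
have nk k : (0 < n * M k)%N by rewrite muln_gt0 n0.
have cellE k c w : (c < n)%N ->
    levy_area (pl (n * M k) w) (gridR n c) (gridR n c.+1) i j =
    2^-1 * (riemann_area X n (M k) (component i) (component j) c w -
            riemann_area X n (M k) (component j) (component i) c w).
  move=> cn; rewrite -(@gridM R n (M k) c (M0 k)) -(@gridM R n (M k) c.+1 (M0 k)) mulSn addnC.
  have := @pl_areaE (n * M k) (c * M k) (M k) i j w (nk k); rewrite /pl_area => ->.
    by rewrite /riemann_area sumrB.
  by rewrite addnC -mulSn leq_mul2r cn orbT.
have ram k l m c : (c < n)%N -> all_moments P (riemann_area X n (M k) l m c).
  by move=> cn; apply: riemann_all_moments; rewrite addnC -mulSn leq_mul2r cn orbT.
have cam k (c : 'I_N) : all_moments P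
    (fun w => levy_area (pl (n * M k) w) (gridR n (p + c)) (gridR n (p + c).+1) i j).
  apply: (@eq_all_moments _ _ _ P (fun w => 2^-1 *
      (riemann_area X n (M k) (component i) (component j) (p + c) w -
       riemann_area X n (M k) (component j) (component i) (p + c) w))).
    by move=> w; rewrite cellE.
  by apply: all_momentsZ; apply: all_momentsB; exact: ram.
have Amess (c : 'I_N) : measurable_fun [set: T]
    (fun w => A w (gridR n (p + c)) (gridR n (p + c).+1) i j).
  apply: area_measurable; [|exact: grid_mono|]; last by have [] := g01 _ (pc c).
  by have [] := g01 _ (ltnW (pc c)).
have B0 : 0 <= B.
  have h0 : 0 <= (2 * h - 1)^-1 by rewrite invr_ge0; move: hH_gt; lra.
  by rewrite mulr_ge0 ?sqr_ge0// exprn_ge0// mulr_ge0 ?sqr_ge0// mulr_ge0// addr_ge0.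
pose S k l m w := \sum_(c < N) riemann_area X n (M k) l m (p + c) w.
have Sam k l m : all_moments P (S k l m) by apply: all_moments_sum => c _; exact: ram.
apply: (cvg_prob_moment (Yn := fun k w => \sum_(c < N)
    levy_area (pl (n * M k) w) (gridR n (p + c)) (gridR n (p + c).+1) i j)).
- by move=> k; apply: all_moments_sum => c _; exact: cam.
- exact: measurable_sum.
- move=> k; have YE w : \sum_(c < N)
      levy_area (pl (n * M k) w) (gridR n (p + c)) (gridR n (p + c).+1) i j =
      2^-1 * (S k (component i) (component j) w - S k (component j) (component i) w).
    by rewrite /S -sumrB mulr_sumr; apply: eq_bigr => c _; rewrite cellE.
  under (eq_ex P) => w do rewrite YE.
  have [->|ij] := eqVneq (component i) (component j).
    rewrite (_ : ex P _ = 0); first by rewrite mulr_ge0.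
    under (eq_ex P) => w do rewrite subrr mulr0 expr0n muln_eq0/=.
    exact: ex_cst.
  apply: (@le_trans _ _ (ex P (fun w => S k (component i) (component j) w ^+ (2 * q.+1) +
      S k (component j) (component i) w ^+ (2 * q.+1)))).
    apply: le_ex.
    + by apply: all_moments_exp; apply: all_momentsZ; exact: all_momentsB.
    + by apply: all_momentsD; exact: all_moments_exp.
    + move=> w; have ev (x : R) : `|x| ^+ (2 * q.+1) = x ^+ (2 * q.+1).
        by rewrite !exprM real_normK// num_real.
      rewrite exprMn -ev; have := normrXD_le (S k (component i) (component j) w)
        (- S k (component j) (component i) w) (2 * q.+1).
      rewrite normrN !ev => h1; rewrite exprVn ler_pdivrMl ?exprn_gt0//.
  rewrite exD; [|exact: all_moments_exp|exact: all_moments_exp].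
  rewrite mulr_natl mulr2n lerD// /S; first exact: riemann_area_moment.
  by apply: riemann_area_moment => //; rewrite eq_sym.
- apply: cvg_prob_sum => // [c k|c].
    exact: all_moments_measurable (cam k c).
  apply: pl_cvg => //; [|exact: grid_mono|]; last by have [] := g01 _ (pc c).
  by have [] := g01 _ (ltnW (pc c)).
Qed.

Definition chen_area (a : R -> R -> 'M[R]_(d + d)) (x : R -> 'rV[R]_d) :=
  forall i j s u t, 0 <= s -> s <= u -> u <= t -> t <= 1 ->
  a s t i j = a s u i j + a u t i j + 2^-1 *
    ((x u 0 (component i) - x s 0 (component i)) * (x t 0 (component j) - x u 0 (component j)) -
     (x u 0 (component j) - x s 0 (component j)) * (x t 0 (component i) - x u 0 (component i))).

Lemma fbm_dyadic_cvg k w (t : R) : 0 <= t -> t <= 1 ->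
  X k (gridR (2 ^ J) (dyadic_floor t J)) w @[J --> \oo] --> X k t w.
Proof.
have Xcont : {within `[0, 1], continuous (fun t => X k t w)} by have [] := hX k.
move=> t0 t1; apply: (@within_cvg_seq R R `[0, 1]%classic (fun t => X k t w)
  (fun J => gridR (2 ^ J) (dyadic_floor t J)) t) => //.
- by move=> J; rewrite /= in_itv/=; apply: grid01; exact: dyadic_floor_le1.
- by rewrite /= in_itv/= t0.
- exact: cvg_dyadic_floor.
Qed.

Lemma area_dyadic_cvg w s t i j : 0 <= s -> s <= t -> t <= 1 ->
  A w (gridR (2 ^ J) (dyadic_floor s J)) (gridR (2 ^ J) (dyadic_floor t J)) i j
    @[J --> \oo] --> A w s t i j.
Proof.
move=> s0 st t1; have [_ Acont _] := hA.
apply: (@within_cvg_seq _ _ simplex (fun st => A w st.1 st.2 i j)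
  (fun J => (gridR (2 ^ J) (dyadic_floor s J), gridR (2 ^ J) (dyadic_floor t J))) (s, t)) => //.
- by move=> J; exact: dyadic_simplex.
- by apply: cvg_dyadic_pair => //; exact: le_trans st.
Qed.

Lemma canonical_area_chen : {ae P, forall w, chen_area (A w) (vec_path X w)}.
Proof.
have : {ae P, forall w, forall n a b c, forall i j,
    [&& 0 < n, a <= b, b <= c & c <= n]%N ->
  let s := gridR n a in let u := gridR n b in let t := gridR n c in
  A w s t i j = A w s u i j + (A w u t i j + 2^-1 *
    ((X (component i) u w - X (component i) s w) * (X (component j) t w - X (component j) u w) -
     (X (component j) u w - X (component j) s w) *
     (X (component i) t w - X (component i) u w)))}.
  do 4 (apply/ae_foralln => ?); apply: filter_forall => i; apply: filter_forall => j.
  case: (boolP [&& _, _, _ & _]) => [/and4P[n0 ab bc cn]|_]; last exact: aeW.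
  by apply: filterS (chen_grid i j n0 ab bc cn) => w hw _; exact: hw.
apply: filterS => w chen i j s u t s0 su ut t1.
pose g (r : R) J := gridR (2 ^ J) (dyadic_floor r J).
have t0 : 0 <= t by rewrite (le_trans s0)// (le_trans su).
have u0 : 0 <= u by exact: le_trans su.
have u1 : u <= 1 by exact: le_trans t1.
have s1 : s <= 1 by exact: le_trans u1.
have cA a b := @area_dyadic_cvg w a b i j.
have cX k r := @fbm_dyadic_cvg k w r.
have := cA s t s0 (le_trans su ut) t1.
have -> : (fun J => A w (g s J) (g t J) i j) = (fun J =>
    A w (g s J) (g u J) i j + (A w (g u J) (g t J) i j + 2^-1 *
    ((X (component i) (g u J) w - X (component i) (g s J) w) *
     (X (component j) (g t J) w - X (component j) (g u J) w) -
     (X (component j) (g u J) w - X (component j) (g s J) w) *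
     (X (component i) (g t J) w - X (component i) (g u J) w)))).
  apply/funext => J; apply: chen; rewrite expn_gt0 /= !dyadic_floor_mono//=.
  exact: dyadic_floor_le1.
move=> h1; rewrite !mxE -addrA; apply: cvg_unique h1 _ => //.
apply: cvgD; first exact: cA.
apply: cvgD; first exact: cA.
apply: cvgM; first exact: cvg_cst.
by apply: cvgB; apply: cvgM; apply: cvgB; exact: cX.
Qed.

End CanonicalArea.

Section DiscreteAreaError.
Context {R : realType} {disp : measure_display} {T : measurableType disp}.
Variables (P : probability T R) (d : nat) (X : 'I_d -> R -> {RV P >-> R}) (H : R).
Hypothesis hH_gt : 4^-1 < H.
Hypothesis hH_le : H <= 2^-1.
Hypothesis hX : forall i, fbm H (X i).
Hypothesis X_indep : independent_processes P X.
Variable A : T -> R -> R -> 'M[R]_(d + d).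
Hypothesis hA : canonical_levy_area P (fun w => diag_path (vec_path X w)) A.
Variable n : nat.
Hypothesis n_gt0 : (0 < n)%N.
Local Notation h := (2 * H).
Local Notation gridR := (@grid R).
Implicit Types i j : 'I_(d + d).

Let h_gt : 2^-1 < h. Proof. by move: hH_gt; lra. Qed.
Let h_le1 : h <= 1. Proof. by move: hH_le; lra. Qed.
Let N0 : 0 < n%:R :> R. Proof. by rewrite ltr0n. Qed.

Lemma dX_exM k l c : (c < n)%N ->
  ex P (fun w => dX X n k c w * dX X n l c w) = (k == l)%:R * psi h n%:R^-1.
Proof.
move=> cn; have [<-|kl] := eqVneq k l.
  rewrite mul1r -(fbm_increment_sqr hH_gt hX k cn).
  by apply: eq_ex => w; rewrite expr2.
have a01 (u : 'I_1) : 0 <= gridR n c <= 1 by apply: grid01; exact: ltnW.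
have b01 (u : 'I_1) : 0 <= gridR n c.+1 <= 1 by exact: grid01.
have := increments_independent X_indep hX kl a01 b01 a01 b01 (fun _ : 'I_1 => ord0) (fun _ : 'I_1 => ord0).
under eq_ex do rewrite !big_ord1.
under [X in X * _]eq_ex do rewrite big_ord1.
by rewrite (increments_ex (hX k) a01 b01) !mul0r.
Qed.

Lemma renormE k l : renorm P n (vec_path X) k l = 2^-1 * ((k == l)%:R * (n%:R * psi h n%:R^-1)).
Proof.
rewrite /renorm mxE unlock; congr (_ * _).
have E w : (\sum_(c < n) incr (vec_path X w) (c%:R / n%:R) (c.+1%:R / n%:R) 0 k *
      incr (vec_path X w) (c%:R / n%:R) (c.+1%:R / n%:R) 0 l) =
    \sum_(c < n) dX X n k c w * dX X n l c w.
  by apply: eq_bigr => c _; rewrite /incr !mxE.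
have am : forall c : 'I_n, true -> all_moments P (fun w => dX X n k c w * dX X n l c w).
  by move=> c _; apply: all_momentsM; exact: (dX_all_moments hX).
under eq_integral do rewrite E.
rewrite integral_ex; last exact: all_moments_sum.
rewrite /= ex_sum//; under eq_bigr do rewrite dX_exM//.
by rewrite sumr_const card_ord -[LHS]mulr_natl mulrCA.
Qed.

Lemma lead_lag_renormE i j : lead_lag_renorm P n (vec_path X) i j =
  2^-1 * ((is_lead j)%:R - (is_lead i)%:R) *
  ((component i == component j)%:R * (n%:R * psi h n%:R^-1)).
Proof.
rewrite /lead_lag_renorm /is_lead /component.
rewrite -[i in LHS]splitK -[j in LHS]splitK.
case: (fintype.split i) => k; case: (fintype.split j) => l /=.
- by rewrite block_mxEul mxE subrr mulr0 mul0r.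
- by rewrite block_mxEur renormE subr0 mulr1.
- by rewrite block_mxEdl mxE renormE sub0r mulrN1 mulNr.
- by rewrite block_mxEdr mxE subrr mulr0 mul0r.
Qed.

Lemma psi_inv : psi h n%:R^-1 = n%:R `^ (- h).
Proof. by rewrite psi_pos ?invr_ge0// -powR_inv1 ?ler0n// -powRrM mulN1r. Qed.

Lemma lead_lag_renorm_bound beta i j : beta <= H ->
  `|lead_lag_renorm P n (vec_path X) i j| <= n%:R `^ (1 - 2 * beta).
Proof.
move=> bH; have N1 : 1 <= n%:R :> R by rewrite ler1n.
rewrite lead_lag_renormE psi_inv.
have -> : n%:R * n%:R `^ (- h) = n%:R `^ (1 - h) :> R.
  by rewrite (powR_split _ _ N0) powRr1 ?ler0n.
have p0 : 0 <= n%:R `^ (1 - h) :> R by exact: powR_ge0.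
apply: (@le_trans _ _ (n%:R `^ (1 - h))); last first.
  by apply: ler_powR => //; move: bH; lra.
rewrite !normrM (ger0_norm p0) mulrA ler_piMl// (ger0_norm (_ : 0 <= 2^-1))//.
case: (is_lead i); case: (is_lead j); case: (_ == _);
  rewrite /= ?mulr1n ?mulr0n ?subrr ?subr0 ?sub0r ?normrN ?normr1 ?normr0; lra.
Qed.

Definition cell_error i j c w : R :=
  2^-1 * ((is_lead i)%:R - (is_lead j)%:R) *
  (dX X n (component i) c w * dX X n (component j) c w -
   (component i == component j)%:R * psi h n%:R^-1) -
  A w (gridR n c) (gridR n c.+1) i j.

Lemma area_error_cell i j c w : (c < n)%N ->
  area_error n (vec_path X w) (A w) (lead_lag_renorm P n (vec_path X)) i j
    (gridR n c) (gridR n c.+1) = cell_error i j c w.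
Proof.
move=> cn; rewrite /area_error (lead_lag_cell_area _ n_gt0)// gridS//.
rewrite lead_lag_renormE /cell_error !mxE -/(dX X n _ c w) -/(dX X n _ c w).
rewrite /dX; have n0 : n%:R != 0 :> R by rewrite gt_eqF.
have -> x y : n%:R^-1 * (x * (y * (n%:R * psi h n%:R^-1))) = x * (y * psi h n%:R^-1) :> R.
  by field.
by ring.
Qed.

Lemma cell_error_measurable i j c : (c < n)%N -> measurable_fun [set: T] (cell_error i j c).
Proof.
move=> cn; apply: measurable_funB; last first.
  apply: (area_measurable hA); [|exact: grid_mono|].
    by have /andP[] : 0 <= gridR n c <= 1 by apply: grid01; exact: ltnW.
  by have /andP[] : 0 <= gridR n c.+1 <= 1 by exact: grid01.
apply: (all_moments_measurable (P := P)); apply: all_momentsZ; apply: all_momentsB.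
  by apply: all_momentsM; exact: (dX_all_moments hX).
exact: all_moments_cst.
Qed.

Definition moment_cst q : R :=
  4 ^+ (2 * q.+1) * (gaussian_moment (2 * q.+1))%:R ^+ 2 *
  (2 ^+ q.+1 + 2 * (2 + (2 * h - 1)^-1) ^+ q.+1).

Lemma moment_cst_ge0 q : 0 <= moment_cst q.
Proof.
have h0 : 0 <= (2 * h - 1)^-1 by rewrite invr_ge0; move: hH_gt; lra.
rewrite !mulr_ge0 ?exprn_ge0//.
by rewrite addr_ge0 ?exprn_ge0// mulr_ge0// exprn_ge0// addr_ge0.
Qed.

Lemma cell_error_moment i j p N q : (p + N <= n)%N ->
  (\int[P]_w ((\sum_(c < N) cell_error i j (p + c) w) ^+ (2 * q.+1))%:E <=
   (moment_cst q * (N%:R * psi h n%:R^-1 ^+ 2) ^+ q.+1)%:E)%E.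
Proof.
move=> pN; set k := (2 * q.+1)%N.
have pc (c : 'I_N) : (p + c < n)%N by rewrite (leq_trans _ pN)// ltn_add2l.
pose Q w := \sum_(c < N) (dX X n (component i) (p + c) w * dX X n (component j) (p + c) w -
   (component i == component j)%:R * psi h n%:R^-1).
pose S w := \sum_(c < N) A w (gridR n (p + c)) (gridR n (p + c).+1) i j.
have am : all_moments P Q.
  apply: all_moments_sum => c _; apply: all_momentsB; last exact: all_moments_cst.
  by apply: all_momentsM; exact: (dX_all_moments hX).
have mS : measurable_fun [set: T] S.
  apply: measurable_sum => c; apply: (area_measurable hA); [|exact: grid_mono|].
    by have /andP[] : 0 <= gridR n (p + c) <= 1 by apply: grid01; exact: ltnW.
  by have /andP[] : 0 <= gridR n (p + c).+1 <= 1 by exact: grid01.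
have ev (x : R) : x ^+ k = `|x| ^+ k.
  by rewrite /k !exprM real_normK// num_real.
have ev0 (x : R) : 0 <= x ^+ k by rewrite ev exprn_ge0.
have E w : \sum_(c < N) cell_error i j (p + c) w =
    2^-1 * ((is_lead i)%:R - (is_lead j)%:R) * Q w - S w.
  by rewrite /Q /S mulr_sumr -sumrB.
have bnd w : (\sum_(c < N) cell_error i j (p + c) w) ^+ k <= 2 ^+ k * Q w ^+ k + 2 ^+ k * S w ^+ k.
  rewrite E ev (ev (Q w)) (ev (S w)) -mulrDr.
  apply: le_trans (normrXD_le _ _ _) _; rewrite ler_wpM2l ?exprn_ge0// normrN lerD2r.
  apply: lerXn2r; rewrite ?nnegrE// normrM ler_piMl//.
  rewrite normrM (ger0_norm (_ : 0 <= 2^-1))// ler_pdivrMl//.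
  by case: (is_lead i); case: (is_lead j); rewrite /= ?subrr ?subr0 ?sub0r ?normrN ?normr0 ?normr1; lra.
have mQ : measurable_fun [set: T] Q by exact: all_moments_measurable am.
apply: (@le_trans _ _ (\int[P]_w (((2 ^+ k * Q w ^+ k)%:E + (2 ^+ k * S w ^+ k)%:E))%E)%E).
  apply: ge0_le_integral => //.
  - by move=> w _; rewrite lee_fin.
  - apply/measurable_EFinP; apply: measurable_funX; apply: measurable_sum => c.
    exact: cell_error_measurable.
  - apply/measurable_EFinP; apply: measurable_funD; apply: measurable_funM => //;
      exact: measurable_funX.
  - by move=> w _; rewrite lee_fin.
rewrite ge0_integralD//; last 4 first.
- by move=> w _; rewrite lee_fin mulr_ge0 // exprn_ge0.
- by apply/measurable_EFinP; apply: measurable_funM => //; exact: measurable_funX.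
- by move=> w _; rewrite lee_fin mulr_ge0 // exprn_ge0.
- by apply/measurable_EFinP; apply: measurable_funM => //; exact: measurable_funX.
under [X in (_ + X)%E]eq_integral do rewrite EFinM.
rewrite ge0_integralZl//; last 2 first.
- by apply/measurable_EFinP; exact: measurable_funX.
- by move=> w _; rewrite lee_fin.
rewrite integral_ex; last by apply: all_momentsZ; exact: all_moments_exp.
rewrite exZ; last exact: all_moments_exp.
have h1 := quadratic_variation_moment hH_gt hH_le hX X_indep pN (component i) (component j) q.
have h2 := area_cell_moment hH_gt hH_le hX X_indep hA q i j n_gt0 pN.
have h3 : ((2 ^+ k)%:E * (\int[P]_w (S w ^+ k)%:E) <= (2 ^+ k)%:E *
  (2 ^+ k * (2 * ((gaussian_moment k)%:R ^+ 2 *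
    ((2 + (2 * h - 1)^-1) * N%:R * psi h n%:R^-1 ^+ 2) ^+ q.+1)))%:E)%E.
  by apply: lee_wpmul2l => //; rewrite lee_fin exprn_ge0.
have h4 : ((2 ^+ k * ex P (fun w => Q w ^+ k))%:E <= (2 ^+ k * (2 ^+ k *
    (gaussian_moment k)%:R ^+ 2 * (2 * N%:R * psi h n%:R^-1 ^+ 2) ^+ q.+1))%:E)%E.
  by rewrite lee_fin ler_wpM2l ?exprn_ge0.
apply: (le_trans (leeD h4 h3)); rewrite -EFinM -EFinD lee_fin /moment_cst.
rewrite le_eqVlt; apply/orP; left; apply/eqP.
have -> : (4 : R) = 2 * 2 by ring.
set g := (gaussian_moment k)%:R ^+ 2; set c := 2 + (2 * h - 1)^-1.
by move: (psi _ _ ^+ 2) g c => Z g c; rewrite -/k !exprMn; ring.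
Qed.

End DiscreteAreaError.

Section RandomModulus.
Context {R : realType} {disp : measure_display} {T : measurableType disp}.
Variable P : probability T R.
Variables (Z : nat -> nat -> T -> R) (k : nat) (C rho r : R).
Local Notation m := (2 * k.+1)%N.
Hypothesis C0 : 0 <= C.
Hypothesis rho0 : 0 < rho.
Hypothesis r0 : 0 <= r.
Hypothesis r1 : r < 1.
Hypothesis mZ : forall j l, (l < 2 ^ j)%N -> measurable_fun [set: T] (Z j l).
Hypothesis Z_moment : forall j l, (l < 2 ^ j)%N ->
  (\int[P]_w (Z j l w ^+ m)%:E <= (C * (rho ^+ j) ^+ m * (r / 2) ^+ j)%:E)%E.

Definition level_modulus j w : \bar R := (\sum_(l < 2 ^ j) ((Z j l w / rho ^+ j) ^+ m)%:E)%E.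
Definition modulus w : \bar R := (\sum_(j <oo) level_modulus j w)%E.

Let even_ge0 (x : R) : 0 <= x ^+ m.
Proof. by rewrite exprM exprn_ge0// sqr_ge0. Qed.

Let level_ge0 j w : (0 <= level_modulus j w)%E.
Proof. by apply: sume_ge0 => l _; rewrite lee_fin. Qed.

Lemma modulus_ge0 w : (0 <= modulus w)%E.
Proof. by apply: nneseries_ge0 => j _ _; exact: level_ge0. Qed.

Let mterm j (l : 'I_(2 ^ j)) :
  measurable_fun [set: T] (fun w => ((Z j l w / rho ^+ j) ^+ m)%:E).
Proof.
by apply/measurable_EFinP; apply: measurable_funX; apply: measurable_funM => //; exact: mZ.
Qed.

Let mlevel j : measurable_fun [set: T] (level_modulus j).
Proof. by apply: emeasurable_sum => l; exact: mterm. Qed.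

Lemma measurable_modulus : measurable_fun [set: T] modulus.
Proof.
apply: (eq_measurable_fun (fun w => \sum_(i <oo | i \in xpredT) level_modulus i w)%E) => //.
exact: ge0_emeasurable_sum.
Qed.

Lemma integral_modulus : (\int[P]_w modulus w <= (C / (1 - r))%:E)%E.
Proof.
rewrite integral_nneseries//.
have int_level j : (\int[P]_w level_modulus j w <= (C * r ^+ j)%:E)%E.
  rewrite ge0_integral_sum//; last first.
    by move=> l w _; rewrite lee_fin.
  apply: (@le_trans _ _ (\sum_(l < 2 ^ j) (C * (r / 2) ^+ j)%:E)%E).
    apply: lee_sum => l _.
    have E w : ((Z j l w / rho ^+ j) ^+ m)%:E = (((rho ^+ j) ^+ m)^-1%:E * (Z j l w ^+ m)%:E)%E.
      by rewrite -EFinM exprMn exprVn mulrC.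
    under eq_integral do rewrite E.
    have rm : 0 < (rho ^+ j) ^+ m by rewrite !exprn_gt0.
    rewrite ge0_integralZl//; last 3 first.
    - by apply/measurable_EFinP; apply: measurable_funX; exact: mZ.
    - by move=> w _; rewrite lee_fin.
    - by rewrite lee_fin invr_ge0 ltW.
    have i0 : (0 <= ((rho ^+ j) ^+ m)^-1%:E)%E by rewrite lee_fin invr_ge0 ltW.
    apply: le_trans (lee_wpmul2l i0 (Z_moment (ltn_ord l))) _.
    rewrite -EFinM lee_fin le_eqVlt; apply/orP; left; apply/eqP.
    by move: rm => /lt0r_neq0 rm; field.
  rewrite sumEFin lee_fin sumr_const card_ord -[leLHS]mulr_natl natrX le_eqVlt; apply/orP; left; apply/eqP.
  by rewrite exprMn exprVn; field; rewrite expf_neq0.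
apply: lime_le; first by apply: is_cvg_nneseries => j _ _; exact: integral_ge0.
apply: nearW => n; rewrite big_mkord.
apply: (@le_trans _ _ (\sum_(j < n) (C * r ^+ j)%:E)%E); first exact: lee_sum.
rewrite sumEFin lee_fin -mulr_sumr ler_wpM2l// -[leRHS]mul1r ler_pdivlMr ?subr_gt0//.
have -> : (\sum_(j < n) r ^+ j) * (1 - r) = 1 - r ^+ n.
  by rewrite -[1 - r ^+ n]opprB subrX1; ring.
by rewrite gerBl exprn_ge0.
Qed.

Lemma modulus_bound w g j l : 0 <= g -> (modulus w <= (g ^+ m)%:E)%E -> (l < 2 ^ j)%N ->
  `|Z j l w| <= g * rho ^+ j.
Proof.
move=> g0 wg lj; have rj : 0 < rho ^+ j by rewrite exprn_gt0.
rewrite -ler_pdivrMr// -[X in _ / X]gtr0_norm// -normf_div.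
have h : (Z j l w / rho ^+ j) ^+ m <= g ^+ m.
  rewrite -lee_fin; apply: le_trans wg; apply: (@le_trans _ _ (level_modulus j w)).
    rewrite /level_modulus (bigD1 (Ordinal lj))//= leeDl//.
    by apply: sume_ge0 => i _; rewrite lee_fin.
  rewrite /modulus; apply: le_trans (nneseries_lim_ge j.+1 _); last by [].
  by rewrite big_nat_recr//= leeDr// sume_ge0.
have e : `|Z j l w / rho ^+ j| ^+ m = (Z j l w / rho ^+ j) ^+ m.
  by rewrite -normrX ger0_norm.
by rewrite -e in h; rewrite -(@ler_pXn2r _ m) ?nnegrE.
Qed.

End RandomModulus.

Section PathwiseBounds.
Context {R : realType} {disp : measure_display} {T : measurableType disp}.
Variables (P : probability T R) (d : nat) (X : 'I_d -> R -> {RV P >-> R}) (H : R).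
Hypothesis hH_gt : 4^-1 < H.
Hypothesis hH_le : H <= 2^-1.
Hypothesis hX : forall i, fbm H (X i).
Hypothesis X_indep : independent_processes P X.
Variable A : T -> R -> R -> 'M[R]_(d + d).
Hypothesis hA : canonical_levy_area P (fun w => diag_path (vec_path X w)) A.
Variables (alpha beta : R) (q : nat).
Hypothesis alpha_gt : 4^-1 < alpha.
Hypothesis alpha_beta : alpha < beta.
Hypothesis beta_H : beta < H.
Local Notation m := (2 * q.+1)%N.
Hypothesis q_large : 1 < (H - beta) * m%:R.
Local Notation h := (2 * H).
Local Notation gridR := (@grid R).
Implicit Types (i j : 'I_(d + d)) (k : 'I_d).

Let H0 : 0 < H. Proof. by move: hH_gt; lra. Qed.
Let beta0 : 0 < beta. Proof. by move: alpha_gt alpha_beta; lra. Qed.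

Definition area_cell i j l c w := A w (gridR (2 ^ l) c) (gridR (2 ^ l) c.+1) i j.

Lemma area_cell_measurable i j l c : (c < 2 ^ l)%N -> measurable_fun [set: T] (area_cell i j l c).
Proof.
move=> cl; apply: (area_measurable hA); [|exact: grid_mono|].
  by have /andP[] : 0 <= gridR (2 ^ l) c <= 1 by apply: grid01; exact: ltnW.
by have /andP[] : 0 <= gridR (2 ^ l) c.+1 <= 1 by exact: grid01.
Qed.

Let rH : R := 2 `^ (- H).
Let rho : R := 2 `^ (- beta).
Let rho2 : R := 2 `^ (- (2 * beta)).
Let r : R := 2 * (rH / rho) ^+ (2 * m).

Let rho_gt0 : 0 < rho. Proof. exact: powR_gt0. Qed.
Let rho2_gt0 : 0 < rho2. Proof. exact: powR_gt0. Qed.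
Let rH_gt0 : 0 < rH. Proof. exact: powR_gt0. Qed.
Let rho2E : rho2 = rho ^+ 2.
Proof. by rewrite /rho2 /rho -powR_mulrn ?powR_ge0// -powRrM; congr (_ `^ _); ring. Qed.

Let r0 : 0 <= r.
Proof. by rewrite mulr_ge0// exprn_ge0// divr_ge0// ltW. Qed.

Let r_lt1 : r < 1.
Proof.
rewrite /r /rH /rho -powRN -powR_split// opprK -powR_mulrn ?powR_ge0// -powRrM natrM.
rewrite -[X in X * _](powRr1 (ler0n R 2)) -powR_split//.
have -> : 1 + (- H + beta) * (2 * m%:R) = - ((H - beta) * m%:R * 2 - 1) by ring.
by apply: powR2N_lt1; move: q_large; lra.
Qed.

Let psi_dyadic l : psi h (2 ^ l)%:R^-1 = (rH ^+ l) ^+ 2.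
Proof.
rewrite psi_pos ?invr_ge0// /rH dyadic_powR -powR_mulrn ?powR_ge0// -powRrM.
by congr (_ `^ _); rewrite mulrC.
Qed.

Let r_split l : (rH ^+ l) ^+ (2 * m) = (rho ^+ l) ^+ (2 * m) * (r / 2) ^+ l.
Proof.
have -> : r / 2 = (rH / rho) ^+ (2 * m) by rewrite /r; field.
move: (2 * m)%N => p; rewrite [X in _ * X]exprAC -exprMn -exprMn mulrCA divff ?mulr1//.
by rewrite gt_eqF.
Qed.

Let CX : R := (gaussian_moment (2 * m))%:R.
Let CA : R := 2 ^+ m * (2 * ((gaussian_moment m)%:R ^+ 2 * (2 + (2 * h - 1)^-1) ^+ q.+1)).

Let CA0 : 0 <= CA.
Proof.
have h0 : 0 <= (2 * h - 1)^-1 by rewrite invr_ge0; move: hH_gt; lra.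
by rewrite mulr_ge0 ?exprn_ge0// mulr_ge0// mulr_ge0 ?sqr_ge0// exprn_ge0// addr_ge0.
Qed.

Let dX_cell_moment k l c : (c < 2 ^ l)%N ->
  (\int[P]_w (dX X (2 ^ l) k c w ^+ (2 * (2 * q).+2))%:E <=
   (CX * (rho ^+ l) ^+ (2 * (2 * q).+2) * (r / 2) ^+ l)%:E)%E.
Proof.
move=> cl; have -> : (2 * q).+2 = m by rewrite mulnS.
rewrite integral_ex; last by apply: all_moments_exp; exact: (dX_all_moments hX).
rewrite (fbm_increment_moment hH_gt hX) ?grid01//; last exact: ltnW.
by rewrite gridS ?expn_gt0// psi_dyadic -exprM r_split lee_fin mulrA.
Qed.

Let area_cell_moment1 i j l c : (c < 2 ^ l)%N ->
  (\int[P]_w (area_cell i j l c w ^+ m)%:E <= (CA * (rho2 ^+ l) ^+ m * (r / 2) ^+ l)%:E)%E.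
Proof.
move=> cl; have l0 : (0 < 2 ^ l)%N by rewrite expn_gt0.
have c1 : (c + 1 <= 2 ^ l)%N by rewrite addn1.
have := area_cell_moment hH_gt hH_le hX X_indep hA q i j l0 c1.
under eq_integral do rewrite big_ord_recl big_ord0 addr0 addn0.
have e1 : (rho2 ^+ l) ^+ m * (r / 2) ^+ l = (rH ^+ l) ^+ (2 * m).
  by rewrite rho2E (exprAC rho 2 l) -exprM -r_split.
have e2 : (((rH ^+ l) ^+ 2) ^+ 2) ^+ q.+1 = (rH ^+ l) ^+ (2 * m).
  by rewrite -!exprM !mulnA.
move=> /le_trans; apply; rewrite lee_fin psi_dyadic mulr1 -mulrA e1 -e2 /CA.
by rewrite exprMn le_eqVlt; apply/orP; left; apply/eqP; ring.
Qed.

Definition path_modulus w : \bar R :=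
  (1 + ((\sum_k modulus (fun l c => dX X (2 ^ l) k c) (2 * q).+1 rho w) +
   (\sum_i \sum_j modulus (area_cell i j) q rho2 w)))%E.

Let sums_ge0 w : (0 <= (\sum_k modulus (fun l c => dX X (2 ^ l) k c) (2 * q).+1 rho w) +
   (\sum_i \sum_j modulus (area_cell i j) q rho2 w))%E.
Proof.
rewrite adde_ge0//; apply: sume_ge0 => i _; first exact: modulus_ge0.
by apply: sume_ge0 => j _; exact: modulus_ge0.
Qed.

Lemma path_modulus_ge1 w : (1 <= path_modulus w)%E.
Proof. by rewrite leeDl. Qed.

Let mdX k l c : (c < 2 ^ l)%N -> measurable_fun [set: T] (dX X (2 ^ l) k c).
Proof. by move=> cl; apply: (all_moments_measurable (P := P)); exact: (dX_all_moments hX). Qed.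

Let m_mod_X k : measurable_fun [set: T] (modulus (fun l c => dX X (2 ^ l) k c) (2 * q).+1 rho).
Proof. exact/measurable_modulus/mdX. Qed.

Let m_mod_A i j : measurable_fun [set: T] (modulus (area_cell i j) q rho2).
Proof. exact/measurable_modulus/area_cell_measurable. Qed.

Lemma measurable_path_modulus : measurable_fun [set: T] path_modulus.
Proof.
apply: emeasurable_funD => //; apply: emeasurable_funD.
  by apply: emeasurable_sum => k; exact: m_mod_X.
by apply: emeasurable_sum => i; apply: emeasurable_sum => j; exact: m_mod_A.
Qed.

Lemma integral_path_modulus : (\int[P]_w path_modulus w < +oo)%E.
Proof.
have finite_int (V : nat -> nat -> T -> R) e (C s : R) : 0 <= C -> 0 < s ->
    (forall l c, (c < 2 ^ l)%N -> measurable_fun [set: T] (V l c)) ->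
    (forall l c, (c < 2 ^ l)%N ->
      (\int[P]_w (V l c w ^+ (2 * e.+1))%:E <= (C * (s ^+ l) ^+ (2 * e.+1) * (r / 2) ^+ l)%:E)%E) ->
    (\int[P]_w modulus V e s w < +oo)%E.
  move=> C0 s0 mV hV; apply: le_lt_trans (integral_modulus C0 s0 r0 r_lt1 mV hV) _.
  by rewrite ltry.
have mX_ge0 w : (0 <= \sum_k modulus (fun l c => dX X (2 ^ l) k c) (2 * q).+1 rho w)%E.
  by apply: sume_ge0 => k _; exact: modulus_ge0.
have mA_ge0 i w : (0 <= \sum_j modulus (area_cell i j) q rho2 w)%E.
  by apply: sume_ge0 => k _; exact: modulus_ge0.
have mmA i : measurable_fun [set: T] (fun w => \sum_j modulus (area_cell i j) q rho2 w)%E.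
  by apply: emeasurable_sum => j; exact: m_mod_A.
have mmX : measurable_fun [set: T]
    (fun w => \sum_k modulus (fun l c => dX X (2 ^ l) k c) (2 * q).+1 rho w)%E.
  by apply: emeasurable_sum => j; exact: m_mod_X.
have mmAA : measurable_fun [set: T] (fun w => \sum_i \sum_j modulus (area_cell i j) q rho2 w)%E.
  exact: emeasurable_sum.
have mAA_ge0 w : (0 <= \sum_i \sum_j modulus (area_cell i j) q rho2 w)%E by exact: sume_ge0.
rewrite ge0_integralD//; last exact: emeasurable_funD.
rewrite [X in (X + _)%E](_ : _ = 1%E); last first.
  by rewrite integral_cst// mul1e; exact: probability_setT.
rewrite ge0_integralD//.
rewrite lte_add_pinfty ?ltry// lte_add_pinfty//.
  rewrite ge0_integral_sum//; last by move=> k w _; exact: modulus_ge0.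
  apply: lte_sum_pinfty => k _.
  by apply: (@finite_int _ _ CX) => //; [exact: mdX|exact: dX_cell_moment].
rewrite ge0_integral_sum//; apply: lte_sum_pinfty => i _.
rewrite ge0_integral_sum//; last by move=> k w _; exact: modulus_ge0.
apply: lte_sum_pinfty => j _.
by apply: (@finite_int _ _ CA) => //; [exact: area_cell_measurable|exact: area_cell_moment1].
Qed.

Definition path_norm w : R := fine (path_modulus w) `^ (m%:R^-1).

Let m0 : m%:R != 0 :> R. Proof. by rewrite pnatr_eq0. Qed.

Lemma powR_root (x : R) : 0 <= x -> (x `^ (m%:R^-1)) ^+ m = x.
Proof. by move=> x0; rewrite -powR_mulrn ?powR_ge0// -powRrM mulVf// powRr1. Qed.

Lemma path_norm_exp w : path_norm w ^+ m = fine (path_modulus w).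
Proof. by rewrite powR_root// fine_ge0// (le_trans _ (path_modulus_ge1 w)). Qed.

Section FiniteModulus.
Variable w : T.
Hypothesis w_fin : (path_modulus w < +oo)%E.

Let fin : path_modulus w \is a fin_num.
Proof. by rewrite ge0_fin_numE// (le_trans _ (path_modulus_ge1 w)). Qed.

Let modE : path_modulus w = (path_norm w ^+ m)%:E.
Proof. by rewrite path_norm_exp fineK. Qed.

Lemma path_norm_ge1 : 1 <= path_norm w.
Proof.
rewrite -(@ler_pXn2r _ m) ?nnegrE ?powR_ge0// expr1n -lee_fin -modE.
exact: path_modulus_ge1.
Qed.

Let g := path_norm w.
Let g0 : 0 <= g. Proof. exact: powR_ge0. Qed.

Let dX_cell k l c : (c < 2 ^ l)%N -> `|dX X (2 ^ l) k c w| <= Num.sqrt g * rho ^+ l.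
Proof.
move=> cl; apply: (@modulus_bound _ _ _ (fun l c => dX X (2 ^ l) k c) (2 * q).+1) => //.
have -> : (2 * (2 * q).+2 = 2 * m)%N by congr (2 * _)%N; rewrite mulnS.
rewrite exprM sqr_sqrtr// -modE; apply: (@le_trans _ _ (\sum_k modulus (fun l c => dX X (2 ^ l) k c) (2 * q).+1 rho w)%E).
  rewrite (bigD1 k)//= leeDl//.
  by apply: sume_ge0 => k' _; exact: modulus_ge0.
rewrite /path_modulus addeCA leeDl// adde_ge0// sume_ge0// => i _.
by apply: sume_ge0 => j _; exact: modulus_ge0.
Qed.

Let area_cell_bound i j l c : (c < 2 ^ l)%N -> `|area_cell i j l c w| <= g * rho2 ^+ l.
Proof.
move=> cl; apply: (@modulus_bound _ _ _ (area_cell i j) q) => //.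
rewrite -modE; apply: (@le_trans _ _ (\sum_i \sum_j modulus (area_cell i j) q rho2 w)%E).
  rewrite (bigD1 i)//= (bigD1 j)//= -addeA leeDl// adde_ge0//.
    by apply: sume_ge0 => k' _; exact: modulus_ge0.
  by apply: sume_ge0 => i' _; apply: sume_ge0 => j' _; exact: modulus_ge0.
rewrite /path_modulus addeA leeDr// adde_ge0// sume_ge0// => k _; exact: modulus_ge0.
Qed.

Definition chain_cst (th : R) : R := 3 / (1 - 2 `^ (- th)) + 2.

Lemma chain_cst_ge0 th : 0 < th -> 0 <= chain_cst th.
Proof. by move=> th0; rewrite addr_ge0// divr_ge0// subr_ge0 ltW// powR2N_lt1. Qed.

Let kappa := chain_cst beta * Num.sqrt g.
Let kappa0 : 0 <= kappa. Proof. by rewrite mulr_ge0 ?sqrtr_ge0// chain_cst_ge0. Qed.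

Lemma increment_cont k :
  {within @simplex R, continuous (fun st => X k st.2 w - X k st.1 w)}.
Proof.
have Xcont : {within `[0, 1], continuous (fun t => X k t w)} by have [] := hX k.
move/subspace_continuousP : Xcont => Xcont.
apply/subspace_continuousP => -[s t] [/= s0 [st t1]].
have in01 (f : R * R -> R) (u : R) : 0 <= u <= 1 ->
    (forall x, simplex x -> 0 <= f x <= 1) -> f x @[x --> (s, t)] --> u ->
    X k (f x) w @[x --> within (@simplex R) (nbhs (s, t))] --> X k u w.
  move=> u01 fs fu; have u01' : `[0, 1]%classic u by rewrite /= in_itv.
  have pw : f x @[x --> within (@simplex R) (nbhs (s, t))] --> within `[0, 1]%classic (nbhs u).
    move=> B /= /fu hB.
    have : \forall x \near (s, t), `[0, 1]%classic (f x) -> B (f x) by exact: hB.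
    apply: (@filterS _ (nbhs (s, t)) _ (fun x => `[0, 1]%classic (f x) -> B (f x))).
    by move=> x fB sx; apply: fB; rewrite /= in_itv/=; exact: fs.
  exact: (cvg_comp _ _ pw (Xcont u u01')).
apply: cvgB; apply: in01.
- by rewrite (le_trans s0).
- by move=> [a b] /= [a0 [ab b1]]; rewrite b1 (le_trans a0).
- exact: cvg_snd.
- by rewrite s0 (le_trans st).
- by move=> [a b] /= [a0 [ab b1]]; rewrite a0 (le_trans ab).
- exact: cvg_fst.
Qed.

Lemma path_holder k s t : 0 <= s -> s <= t -> t <= 1 ->
  `|X k t w - X k s w| <= kappa * (t - s) `^ beta.
Proof.
move=> s0 st t1.
have add a b c : 0 <= a -> a <= b -> b <= c -> c <= 1 ->
    `|(X k c w - X k a w) - (X k b w - X k a w) - (X k c w - X k b w)| <= 0 * (c - a) `^ beta.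
  by move=> _ _ _ _; rewrite mul0r (_ : _ - _ = 0) ?normr0//; ring.
have := @chaining _ (fun s t => X k t w - X k s w) beta 0 (Num.sqrt g) beta0
  (lexx _) (sqrtr_ge0 _) add (@increment_cont k) (@dX_cell k) s t s0 st t1.
by rewrite addr0.
Qed.

Hypothesis w_chen : chen_area (A w) (vec_path X w).

Let kappa2 := chain_cst (2 * beta) * (g + kappa ^+ 2).

Lemma area_holder i j s t : 0 <= s -> s <= t -> t <= 1 ->
  `|A w s t i j| <= kappa2 * (t - s) `^ (2 * beta).
Proof.
move=> s0 st t1; have [_ Acont _] := hA.
have b20 : 0 < 2 * beta by rewrite mulr_gt0.
have add a b c : 0 <= a -> a <= b -> b <= c -> c <= 1 ->
    `|A w a c i j - A w a b i j - A w b c i j| <= kappa ^+ 2 * (c - a) `^ (2 * beta).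
  move=> a0 ab bc c1; rewrite (w_chen i j a0 ab bc c1) !mxE.
  have b0 : 0 <= b by exact: le_trans ab.
  have b1 : b <= 1 by exact: le_trans c1.
  set V := (c - a) `^ (2 * beta).
  have -> : kappa ^+ 2 * V = (kappa * (c - a) `^ beta) * (kappa * (c - a) `^ beta).
    have -> : V = ((c - a) `^ beta) ^+ 2.
      by rewrite /V -powR_mulrn ?powR_ge0// -powRrM mulrC.
    by ring.
  have l1 u : `|X u b w - X u a w| <= kappa * (c - a) `^ beta.
    apply: le_trans (path_holder u a0 ab b1) _; rewrite ler_wpM2l//.
    by apply: powR_mono => //; rewrite ?subr_ge0// lerB.
  have l2 u : `|X u c w - X u b w| <= kappa * (c - a) `^ beta.
    apply: le_trans (path_holder u b0 bc c1) _; rewrite ler_wpM2l//.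
    by apply: powR_mono => //; rewrite ?subr_ge0// lerB.
  have l3 u v : `|(X u b w - X u a w) * (X v c w - X v b w)| <=
      (kappa * (c - a) `^ beta) * (kappa * (c - a) `^ beta).
    by rewrite normrM ler_pM.
  rewrite [X in `|X|](_ : _ = 2^-1 *
    ((X (component i) b w - X (component i) a w) * (X (component j) c w - X (component j) b w) -
     (X (component j) b w - X (component j) a w) *
     (X (component i) c w - X (component i) b w))); last by ring.
  rewrite normrM (ger0_norm (_ : 0 <= 2^-1))// ler_pdivrMl//.
  by apply: le_trans (ler_normB _ _) _; rewrite mulr_natl mulr2n lerD.
exact: (@chaining _ (fun s t => A w s t i j) (2 * beta) (kappa ^+ 2) g b20
  (sqr_ge0 _) g0 add (Acont w i j) (@area_cell_bound i j) s t s0 st t1).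
Qed.

End FiniteModulus.

End PathwiseBounds.

Section AreaErrorModulus.
Context {R : realType} {disp : measure_display} {T : measurableType disp}.
Variables (P : probability T R) (d : nat) (X : 'I_d -> R -> {RV P >-> R}) (H : R).
Hypothesis hH_gt : 4^-1 < H.
Hypothesis hH_le : H <= 2^-1.
Hypothesis hX : forall i, fbm H (X i).
Hypothesis X_indep : independent_processes P X.
Variable A : T -> R -> R -> 'M[R]_(d + d).
Hypothesis hA : canonical_levy_area P (fun w => diag_path (vec_path X w)) A.
Variables (alpha beta : R) (q : nat).
Hypothesis alpha_gt : 4^-1 < alpha.
Hypothesis alpha_beta : alpha < beta.
Hypothesis beta_H : beta < H.
Local Notation m := (2 * q.+1)%N.
Hypothesis q_large : 1 < (H - beta) * m%:R.
Local Notation h := (2 * H).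
Local Notation gridR := (@grid R).
Implicit Types (i j : 'I_(d + d)) (k : 'I_d) (n : nat).

Let even_ge0 (x : R) : 0 <= x ^+ m.
Proof. by rewrite exprM exprn_ge0// sqr_ge0. Qed.
Let alpha0 : 0 < alpha. Proof. by move: alpha_gt; lra. Qed.
Let beta0 : 0 < beta. Proof. by move: alpha_gt alpha_beta; lra. Qed.
Let m0 : m%:R != 0 :> R. Proof. by rewrite pnatr_eq0. Qed.

Definition grid_error n i j p N w : R :=
  if (p + N.+1 <= n)%N then
    (\sum_(c < N.+1) cell_error X H A n i j (p + c) w) / gridR n N.+1 `^ (2 * alpha)
  else 0.

Definition grid_modulus n w : R :=
  \sum_(p < n) \sum_(N < n) \sum_i \sum_j grid_error n i j p N w ^+ m.

Lemma grid_error_measurable n i j p N : (0 < n)%N ->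
  measurable_fun [set: T] (grid_error n i j p N).
Proof.
move=> n0; rewrite /grid_error; case: (boolP (p + N.+1 <= n)%N) => pN; last exact: measurable_cst.
apply: measurable_funM => //; apply: measurable_sum => c.
apply: (cell_error_measurable hX hA).
by rewrite (leq_trans _ pN)// ltn_add2l.
Qed.

Let mterm n i j p N : (0 < n)%N -> measurable_fun [set: T] (fun w => grid_error n i j p N w ^+ m).
Proof. by move=> n0; apply: measurable_funX; exact: grid_error_measurable. Qed.

Lemma grid_modulus_measurable n : (0 < n)%N -> measurable_fun [set: T] (grid_modulus n).
Proof. by move=> n0; do 4 apply: measurable_sum => ?; exact: mterm. Qed.

Lemma grid_modulus_ge0 n w : 0 <= grid_modulus n w.
Proof. by do 4 apply: sumr_ge0 => ? _. Qed.

Let cell_scaling n N : (0 < n)%N -> (0 < N)%N ->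
  N%:R * psi h n%:R^-1 ^+ 2 <= n%:R `^ (- (4 * (H - alpha))) * (gridR n N `^ (2 * alpha)) ^+ 2.
Proof.
move=> n0 N0; have n0' : 0 < n%:R :> R by rewrite ltr0n.
have N1 : 1 <= N%:R :> R by rewrite ler1n.
have N0' : 0 < N%:R :> R by rewrite ltr0n.
have sq (x : R) : (x `^ (2 * alpha)) ^+ 2 = x `^ (4 * alpha).
  by rewrite -powR_mulrn ?powR_ge0// -powRrM; congr (_ `^ _); ring.
rewrite sq psi_inv// -powR_mulrn ?powR_ge0// -powRrM /grid powRM ?invr_ge0//.
rewrite -(powR_inv1 (ltW n0')) -powRrM [n%:R `^ _ * (_ * _)]mulrCA -powR_split//.
rewrite (_ : - (4 * (H - alpha)) + -1 * (4 * alpha) = - h * 2); last by ring.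
rewrite ler_wpM2r ?powR_ge0// -[leLHS]powRr1//; apply: ler_powR => //.
by move: alpha_gt; lra.
Qed.

Let grid_error_moment n i j p N : (0 < n)%N ->
  (\int[P]_w (grid_error n i j p N w ^+ m)%:E <=
   (moment_cst H q * (n%:R `^ (- (4 * (H - alpha)))) ^+ q.+1)%:E)%E.
Proof.
move=> n0; have C0 : 0 <= moment_cst H q by exact: moment_cst_ge0.
have [pN|pN] := boolP (p + N.+1 <= n)%N; last first.
  rewrite /grid_error (negbTE pN).
  under eq_integral do rewrite expr0n muln_eq0/=.
  by rewrite integral0 lee_fin mulr_ge0// exprn_ge0// powR_ge0.
set V := gridR n N.+1 `^ (2 * alpha).
have V0 : 0 < V by rewrite powR_gt0// divr_gt0// ltr0n.
have E w : (grid_error n i j p N w ^+ m)%:E = (((V ^+ m)^-1)%:E *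
    ((\sum_(c < N.+1) cell_error X H A n i j (p + c) w) ^+ m)%:E)%E.
  by rewrite /grid_error pN -EFinM exprMn exprVn mulrC.
under eq_integral do rewrite E.
have i0 : (0 <= ((V ^+ m)^-1)%:E)%E by rewrite lee_fin invr_ge0.
rewrite ge0_integralZl//; last 2 first.
- apply/measurable_EFinP; apply: measurable_funX; apply: measurable_sum => c.
  apply: (cell_error_measurable hX hA).
  by rewrite (leq_trans _ pN)// ltn_add2l.
- by move=> w _; rewrite lee_fin.
have hm := cell_error_moment hH_gt hH_le hX X_indep hA n0 i j q pN.
apply: le_trans (lee_wpmul2l i0 hm) _; rewrite -EFinM lee_fin.
rewrite ler_pdivrMl ?exprn_gt0// [leRHS]mulrCA ler_wpM2l//.
rewrite exprM -exprMn [leRHS](_ : _ = (n%:R `^ (- (4 * (H - alpha))) * V ^+ 2) ^+ q.+1); last first.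
  by rewrite mulrC.
apply: lerXn2r; rewrite ?nnegrE//.
- by rewrite mulr_ge0// sqr_ge0.
- by rewrite mulr_ge0 ?powR_ge0// sqr_ge0.
- exact: cell_scaling.
Qed.

Definition grid_modulus_bound n : R :=
  (n%:R ^+ 2 * (d + d)%:R ^+ 2) * (moment_cst H q * (n%:R `^ (- (4 * (H - alpha)))) ^+ q.+1).

Lemma integral_grid_modulus n : (0 < n)%N ->
  (\int[P]_w (grid_modulus n w)%:E <= (grid_modulus_bound n)%:E)%E.
Proof.
move=> n0; set B := moment_cst H q * (n%:R `^ (- (4 * (H - alpha)))) ^+ q.+1.
have E w : (grid_modulus n w)%:E = (\sum_(p < n) \sum_(N < n) \sum_i \sum_j
    (grid_error n i j p N w ^+ m)%:E)%E.
  rewrite /grid_modulus -sumEFin; apply: eq_bigr => p _; rewrite -sumEFin.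
  apply: eq_bigr => N _; rewrite -sumEFin; apply: eq_bigr => i _; rewrite -sumEFin.
  by [].
under eq_integral do rewrite E.
have mt n' i j p N : n' = n -> measurable_fun [set: T] (fun w => (grid_error n' i j p N w ^+ m)%:E).
  by move=> ->; apply/measurable_EFinP; exact: mterm.
have t0 n' i j p N w : (0 <= (grid_error n' i j p N w ^+ m)%:E)%E by rewrite lee_fin.
rewrite ge0_integral_sum//; last 2 first.
- by move=> p; do 3 apply: emeasurable_sum => ?; exact: mt.
- by move=> p w _; do 3 apply: sume_ge0 => ? _; exact: t0.
apply: (@le_trans _ _ (\sum_(p < n) \sum_(N < n) \sum_(i < d + d) \sum_(j < d + d) B%:E)%E); last first.
  have sc (K : nat) (c : R) : (\sum_(i < K) c%:E)%E = (K%:R * c)%:E.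
    by rewrite sumEFin sumr_const card_ord mulr_natl.
  have -> : (\sum_(p < n) \sum_(N < n) \sum_(i < d + d) \sum_(j < d + d) B%:E)%E =
      (n%:R * (n%:R * ((d + d)%:R * ((d + d)%:R * B))))%:E.
    rewrite -sc; apply: eq_bigr => p _; rewrite -sc; apply: eq_bigr => N _.
    by rewrite -sc; apply: eq_bigr => i _; rewrite -sc.
  rewrite lee_fin le_eqVlt; apply/orP; left; apply/eqP.
  by rewrite /grid_modulus_bound -/B; ring.
apply: lee_sum => p _; rewrite ge0_integral_sum//; last 2 first.
- by move=> N; do 2 apply: emeasurable_sum => ?; exact: mt.
- by move=> N w _; do 2 apply: sume_ge0 => ? _; exact: t0.
apply: lee_sum => N _; rewrite ge0_integral_sum//; last 2 first.
- by move=> i; apply: emeasurable_sum => ?; exact: mt.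
- by move=> i w _; apply: sume_ge0 => ? _; exact: t0.
apply: lee_sum => i _; rewrite ge0_integral_sum//; last by move=> j; exact: mt.
apply: lee_sum => j _; exact: grid_error_moment.
Qed.

Definition grid_norm n w : R := grid_modulus n w `^ (m%:R^-1).

Lemma grid_norm_exp n w : grid_norm n w ^+ m = grid_modulus n w.
Proof. by rewrite powR_root// grid_modulus_ge0. Qed.

Lemma grid_error_le n i j p N w : (p < n)%N -> (N < n)%N ->
  `|grid_error n i j p N w| <= grid_norm n w.
Proof.
move=> pn Nn; rewrite -(@ler_pXn2r _ m) ?nnegrE ?powR_ge0// grid_norm_exp.
rewrite -normrX ger0_norm// /grid_modulus.
rewrite (bigD1 (Ordinal pn))//= (bigD1 (Ordinal Nn))//= (bigD1 i)//= (bigD1 j)//=.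
rewrite -!addrA lerDl !addr_ge0//; do ?apply: sumr_ge0 => ? _ //.
Qed.

Let C1 : R := chain_cst beta.
Let C2 : R := chain_cst (2 * beta).
Let C10 : 0 <= C1. Proof. exact: chain_cst_ge0. Qed.
Let C20 : 0 <= C2. Proof. by apply: chain_cst_ge0; rewrite mulr_gt0. Qed.

Definition path_cst : R := 6 * C1 + 18 * (C1 ^+ 2 + C2 * (1 + C1 ^+ 2) + 1).

Definition error_norm n w : R :=
  path_cst * (n%:R `^ (- (beta - alpha)) * path_norm X A beta q w) + grid_norm n w.

Section Pathwise.
Variable w : T.
Hypothesis w_fin : (path_modulus X A beta q w < +oo)%E.
Hypothesis w_chen : chen_area (A w) (vec_path X w).
Variable n : nat.
Hypothesis n_gt0 : (0 < n)%N.
Local Notation g := (path_norm X A beta q w).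
Local Notation x := (vec_path X w).
Local Notation v := (lead_lag_renorm P n (vec_path X)).

Let g1 : 1 <= g. Proof. exact: path_norm_ge1. Qed.
Let g0 : 0 <= g. Proof. exact: le_trans g1. Qed.
Let kappa := C1 * Num.sqrt g.
Let kappa2 := C2 * (g + kappa ^+ 2).
Let kappa0 : 0 <= kappa. Proof. by rewrite mulr_ge0 ?sqrtr_ge0. Qed.
Let kappa20 : 0 <= kappa2. Proof. by rewrite mulr_ge0// addr_ge0// sqr_ge0. Qed.
Let kappaE : kappa ^+ 2 = C1 ^+ 2 * g. Proof. by rewrite exprMn sqr_sqrtr. Qed.
Let W := n%:R `^ (- (beta - alpha)) : R.
Let W0 : 0 <= W. Proof. exact: powR_ge0. Qed.
Let Wg0 : 0 <= W * g. Proof. by rewrite mulr_ge0. Qed.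

Let x_holder k s t : 0 <= s -> s <= t -> t <= 1 ->
  `|x t 0 k - x s 0 k| <= kappa * (t - s) `^ beta.
Proof.
by move=> s0 st t1; rewrite !mxE; exact: (path_holder hX alpha_gt alpha_beta w_fin).
Qed.

Let beta_half : beta <= 2^-1. Proof. by move: beta_H hH_le; lra. Qed.

Lemma error_norm_ge0 : 0 <= error_norm n w.
Proof.
by rewrite addr_ge0 ?powR_ge0// mulr_ge0// addr_ge0 ?mulr_ge0// !addr_ge0 ?sqr_ge0// mulr_ge0// addr_ge0// sqr_ge0.
Qed.

Lemma increment_error i s t : 0 <= s -> s < t -> t <= 1 ->
  `|(lead_lag n x t 0 i - lead_lag n x s 0 i) - (x t 0 (component i) - x s 0 (component i))| <=
  error_norm n w * (t - s) `^ alpha.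
Proof.
move=> s0 st t1.
apply: le_trans (lead_lag_level1 n_gt0 kappa0 beta0 x_holder (ltW alpha0) alpha_beta beta_half i s0 st t1) _.
rewrite ler_wpM2r ?powR_ge0// -/W; apply: (@le_trans _ _ (6 * C1 * (W * g))).
  have sg : Num.sqrt g <= g.
    rewrite -[leRHS]sqr_sqrtr// expr2 -[leLHS]mulr1 ler_wpM2l ?sqrtr_ge0//.
    by rewrite -sqrtr1 ler_wsqrtr.
  rewrite /kappa -[leRHS]mulrA -!mulrA !ler_wpM2l// mulrC ler_wpM2l//.
apply: (@le_trans _ _ (path_cst * (W * g))); last by rewrite lerDl powR_ge0.
by rewrite ler_wpM2r// lerDl mulr_ge0// !addr_ge0 ?sqr_ge0// mulr_ge0// addr_ge0// sqr_ge0.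
Qed.

Lemma area_error_norm i j s t : 0 <= s -> s < t -> t <= 1 ->
  `|area_error n x (A w) v i j s t| <= error_norm n w * (t - s) `^ (2 * alpha).
Proof.
move=> s0 st t1.
have a_holder i' j' a b : 0 <= a -> a <= b -> b <= 1 ->
    `|A w a b i' j'| <= kappa2 * (b - a) `^ (2 * beta).
  by move=> *; exact: (area_holder hX hA alpha_gt alpha_beta w_fin w_chen).
have v_bound i' j' : `|v i' j'| <= n%:R `^ (1 - 2 * beta).
  by apply: (lead_lag_renorm_bound (H := H)) => //; exact: ltW.
have L0 : 0 <= grid_norm n w by exact: powR_ge0.
have grid_bound i' j' p e : (p < e)%N -> (e <= n)%N ->
    `|area_error n x (A w) v i' j' (gridR n p) (gridR n e)| <=
    grid_norm n w * (gridR n e - gridR n p) `^ (2 * alpha).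
  move=> pe en; have eE : e = (p + (e - p).-1.+1)%N by rewrite prednK ?subn_gt0// subnKC// ltnW.
  set N := (e - p).-1 in eE; rewrite eE in en *.
  rewrite (area_error_grid n_gt0 beta0 v a_holder w_chen i' j' en).
  have -> : gridR n (p + N.+1) - gridR n p = gridR n N.+1.
    by rewrite /grid -mulrBl natrD addrC addKr.
  have V0 : 0 < gridR n N.+1 `^ (2 * alpha) by rewrite powR_gt0// divr_gt0// ltr0n.
  rewrite -ler_pdivrMr// -[X in _ / X]gtr0_norm// -normf_div.
  have pn : (p < n)%N by rewrite (leq_trans _ en)// addnS ltnS leq_addr.
  have Nn : (N < n)%N by rewrite (leq_trans _ en)// addnS ltnS leq_addl.
  apply: le_trans (grid_error_le i' j' w pn Nn); rewrite /grid_error en.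
  rewrite le_eqVlt; apply/orP; left; apply/eqP; congr (`|_ / _|).
  apply: eq_bigr => c _; apply: (area_error_cell (H := H)) => //.
  by rewrite (leq_trans _ en)// ltn_add2l.
apply: le_trans (area_error_bound n_gt0 kappa0 beta0 x_holder (ltW alpha0) alpha_beta
  beta_half kappa20 L0 a_holder w_chen v_bound grid_bound i j s0 st t1) _.
rewrite ler_wpM2r ?powR_ge0// -/W lerD2r mulrAC.
apply: (@le_trans _ _ (18 * (C1 ^+ 2 + C2 * (1 + C1 ^+ 2) + 1) * (W * g))).
  have e : kappa ^+ 2 + kappa2 + 1 <= (C1 ^+ 2 + C2 * (1 + C1 ^+ 2) + 1) * g.
    by rewrite /kappa2 kappaE; have := g1; lra.
  have := ler_wpM2r W0 e; lra.
by rewrite ler_wpM2r// lerDr mulr_ge0.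
Qed.

End Pathwise.

Lemma error_norm_measurable n : (0 < n)%N -> measurable_fun [set: T] (error_norm n).
Proof.
move=> n0; apply: measurable_funD; last first.
  by apply: (@measurableT_comp _ _ _ _ _ _ (fun x => x `^ (m%:R^-1))); [exact: measurable_powR|exact: grid_modulus_measurable].
apply: measurable_funM => //; apply: measurable_funM => //.
apply: (@measurableT_comp _ _ _ _ _ _ (fun x => x `^ (m%:R^-1))); first exact: measurable_powR.
apply: measurableT_comp => //; exact: (measurable_path_modulus hX hA).
Qed.

Lemma ae_path_modulus_fin : {ae P, forall w, (path_modulus X A beta q w < +oo)%E}.
Proof.
have mG : measurable_fun [set: T] (path_modulus X A beta q).
  exact: (measurable_path_modulus hX hA).
have G0 w : (0 <= path_modulus X A beta q w)%E by rewrite (le_trans _ (path_modulus_ge1 _ _ _ _ _)).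
have iG : P.-integrable [set: T] (path_modulus X A beta q).
  apply/integrableP; split => //.
  under eq_integral do rewrite gee0_abs//.
  by apply: (integral_path_modulus (H := H)).
have := integrable_ae measurableT iG; apply: filterS => w /(_ I).
by rewrite ge0_fin_numE.
Qed.

Lemma error_norm_moment : exists2 K : R, 0 <= K & forall n, (0 < n)%N ->
  (\int[P]_w (error_norm n w ^+ m)%:E <=
   (K * ((n%:R `^ (- (beta - alpha))) ^+ m + n%:R ^+ 2 * (n%:R `^ (- (4 * (H - alpha)))) ^+ q.+1))%:E)%E.
Proof.
pose IG := fine (\int[P]_w path_modulus X A beta q w)%E.
have G1 w : (1 <= path_modulus X A beta q w)%E by exact: path_modulus_ge1.
have G0 w : (0 <= path_modulus X A beta q w)%E by rewrite (le_trans _ (G1 w)).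
have mG : measurable_fun [set: T] (path_modulus X A beta q).
  exact: (measurable_path_modulus hX hA).
have IGfin : (\int[P]_w path_modulus X A beta q w)%E \is a fin_num.
  rewrite ge0_fin_numE; last exact: integral_ge0.
  by apply: (integral_path_modulus (H := H)).
have IG0 : 0 <= IG by apply: fine_ge0; exact: integral_ge0.
have int_g : (\int[P]_w (path_norm X A beta q w ^+ m)%:E <= IG%:E)%E.
  rewrite /IG fineK//; apply: ge0_le_integral => //.
  - by move=> w _; rewrite lee_fin.
  - apply/measurable_EFinP; apply: (eq_measurable_fun (fun w => fine (path_modulus X A beta q w))).
      by move=> w _; rewrite path_norm_exp.
    exact: measurableT_comp.
  - move=> w _; rewrite path_norm_exp; have := G0 w.
    by case: (path_modulus X A beta q w) => //= *; rewrite ?leey.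
have c0 : 0 <= path_cst by rewrite addr_ge0 ?mulr_ge0// !addr_ge0 ?sqr_ge0// mulr_ge0// addr_ge0// sqr_ge0.
pose K1 := 2 ^+ m * path_cst ^+ m * IG.
pose K2 := 2 ^+ m * ((d + d)%:R ^+ 2 * moment_cst H q).
have C0 : 0 <= moment_cst H q by exact: moment_cst_ge0.
have K10 : 0 <= K1 by rewrite mulr_ge0// mulr_ge0 ?exprn_ge0.
have K20 : 0 <= K2 by rewrite mulr_ge0 ?exprn_ge0// mulr_ge0 ?exprn_ge0.
exists (K1 + K2) => [|n n0]; first exact: addr_ge0.
set W := (n%:R `^ (- (beta - alpha))); have W0 : 0 <= W ^+ m by rewrite exprn_ge0// powR_ge0.
have mg : measurable_fun [set: T] (fun w => (path_norm X A beta q w ^+ m)%:E).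
  apply/measurable_EFinP; apply: (eq_measurable_fun (fun w => fine (path_modulus X A beta q w))).
    by move=> w _; rewrite path_norm_exp.
  exact: measurableT_comp.
have mL : measurable_fun [set: T] (fun w => (grid_modulus n w)%:E).
  by apply/measurable_EFinP; exact: grid_modulus_measurable.
pose a := 2 ^+ m * path_cst ^+ m * W ^+ m; have a0 : 0 <= a by rewrite mulr_ge0// mulr_ge0 ?exprn_ge0.
apply: (@le_trans _ _ (\int[P]_w (a%:E * (path_norm X A beta q w ^+ m)%:E +
    (2 ^+ m)%:E * (grid_modulus n w)%:E))%E).
  apply: ge0_le_integral => //.
  - by move=> w _; rewrite lee_fin.
  - by apply/measurable_EFinP; apply: measurable_funX; exact: error_norm_measurable.
  - by apply: emeasurable_funD; apply: emeasurable_funM.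
  - move=> w _; rewrite -!EFinM -EFinD lee_fin /error_norm -/W -grid_norm_exp.
    set u := path_cst * _; set z := grid_norm n w.
    have uE : u ^+ m = path_cst ^+ m * W ^+ m * path_norm X A beta q w ^+ m.
      by rewrite /u !exprMn mulrA.
    have ev (x : R) : `|x| ^+ m = x ^+ m by rewrite -normrX ger0_norm.
    rewrite -ev; apply: le_trans (normrXD_le _ _ _) _; rewrite !ev mulrDr uE /a.
    by rewrite !mulrA.
rewrite ge0_integralD//; last 4 first.
- by move=> w _; rewrite -EFinM lee_fin mulr_ge0.
- exact: emeasurable_funM.
- by move=> w _; rewrite -EFinM lee_fin mulr_ge0 ?exprn_ge0 ?grid_modulus_ge0.
- exact: emeasurable_funM.
rewrite ge0_integralZl//; last by move=> w _; rewrite lee_fin.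
rewrite ge0_integralZl//; last by move=> w _; rewrite lee_fin grid_modulus_ge0.
have a0' : (0 <= a%:E)%E by rewrite lee_fin.
have b0' : (0 <= ((2 : R) ^+ m)%:E)%E by rewrite lee_fin exprn_ge0.
apply: le_trans (leeD (lee_wpmul2l a0' int_g) (lee_wpmul2l b0' (integral_grid_modulus n0))) _.
rewrite -!EFinM -EFinD lee_fin /grid_modulus_bound /a.
set V := _ ^+ q.+1; have V0 : 0 <= n%:R ^+ 2 * V by rewrite mulr_ge0 ?exprn_ge0 ?powR_ge0.
have e1 : 2 ^+ m * path_cst ^+ m * W ^+ m * IG = K1 * W ^+ m by rewrite /K1; ring.
have e2 : 2 ^+ m * (n%:R ^+ 2 * (d + d)%:R ^+ 2 * (moment_cst H q * V)) = K2 * (n%:R ^+ 2 * V).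
  by rewrite /K2; ring.
rewrite e1 e2 mulrDl !mulrDr; have h1 := mulr_ge0 K10 V0; have h2 := mulr_ge0 K20 W0.
by move: h1 h2; lra.
Qed.

End AreaErrorModulus.

Section CountableSupremum.
Context {R : realType} {disp : measure_display} {T : measurableType disp}.

Lemma measurable_countable_sup (I : countType) (f : I -> T -> \bar R) :
  (forall i, measurable_fun [set: T] (f i)) ->
  measurable_fun [set: T] (fun w => ereal_sup [set e | exists i, e = f i w]).
Proof.
move=> mf; pose F n w := if unpickle n is Some i then f i w else -oo%E.
have mF n : measurable_fun [set: T] (F n).
  by rewrite /F; case: (unpickle n) => [i|]; [exact: mf|exact: measurable_cst].
apply: (eq_measurable_fun (fun w => esups (F^~ w) 0%N)); last exact: measurable_fun_esups.
move=> w _; rewrite /esups /sdrop /=; apply/eqP; rewrite eq_le; apply/andP; split.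
  apply: ge_ereal_sup => _ [n _ <-]; rewrite /F; case: (unpickle n) => [i|]; last exact: leNye.
  by apply: ereal_sup_ubound; exists i.
apply: ge_ereal_sup => _ [i ->]; apply: ereal_sup_ubound; exists (pickle i) => //.
by rewrite /F pickleK.
Qed.

End CountableSupremum.

Section MatrixNorms.
Context {R : realType} (p r : nat).
Variable N : 'M[R]_(p, r) -> R.
Hypothesis hN : is_norm N.

Let NZ a x : N (a *: x) = `|a| * N x. Proof. by case: hN. Qed.
Let ND x y : N (x + y) <= N x + N y. Proof. by case: hN. Qed.

Lemma is_norm0 : N 0 = 0.
Proof. by rewrite -(scale0r 0) NZ normr0 mul0r. Qed.

Lemma is_normN x : N (- x) = N x.
Proof. by rewrite -scaleN1r NZ normrN normr1 mul1r. Qed.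

Lemma is_norm_ge0 x : 0 <= N x.
Proof. by have := ND x (- x); rewrite subrr is_norm0 is_normN; lra. Qed.

Definition norm_cst : R := \sum_i \sum_j N (delta_mx i j).

Lemma norm_cst_ge0 : 0 <= norm_cst.
Proof. by do 2 apply: sumr_ge0 => ? _; exact: is_norm_ge0. Qed.

Lemma norm_le_entries (x : 'M[R]_(p, r)) (e : R) : (forall i j, `|x i j| <= e) -> N x <= norm_cst * e.
Proof.
move=> xe; have Nsum (I : finType) (F : I -> 'M[R]_(p, r)) : N (\sum_i F i) <= \sum_i N (F i).
  elim/big_rec2: _ => [|i u v _ uv]; first by rewrite is_norm0.
  by apply: le_trans (ND _ _) _; rewrite lerD2l.
rewrite {1}(matrix_sum_delta x) /norm_cst mulr_suml; apply: le_trans (Nsum _ _) _.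
apply: ler_sum => i _; rewrite mulr_suml; apply: le_trans (Nsum _ _) _.
by apply: ler_sum => j _; rewrite NZ mulrC ler_wpM2l// is_norm_ge0.
Qed.

Lemma norm_lipschitz (x y : 'M[R]_(p, r)) (e : R) : (forall i j, `|x i j - y i j| <= e) -> N x <= N y + norm_cst * e.
Proof.
move=> xy; rewrite -[in leLHS](subrK y x) addrC; apply: le_trans (ND _ _) _.
by rewrite lerD2l; apply: norm_le_entries => i j; rewrite !mxE.
Qed.

Lemma norm_cvg (M : nat -> 'M[R]_(p, r)) (x : 'M[R]_(p, r)) :
  (forall i j, M n i j @[n --> \oo] --> x i j) -> N (M n) @[n --> \oo] --> N x.
Proof.
move=> Mx; apply/cvgrPdist_le => e e0.
have C1 : 0 < norm_cst + 1 by rewrite ltr_wpDl ?norm_cst_ge0.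
have d0 : 0 < e / (norm_cst + 1) by rewrite divr_gt0.
have Ce : norm_cst * (e / (norm_cst + 1)) <= e.
  by rewrite mulrA ler_pdivrMr// mulrC ler_wpM2l ?(ltW e0)// lerDl.
have : \forall n \near \oo, forall i j, `|x i j - M n i j| <= e / (norm_cst + 1).
  apply: filter_forall => i; apply: filter_forall => j.
  by move/cvgrPdist_le : (Mx i j); exact.
apply: filterS => n xM; rewrite ler_norml.
have h1 := norm_lipschitz xM.
have h2 : N (M n) <= N x + norm_cst * (e / (norm_cst + 1)).
  by apply: norm_lipschitz => i j; rewrite distrC.
by apply/andP; split; move: h1 h2 Ce; lra.
Qed.

Lemma norm_sup (x : 'M[R]_(p, r)) : ereal_sup [set e | exists Q : 'M[rat]_(p, r),
    e = (N (map_mx ratr Q) - norm_cst * \sum_i \sum_j `|x i j - ratr (Q i j)|)%:E] = (N x)%:E.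
Proof.
apply/eqP; rewrite eq_le; apply/andP; split.
  apply: ge_ereal_sup => _ [Q ->]; rewrite lee_fin lerBlDr; apply: norm_lipschitz => i j.
  rewrite mxE distrC (bigD1 i)//= (bigD1 j)//= -addrA lerDl addr_ge0//; apply: sumr_ge0 => // k _.
  exact: sumr_ge0.
apply/lee_addgt0Pr => e e0.
pose K := norm_cst * (1 + (p * r)%:R) + 1.
have K0 : 0 < K by rewrite ltr_wpDl// mulr_ge0 ?norm_cst_ge0.
have eK : 0 < e / K by rewrite divr_gt0.
have /choice[f fP] (ij : 'I_p * 'I_r) : exists y : rat, `|x ij.1 ij.2 - ratr y| <= e / K.
  have /rat_in_itvoo[y] : x ij.1 ij.2 - e / K < x ij.1 ij.2 + e / K.
    by rewrite ltrD2l gtrN.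
  rewrite in_itv/= => /andP[y1 y2]; exists y; rewrite ler_norml.
  by apply/andP; split; move: y1 y2; lra.
pose Q : 'M[rat]_(p, r) := \matrix_(i, j) f (i, j).
apply: (@le_trans _ _ ((N (map_mx ratr Q) -
    norm_cst * \sum_i \sum_j `|x i j - ratr (Q i j)|)%:E + e%:E)%E); last first.
  by rewrite leeD2r//; apply: ereal_sup_ubound; exists Q.
rewrite -EFinD lee_fin.
have h1 : N x <= N (map_mx ratr Q) + norm_cst * (e / K).
  by apply: norm_lipschitz => i j; rewrite !mxE; exact: (fP (i, j)).
have h2 : \sum_i \sum_j `|x i j - ratr (Q i j)| <= (p * r)%:R * (e / K).
  apply: (@le_trans _ _ (\sum_(i < p) \sum_(j < r) e / K)).
    by do 2 apply: ler_sum => ? _; rewrite mxE; exact: (fP (_, _)).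
  by rewrite !sumr_const !card_ord -mulrnA mulnC mulr_natl.
have h3 : norm_cst * \sum_i \sum_j `|x i j - ratr (Q i j)| <= norm_cst * ((p * r)%:R * (e / K)).
  by rewrite ler_wpM2l ?norm_cst_ge0.
have h4 : norm_cst * (1 + (p * r)%:R) * (e / K) <= e.
  by rewrite mulrA ler_pdivrMr// mulrC ler_wpM2l ?(ltW e0)// /K lerDl.
by move: h1 h3 h4; lra.
Qed.

Lemma measurable_norm {disp} {T : measurableType disp} (M : T -> 'M[R]_(p, r)) :
  (forall i j, measurable_fun [set: T] (fun w => M w i j)) ->
  measurable_fun [set: T] (fun w => N (M w)).
Proof.
move=> mM; apply/measurable_EFinP.
apply: (eq_measurable_fun (fun w => ereal_sup [set e | exists Q : 'M[rat]_(p, r),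
    e = (N (map_mx ratr Q) - norm_cst * \sum_i \sum_j `|M w i j - ratr (Q i j)|)%:E])).
  by move=> w _; rewrite norm_sup.
apply: measurable_countable_sup => Q; apply/measurable_EFinP.
apply: measurable_funB => //; apply: measurable_funM => //.
do 2 apply: measurable_sum => ?.
by apply: measurableT_comp => //; exact: measurable_funB.
Qed.

End MatrixNorms.

Section HolderSup.
Context {R : realType} (p r : nat).
Variable N : 'M[R]_(p, r) -> R.
Hypothesis hN : is_norm N.
Local Notation gridR := (@grid R).
Local Notation D J t := (gridR (2 ^ J) (dyadic_floor t J)).

Lemma holder_sup_ge0 b f : (0 <= holder_sup N b f)%E.
Proof.
apply: le_trans (_ : (0 <= (N (f 0 1) / (1 - 0) `^ b)%:E)%E) _.
  by rewrite lee_fin divr_ge0 ?powR_ge0// is_norm_ge0.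
by apply: ereal_sup_ubound; exists 0, 1; split.
Qed.

Lemma holder_sup_le (b b' K : R) (f : R -> R -> 'M[R]_(p, r)) : b <= b' -> 0 <= K ->
  (forall s t i j, 0 <= s -> s < t -> t <= 1 -> `|f s t i j| <= K * (t - s) `^ b') ->
  (holder_sup N b f <= (norm_cst N * K)%:E)%E.
Proof.
move=> bb K0 fK; apply: ge_ereal_sup => _ [s [t [s0 st t1 ->]]]; rewrite lee_fin.
have ts0 : 0 < t - s by rewrite subr_gt0.
have V0 : 0 < (t - s) `^ b by exact: powR_gt0.
rewrite ler_pdivrMr// -mulrA; apply: (norm_le_entries hN) => i j.
apply: le_trans (fK _ _ _ _ s0 st t1) _; rewrite ler_wpM2l//.
by apply: ger_powR => //; rewrite ts0/=; lra.
Qed.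

Lemma measurable_holder_sup {disp} {T : measurableType disp} b (f : T -> R -> R -> 'M[R]_(p, r)) :
  (forall s t i j, 0 <= s -> s <= t -> t <= 1 -> measurable_fun [set: T] (fun w => f w s t i j)) ->
  (forall w s t i j, 0 <= s -> s < t -> t <= 1 ->
    f w (D J s) (D J t) i j @[J --> \oo] --> f w s t i j) ->
  measurable_fun [set: T] (fun w => holder_sup N b (f w)).
Proof.
move=> mf cf.
pose F (x : nat * nat * nat) w := let: (J, a, c) := x in
  if (a < c <= 2 ^ J)%N then (N (f w (gridR (2 ^ J) a) (gridR (2 ^ J) c)) /
    (gridR (2 ^ J) c - gridR (2 ^ J) a) `^ b)%:E else -oo%E.
have grid_lt J a c : (a < c)%N -> gridR (2 ^ J) a < gridR (2 ^ J) c.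
  by move=> ac; rewrite /grid ltr_pM2r ?invr_gt0 ?ltr0n ?expn_gt0// ltr_nat.
apply: (eq_measurable_fun (fun w => ereal_sup [set e | exists x, e = F x w])); last first.
  apply: (measurable_countable_sup (f := F)) => -[[J a] c]; rewrite /F.
  case: (boolP (a < c <= 2 ^ J)%N) => [/andP[ac cJ]|_]; last exact: measurable_cst.
  apply/measurable_EFinP; apply: measurable_funM => //; apply: measurable_norm => // i j.
  apply: mf; last by have /andP[] := @grid01 R _ _ cJ.
    by have /andP[] := @grid01 R _ _ (leq_trans (ltnW ac) cJ).
  exact/grid_mono/ltnW.
move=> w _; apply/eqP; rewrite eq_le; apply/andP; split.
  apply: ge_ereal_sup => _ [[[J a] c] ->] /=.
  case: ifPn => [/andP[ac cJ]|_]; last exact: leNye.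
  apply: ereal_sup_ubound; exists (gridR (2 ^ J) a), (gridR (2 ^ J) c).
  have /andP[_ c1] := @grid01 R _ _ cJ.
  have /andP[a0 _] := @grid01 R _ _ (leq_trans (ltnW ac) cJ).
  by split => //; exact: grid_lt.
apply: ge_ereal_sup => _ [s [t [s0 st t1 ->]]].
have t0 : 0 <= t by rewrite (le_trans s0)// ltW.
have ts0 : 0 < t - s by rewrite subr_gt0.
have cD : D J t - D J s @[J --> \oo] --> t - s.
  by apply: cvgB; exact: cvg_dyadic_floor.
have cV : (N (f w (D J s) (D J t)) / (D J t - D J s) `^ b)%:E @[J --> \oo] -->
    (N (f w s t) / (t - s) `^ b)%:E.
  apply: cvg_EFin; first exact: nearW.
  apply: cvgM.
    by apply: (norm_cvg hN) => i j; exact: cf.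
  apply: cvgV; first by rewrite gt_eqF// powR_gt0.
  have c : {for (t - s), continuous (fun x : R => x `^ b)}.
    apply: differentiable_continuous; apply/derivable1_diffP; apply: derivable_powR.
    by rewrite in_itv/= ts0.
  exact: (cvg_comp _ _ cD c).
rewrite -(cvg_lim _ cV)//; apply: lime_le; first by apply/cvg_ex; eexists; exact: cV.
have : \forall J \near \oo, 0 < D J t - D J s by apply: (cvgr_gt _ cD).
apply: filterS => J; rewrite subr_gt0 => lt.
apply: ereal_sup_ubound; exists (J, dyadic_floor s J, dyadic_floor t J); rewrite /F.
rewrite dyadic_floor_le1// andbT ifT// ltnNge; apply/negP => le.
by move: lt; rewrite ltNge grid_mono.
Qed.

End HolderSup.

Section PiecewiseAffineRegularity.
Context {R : realType} (m : nat).
Implicit Types (x : R -> 'rV[R]_m).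
Local Notation gridR := (@grid R).
Local Notation D J t := (gridR (2 ^ J) (dyadic_floor t J)).

Lemma pwaffine_lipschitz x a b : pwaffine x a b -> exists2 L, 0 <= L &
  forall k s t, a <= s -> s <= t -> t <= b -> `|x t 0 k - x s 0 k| <= L * (t - s).
Proof.
elim=> {a b} [a b v ab xE|a b c _ [L1 L10 h1] _ [L2 L20 h2]].
  exists (\sum_k `|v 0 k|) => [|k s t as_ st tb]; first exact: sumr_ge0.
  rewrite (xE t) ?(xE s) ?as_ ?(le_trans as_)//= ?(le_trans st)// !mxE.
  rewrite (_ : _ - _ = (t - s) * v 0 k); last by ring.
  rewrite normrM mulrC (ger0_norm (_ : 0 <= t - s)) ?subr_ge0// ler_wpM2r ?subr_ge0//.
  by rewrite (bigD1 k)//= lerDl sumr_ge0.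
exists (L1 + L2) => [|k s t as_ st tc]; first exact: addr_ge0.
have ts0 : 0 <= t - s by rewrite subr_ge0.
have l1 : L1 * (t - s) <= (L1 + L2) * (t - s) by rewrite ler_wpM2r// lerDl.
have l2 : L2 * (t - s) <= (L1 + L2) * (t - s) by rewrite ler_wpM2r// lerDr.
have [tb|bt] := leP t b; first exact: le_trans (h1 k s t as_ st tb) l1.
have [bs|sb] := leP b s; first exact: le_trans (h2 k s t bs st tc) l2.
have e1 := h1 k s b as_ (ltW sb) (lexx b); have e2 := h2 k b t (lexx b) (ltW bt) tc.
have := ler_normD (x t 0 k - x b 0 k) (x b 0 k - x s 0 k); rewrite addrA subrK.
have e3 : L1 * (b - s) <= L1 * (t - s) by rewrite ler_wpM2l// lerD2r ltW.
have e4 : L2 * (t - b) <= L2 * (t - s) by rewrite ler_wpM2l// lerD2l lerN2 ltW.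
by move: e1 e2 e3 e4; rewrite mulrDl; lra.
Qed.

Lemma lipschitz_dyadic_cvg (F : R -> R) C t : 0 <= t -> t <= 1 ->
  (forall s t, 0 <= s -> s <= t -> t <= 1 -> `|F t - F s| <= C * (t - s)) ->
  F (D J t) @[J --> \oo] --> F t.
Proof.
move=> t0 t1 FL; apply/cvgrPdist_le => e e0.
have : C * (t - D J t) @[J --> \oo] --> C * (t - t).
  by apply: cvgM; [exact: cvg_cst|apply: cvgB; [exact: cvg_cst|exact: cvg_dyadic_floor]].
rewrite subrr mulr0 => /cvgrPdist_le /(_ e e0); apply: filterS => J.
rewrite sub0r normrN => CJ; apply: le_trans (le_trans (ler_norm _) CJ).
by apply: FL => //; [have /andP[] := @grid01 R _ _ (dyadic_floor_le1 J t0 t1)|exact: dyadic_floor_le].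
Qed.

Variable y : R -> 'rV[R]_m.
Hypothesis y_aff : pwaffine y 0 1.

Let aff s t : 0 <= s -> s <= t -> t <= 1 -> pwaffine y s t.
Proof. exact: pwaffine_sub. Qed.

Lemma pwaffine_dyadic_cvg t k : 0 <= t -> t <= 1 ->
  y (D J t) 0 k @[J --> \oo] --> y t 0 k.
Proof.
move=> t0 t1; have [L L0 yL] := pwaffine_lipschitz y_aff.
exact: (@lipschitz_dyadic_cvg (fun t => y t 0 k) L t t0 t1 (yL k)).
Qed.

Lemma levy_area_from0 s t i j : 0 <= s -> s <= t -> t <= 1 ->
  levy_area y s t i j = levy_area y 0 t i j - levy_area y 0 s i j -
   2^-1 * ((y s 0 i - y 0 0 i) * (y t 0 j - y s 0 j) -
           (y s 0 j - y 0 0 j) * (y t 0 i - y s 0 i)).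
Proof.
move=> s0 st t1; rewrite (levy_area_chen i j (aff (lexx 0) s0 (le_trans st t1)) (aff s0 st t1)).
by ring.
Qed.

Lemma levy_area_dyadic_cvg s t i j : 0 <= s -> s <= t -> t <= 1 ->
  levy_area y (D J s) (D J t) i j @[J --> \oo] --> levy_area y s t i j.
Proof.
move=> s0 st t1; have t0 : 0 <= t by exact: le_trans st.
have s1 : s <= 1 by exact: le_trans t1.
have [L L0 yL] := pwaffine_lipschitz y_aff.
have F_lip a b : 0 <= a -> a <= b -> b <= 1 ->
    `|levy_area y 0 b i j - levy_area y 0 a i j| <= (2 * L ^+ 2) * (b - a).
  move=> a0 ab b1; have a1 : a <= 1 by exact: le_trans b1.
  have ba0 : 0 <= b - a by rewrite subr_ge0.
  have h1 : `|levy_area y a b i j| <= L ^+ 2 * (b - a) ^+ 2.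
    apply: levy_area_lipschitz => //; first exact: aff.
    by move=> k u v au uv vb; apply: yL => //; [exact: le_trans au|exact: le_trans b1].
  have h2 u v : `|(y a 0 u - y 0 0 u) * (y b 0 v - y a 0 v)| <= L ^+ 2 * (b - a).
    rewrite normrM expr2 -mulrA mulrCA; apply: ler_pM => //; last exact: yL.
    rewrite -[leRHS]mulr1; apply: le_trans (yL u 0 a (lexx 0) a0 a1) _.
    by rewrite subr0 ler_wpM2l.
  have h3 : (b - a) ^+ 2 <= b - a by rewrite expr2 ler_piMl//; lra.
  have h4 : L ^+ 2 * (b - a) ^+ 2 <= L ^+ 2 * (b - a) by rewrite ler_wpM2l ?sqr_ge0.
  move: h1; rewrite levy_area_from0//; set c := 2^-1 * _ => h1.
  have hc : `|c| <= L ^+ 2 * (b - a).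
    rewrite /c normrM (ger0_norm (_ : 0 <= 2^-1))// ler_pdivrMl//.
    by apply: le_trans (ler_normB _ _) _; rewrite mulr_natl mulr2n lerD.
  have := ler_normD (levy_area y 0 b i j - levy_area y 0 a i j - c) c.
  by rewrite subrK; move: h1 hc h4; lra.
have cF u : 0 <= u -> u <= 1 -> levy_area y 0 (D J u) i j @[J --> \oo] --> levy_area y 0 u i j.
  move=> u0 u1; exact: (@lipschitz_dyadic_cvg (fun u => levy_area y 0 u i j) _ u u0 u1 F_lip).
rewrite levy_area_from0//.
rewrite (_ : (fun J => levy_area y (D J s) (D J t) i j) = (fun J =>
  levy_area y 0 (D J t) i j - levy_area y 0 (D J s) i j -
   2^-1 * ((y (D J s) 0 i - y 0 0 i) * (y (D J t) 0 j - y (D J s) 0 j) -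
           (y (D J s) 0 j - y 0 0 j) * (y (D J t) 0 i - y (D J s) 0 i)))); last first.
  apply/funext => J; apply: levy_area_from0; last by have /andP[] := @grid01 R _ _ (dyadic_floor_le1 J t0 t1).
    by have /andP[] := @grid01 R _ _ (dyadic_floor_le1 J s0 s1).
  by apply: grid_mono; exact: dyadic_floor_mono.
have cy u k : 0 <= u -> u <= 1 -> y (D J u) 0 k @[J --> \oo] --> y u 0 k by exact: pwaffine_dyadic_cvg.
apply: cvgB; first by apply: cvgB; exact: cF.
apply: cvgM; first exact: cvg_cst.
by apply: cvgB; apply: cvgM; apply: cvgB; (exact: cy || exact: cvg_cst).
Qed.

Lemma grid_cell M (t : R) : (0 < M)%N -> 0 <= t -> t <= 1 ->
  exists2 k, (k < M)%N & gridR M k <= t <= gridR M k.+1.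
Proof.
move=> M0 t0; have M0' : 0 < M%:R :> R by rewrite ltr0n.
rewrite le_eqVlt => /predU1P[->|t1].
  exists M.-1; first by rewrite prednK.
  rewrite prednK// /grid divff ?gt_eqF// lexx andbT ler_pdivrMr// mul1r ler_nat.
  exact: leq_pred.
have tM0 : 0 <= t * M%:R by rewrite mulr_ge0.
have h1 : (Num.truncn (t * M%:R))%:R <= t * M%:R by rewrite truncn_le.
exists (Num.truncn (t * M%:R)).
  by rewrite -(ltr_nat R) (le_lt_trans h1)// gtr_pMl.
by rewrite /grid ler_pdivrMr// h1/= ler_pdivlMr// ltW// truncnS_gt.
Qed.

End PiecewiseAffineRegularity.

Section LeadLagMeasurability.
Context {R : realType} {disp : measure_display} {T : measurableType disp}.
Variables (P : probability T R) (d : nat) (X : 'I_d -> R -> {RV P >-> R}) (n : nat).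
Hypothesis n_gt0 : (0 < n)%N.
Local Notation gridR := (@grid R).
Let y w := lead_lag n (vec_path X w).
Let n2 : (0 < n.*2)%N. Proof. by rewrite double_gt0. Qed.

Let node_measurable k i :
  measurable_fun [set: T] (fun w => (lead_lag_node n (vec_path X w) k).2 0 i).
Proof.
rewrite (_ : (fun w => _) = X (component i)
    (gridR n (if is_lead i then uphalf k else k./2))) //.
by apply/funext => w; rewrite node_coord mxE.
Qed.

Lemma lead_lag_measurable t i : 0 <= t -> t <= 1 ->
  measurable_fun [set: T] (fun w => y w t 0 i).
Proof.
move=> t0 t1; have [k kn kt] := grid_cell n2 t0 t1.
rewrite (_ : (fun w => _) = (fun w => (lead_lag_node n (vec_path X w) k).2 0 i +
  (t - gridR n.*2 k) * (n.*2%:R * ((lead_lag_node n (vec_path X w) k.+1).2 0 i -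
    (lead_lag_node n (vec_path X w) k).2 0 i)))); last first.
  apply/funext => w; rewrite /y (lead_lagE _ n_gt0 kn kt).
  have lin (e f g : 'rV[R]_(d + d)) (b c : R) : (e + b *: (c *: (f - g))) 0 i =
      e 0 i + b * (c * (f 0 i - g 0 i)) by rewrite !mxE.
  exact: lin.
apply: measurable_funD; first exact: node_measurable.
apply: measurable_funM => //; apply: measurable_funM => //.
by apply: measurable_funB; exact: node_measurable.
Qed.

Lemma lead_lag_area_measurable s t i j : 0 <= s -> s <= t -> t <= 1 ->
  measurable_fun [set: T] (fun w => levy_area (y w) s t i j).
Proof.
have aff w a b : 0 <= a -> a <= b -> b <= 1 -> pwaffine (y w) a b.
  by move=> a0 ab b1; exact: lead_lag_pwaffine.
have from0 u : 0 <= u -> u <= 1 -> measurable_fun [set: T] (fun w => levy_area (y w) 0 u i j).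
  move=> u0 u1; have [k kn /andP[ku uk]] := grid_cell n2 u0 u1.
  have g0 : gridR n.*2 0 = 0 by rewrite /grid mul0r.
  have k0 : 0 <= gridR n.*2 k by rewrite -g0 grid_mono.
  rewrite (_ : (fun w => _) = (fun w => levy_area (y w) (gridR n.*2 0) (gridR n.*2 (0 + k)) i j +
    2^-1 * ((y w (gridR n.*2 k) 0 i - y w 0 0 i) * (y w u 0 j - y w (gridR n.*2 k) 0 j) -
            (y w (gridR n.*2 k) 0 j - y w 0 0 j) * (y w u 0 i - y w (gridR n.*2 k) 0 i)))); last first.
    apply/funext => w; rewrite add0n g0.
    rewrite (levy_area_chen i j (aff w _ _ (lexx 0) k0 (le_trans ku u1)) (aff w _ _ k0 ku u1)).
    have yE := @grid_affine _ _ _ _ _ n2 (fun k u => @lead_lagE _ _ _ (vec_path X w) n_gt0 k u) k kn.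
    have -> : levy_area (y w) (gridR n.*2 k) u i j = 0; last by rewrite addr0.
    apply: levy_area_affine => // v /andP[kv vu]; apply: yE.
    by rewrite kv (le_trans vu).
  apply: measurable_funD.
    rewrite (_ : (fun w => _) = (fun w => 2^-1 * \sum_(u < k)
      (((lead_lag_node n (vec_path X w) u).2 0 i - (lead_lag_node n (vec_path X w) 0).2 0 i) *
       ((lead_lag_node n (vec_path X w) u.+1).2 0 j - (lead_lag_node n (vec_path X w) u).2 0 j) -
       ((lead_lag_node n (vec_path X w) u).2 0 j - (lead_lag_node n (vec_path X w) 0).2 0 j) *
       ((lead_lag_node n (vec_path X w) u.+1).2 0 i - (lead_lag_node n (vec_path X w) u).2 0 i)))); last first.
      apply/funext => w; rewrite (grid_levy_area n2 (fun k u => @lead_lagE _ _ _ (vec_path X w) n_gt0 k u))//.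
      by rewrite ltnW.
    apply: measurable_funM => //; apply: measurable_sum => v.
    by apply: measurable_funB; apply: measurable_funM; apply: measurable_funB;
      exact: node_measurable.
  have k1 : gridR n.*2 k <= 1 by exact: le_trans u1.
  apply: measurable_funM => //.
  by apply: measurable_funB; apply: measurable_funM; apply: measurable_funB;
    exact: lead_lag_measurable.
move=> s0 st t1; have t0 : 0 <= t by exact: le_trans st.
have s1 : s <= 1 by exact: le_trans t1.
rewrite (_ : (fun w => _) = (fun w => levy_area (y w) 0 t i j - levy_area (y w) 0 s i j -
   2^-1 * ((y w s 0 i - y w 0 0 i) * (y w t 0 j - y w s 0 j) -
           (y w s 0 j - y w 0 0 j) * (y w t 0 i - y w s 0 i)))); last first.
  by apply/funext => w; apply: levy_area_from0 => //; exact: aff.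
apply: measurable_funB; first by apply: measurable_funB; exact: from0.
apply: measurable_funM => //.
by apply: measurable_funB; apply: measurable_funM; apply: measurable_funB;
  exact: lead_lag_measurable.
Qed.

End LeadLagMeasurability.

Section LqConvergence.
Context {R : realType} {disp : measure_display} {T : measurableType disp}.
Variable P : probability T R.

Lemma cvge0P (u : nat -> \bar R) : (forall n, 0 <= u n)%E ->
  (forall e : R, 0 < e -> \forall n \near \oo, (u n <= e%:E)%E) -> u @ \oo --> 0%E.
Proof.
move=> u0 ue; apply/fine_cvgP; split.
  apply: filterS (ue 1 ltr01) => n un; rewrite ge0_fin_numE//.
  by apply: le_lt_trans un _; rewrite ltry.
apply/cvgrPdist_le => e e0; apply: filterS (ue e e0) => n un.
rewrite sub0r normrN ger0_norm ?fine_ge0//=; move: un (u0 n).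
by case: (u n) => [z| |] //=; rewrite ?lee_fin ?leye_eq.
Qed.

Lemma cvg_Lnorm_dominated (Z : nat -> T -> \bar R) (S : nat -> T -> R) (e : nat -> R)
    (q : R) (k : nat) : 1 <= q -> q <= k%:R -> ~~ odd k ->
  (forall n, measurable_fun [set: T] (Z n)) -> (forall n, measurable_fun [set: T] (S n)) ->
  (forall n w, 0 <= Z n w)%E ->
  (forall n, {ae P, forall w, (Z n w <= (S n w)%:E)%E}) ->
  (forall n, (\int[P]_w (S n w ^+ k)%:E <= (e n)%:E)%E) ->
  e n @[n --> \oo] --> 0 ->
  ('N[P]_(q%:E) [Z n])%E @[n --> \oo] --> 0%E.
Proof.
move=> q1 qk ek mZ mS Z0 ZS Se e0; have q0 : 0 < q by exact: lt_le_trans q1.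
apply: cvge0P => [n|dl dl0]; first exact: Lnorm_ge0.
pose eta := dl / 2; have eta0 : 0 < eta by rewrite divr_gt0.
have Sk0 n w : 0 <= S n w ^+ k by rewrite -(odd_double_half k) (negbTE ek) add0n -mul2n exprM exprn_ge0// sqr_ge0.
have ek0 : 0 < eta ^+ k by rewrite exprn_gt0.
move/cvgrPdist_le : e0 => /(_ _ ek0); apply: filterS => n; rewrite sub0r normrN => en.
have en' : e n <= eta ^+ k by exact: le_trans (ler_norm _) en.
rewrite unlock.
have pw : (\int[P]_w ((`|Z n w|%E `^ q)%E) <= (2 * eta `^ q)%:E)%E.
  apply: (@le_trans _ _ (\int[P]_w ((eta `^ q)%:E + (eta `^ q / eta ^+ k)%:E * (S n w ^+ k)%:E))%E).
    apply: ae_ge0_le_integral => //.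
    - by move=> w _; exact: poweR_ge0.
    - apply: (@measurableT_comp _ _ _ _ _ _ (fun x => x `^ q)%E); first exact: measurable_poweR.
      exact: measurableT_comp.
    - by move=> w _; rewrite -EFinM -EFinD lee_fin addr_ge0 ?powR_ge0// mulr_ge0// divr_ge0 ?powR_ge0// ltW.
    - apply: emeasurable_funD => //; apply: emeasurable_funM => //.
      by apply/measurable_EFinP; exact: measurable_funX.
    apply: filterS (ZS n) => w zs _; rewrite gee0_abs//; move: zs (Z0 n w).
    case: (Z n w) => [z| |] //; rewrite ?leye_eq// !lee_fin => zs z0.
    have S0 : 0 <= S n w by exact: le_trans zs.
    have zq : z `^ q <= (S n w) `^ q by apply: powR_mono => //; exact: ltW.
    apply: le_trans zq _; have [Se'|eS] := leP (S n w) eta.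
      apply: le_trans (_ : eta `^ q <= _); first by apply: powR_mono => //; exact: ltW.
      by rewrite lerDl mulr_ge0// divr_ge0 ?powR_ge0// ltW.
    have r1 : 1 <= S n w / eta by rewrite ler_pdivlMr// mul1r ltW.
    have -> : (S n w) `^ q = eta `^ q * (S n w / eta) `^ q.
      have E : S n w = eta * (S n w / eta) by rewrite mulrC divfK ?gt_eqF.
      by rewrite {1}E powRM ?(ltW eta0)// divr_ge0// ltW.
    have rq : (S n w / eta) `^ q <= (S n w / eta) ^+ k.
      by rewrite -powR_mulrn ?(le_trans ler01 r1)//; exact: ler_powR.
    apply: le_trans (ler_wpM2l (powR_ge0 _ _) rq) _.
    by rewrite exprMn exprVn [_ ^+ k / _]mulrC mulrA lerDr powR_ge0.
  have c0 : 0 <= eta `^ q / eta ^+ k by rewrite divr_ge0 ?powR_ge0// ltW.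
  rewrite ge0_integralD//; last 3 first.
  - by move=> w _; rewrite lee_fin powR_ge0.
  - by move=> w _; rewrite -EFinM lee_fin mulr_ge0.
  - by apply: emeasurable_funM => //; apply/measurable_EFinP; exact: measurable_funX.
  rewrite [X in (X + _)%E](_ : _ = (eta `^ q)%:E); last first.
    rewrite integral_cst// -[RHS]mule1; congr (_ * _)%E; exact: probability_setT.
  rewrite ge0_integralZl//; last 2 first.
  - by apply/measurable_EFinP; exact: measurable_funX.
  - by move=> w _; rewrite lee_fin.
  have c0' : (0 <= (eta `^ q / eta ^+ k)%:E)%E by rewrite lee_fin.
  apply: le_trans (leeD (lexx _) (lee_wpmul2l c0' (Se n))) _.
  rewrite -EFinM -EFinD lee_fin mulr_natl mulr2n lerD2l.
  rewrite -mulrA ler_piMr ?powR_ge0// mulrC ler_pdivrMr// mul1r.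
  exact: le_trans en'.
apply: le_trans (_ : ((2 * eta `^ q)%:E `^ q^-1 <= _)%E).
  apply: gt0_ler_poweR => //; rewrite ?in_itv/= ?invr_ge0 ?(ltW q0)// ?andbT ?leey ?andbT.
  - by apply: integral_ge0 => w _; exact: poweR_ge0.
  - by rewrite lee_fin mulr_ge0// powR_ge0.
rewrite poweR_EFin lee_fin powRM ?powR_ge0// -powRrM divff ?gt_eqF// powRr1 ?(ltW eta0)//.
have h2 : 2 `^ q^-1 <= 2 :> R.
  rewrite -[leRHS]powRr1//; apply: ler_powR; first by rewrite ler1n.
  by rewrite invf_le1.
by apply: le_trans (ler_wpM2r (ltW eta0) h2) _; rewrite /eta mulrC divfK.
Qed.

Lemma cvg_powRN (e : R) : 0 < e -> (n.+1%:R : R) `^ (- e) @[n --> \oo] --> 0.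
Proof.
move=> e0; apply/cvgrPdist_le => dl dl0.
have [M _ hM] := nbhs_infty_ger (dl^-1 `^ e^-1 : R).
exists M => // n /= Mn; rewrite sub0r normrN ger0_norm ?powR_ge0// powRN.
have n0 : 0 < n.+1%:R :> R by rewrite ltr0n.
rewrite -[leRHS]invrK lef_pV2 ?posrE ?invr_gt0 ?powR_gt0//.
have -> : dl^-1 = (dl^-1 `^ e^-1) `^ e.
  by rewrite -powRrM mulVf ?gt_eqF// powRr1// invr_ge0 ltW.
apply: powR_mono; rewrite ?powR_ge0//.
by apply: le_trans (hM n Mn) _; rewrite ler_nat.
Qed.

End LqConvergence.

Lemma large_exponent {R : realType} (e q : R) : 0 < e ->
  exists k, 1 < e * (2 * k.+1)%:R /\ q <= (2 * k.+1)%:R.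
Proof.
move=> e0; pose M := Num.max q e^-1; exists (Num.truncn M).
have h : M <= (2 * (Num.truncn M).+1)%:R.
  apply: (@le_trans _ _ (Num.truncn M).+1%:R); first exact/ltW/truncnS_gt.
  by rewrite ler_nat leq_pmull.
have h' : e^-1 < (2 * (Num.truncn M).+1)%:R.
  apply: (@lt_le_trans _ _ (Num.truncn M).+1%:R); last by rewrite ler_nat leq_pmull.
  by apply: le_lt_trans (truncnS_gt M); rewrite le_max lexx orbT.
split; last by apply: le_trans h; rewrite le_max lexx.
by rewrite mulrC -ltr_pdivrMr// div1r.
Qed.

Unset Implicit Arguments.

Theorem theorem3p1 (R : realType) (d : nat) (hd : (1 <= d)%N)
    (H : R) (hH_gt : 4^-1 < H) (hH_le : H <= 2^-1)
    (disp : measure_display) (T : measurableType disp) (P : probability T R)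
    (X : 'I_d -> R -> {RV P >-> R})
    (hX : forall i, fbm H (X i))
    (hX_indep : independent_processes P X)
    (A : T -> R -> R -> 'M[R]_(d + d))
    (hA : canonical_levy_area P (fun w => diag_path (vec_path X w)) A)
    (Nv : 'rV[R]_(d + d) -> R) (hNv : is_norm Nv)
    (Nm : 'M[R]_(d + d) -> R) (hNm : is_norm Nm)
    (alpha : R) (halpha_ge : 0 <= alpha) (halpha_lt : alpha < H)
    (q : R) (hq : 1 <= q) :
  let x := vec_path X in
  let xt := fun w => diag_path (x w) in
  let xn := fun n w => lead_lag n (x w) in
  let An := fun n w => levy_area (xn n w) in
  let vn := fun n => lead_lag_renorm P n x in
  cvg0_Lq P q (fun n w =>
    rp_holder_dist Nv Nm alpha
      (translate (vn n.+1) (lift2 (xn n.+1 w) (An n.+1 w)))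
      (lift2 (xt w) (A w))) /\
  cvg0_Lq P q (fun n w =>
    (holder_sup Nv alpha
       (fun s t => (incr (xn n.+1 w) s t - incr (xt w) s t)%R)
     + holder_sup Nm (2 * alpha)%R
       (fun s t => (An n.+1 w s t + (t - s) *: vn n.+1 - A w s t)%R))%E).
Proof.
move=> x xt xn An vn.
set Z2 := (Z in _ /\ cvg0_Lq _ _ Z).
suff cZ : cvg0_Lq P q Z2.
  split=> //; rewrite (_ : (fun n w => _) = Z2)//.
  apply/funext => n; apply/funext => w; rewrite /Z2 /rp_holder_dist; congr (_ + _)%E.
  congr (holder_sup _ _ _); apply/funext => s; apply/funext => t.
  rewrite translate_lift2 /lift2 /log2 /exp2 /= !addrK.
  by [].
pose a := (Num.max alpha 4^-1 + H) / 2; pose b := (a + H) / 2.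
have mxH : Num.max alpha 4^-1 < H by rewrite gt_max halpha_lt.
have mx1 : alpha <= Num.max alpha 4^-1 by rewrite le_max lexx.
have mx2 : 4^-1 <= Num.max alpha 4^-1 by rewrite le_max lexx orbT.
have aH : a < H by rewrite /a; lra.
have a4 : 4^-1 < a by rewrite /a; lra.
have ala : alpha <= a by rewrite /a; lra.
have ab : a < b by rewrite /b; lra.
have bH : b < H by rewrite /b; lra.
have Hb : 0 < H - b by rewrite subr_gt0.
have [k [k1 kq]] := large_exponent q Hb.
set m := (2 * k.+1)%N in k1 kq.
pose S n := error_norm X H A a b k n.+1.
pose C := norm_cst Nv + norm_cst Nm.
have Cv0 : 0 <= norm_cst Nv by exact: norm_cst_ge0.
have Cm0 : 0 <= norm_cst Nm by exact: norm_cst_ge0.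
have mB (u v : 'rV[R]_(d + d)) i j : (u - v) i j = u i j - v i j by rewrite !mxE.
have mZ n : measurable_fun [set: T] (Z2 n).
  apply: emeasurable_funD.
    apply: measurable_holder_sup => // [s t i j s0 st t1|w s t i j s0 st t1].
      have t0 : 0 <= t by exact: le_trans st.
      have s1 : s <= 1 by exact: le_trans t1.
      rewrite (_ : (fun w => _) = (fun w => (xn n.+1 w t 0 j - xn n.+1 w s 0 j) -
          (X (component j) t w - X (component j) s w))); last first.
        by apply/funext => w; rewrite ord1 /incr !mB /xt /x !vec_path_diagE.
      apply: measurable_funB; last exact: measurable_funB.
      by apply: measurable_funB; exact: lead_lag_measurable.
    have t0 : 0 <= t by rewrite (le_trans s0)// ltW.
    have s1 : s <= 1 by rewrite (le_trans _ t1)// ltW.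
    have e u v : (incr (xn n.+1 w) u v - incr (xt w) u v) i j =
        (xn n.+1 w v 0 j - xn n.+1 w u 0 j) - (X (component j) v w - X (component j) u w).
      by rewrite ord1 /incr !mB /xt /x !vec_path_diagE.
    rewrite e; under eq_cvg do rewrite e.
    have aff : pwaffine (xn n.+1 w) 0 1 by exact: lead_lag_pwaffine.
    apply: cvgB; apply: cvgB; (exact: pwaffine_dyadic_cvg || exact: (fbm_dyadic_cvg hX)).
  apply: measurable_holder_sup => // [s t i j s0 st t1|w s t i j s0 st t1].
    rewrite (_ : (fun w => _) = (fun w => An n.+1 w s t i j + (t - s) * vn n.+1 i j - A w s t i j));
      last by apply/funext => w; rewrite !mxE.
    apply: measurable_funB; last exact: (area_measurable hA).
    by apply: measurable_funD => //; exact: lead_lag_area_measurable.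
  have st' := ltW st.
  have t0 : 0 <= t by exact: le_trans st'.
  have e u v : (An n.+1 w u v + (v - u) *: vn n.+1 - A w u v) i j =
    An n.+1 w u v i j + (v - u) * vn n.+1 i j - A w u v i j by rewrite !mxE.
  rewrite e; under eq_cvg do rewrite e.
  have aff : pwaffine (xn n.+1 w) 0 1 by exact: lead_lag_pwaffine.
  apply: cvgB; last exact: (area_dyadic_cvg hA).
  apply: cvgD; first exact: levy_area_dyadic_cvg.
  apply: cvgM; last exact: cvg_cst.
  by apply: cvgB; exact: cvg_dyadic_floor.
split=> //.
have [K K0 SK] := error_norm_moment hH_gt hH_le hX hX_indep hA a4 ab k1.
pose e n := C ^+ m * (K * ((n.+1%:R `^ (- (b - a))) ^+ m +
   n.+1%:R ^+ 2 * (n.+1%:R `^ (- (4 * (H - a)))) ^+ k.+1)).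
have C0 : 0 <= C by exact: addr_ge0.
have mS n : measurable_fun [set: T] (S n) by exact: (error_norm_measurable hX hA).
have even_ge0 (z : R) : 0 <= z ^+ m by rewrite exprM exprn_ge0// sqr_ge0.
apply: (cvg_Lnorm_dominated (S := fun n w => C * S n w) (e := e) (k := m)) => //.
- by rewrite /m mul2n odd_double.
- by move=> n; exact: measurable_funM.
- by move=> n w; rewrite adde_ge0// holder_sup_ge0.
- move=> n; have := canonical_area_chen hX hA.
  apply: filterS2 (ae_path_modulus_fin hH_gt hH_le hX hX_indep hA k1) => w w_fin w_chen.
  have S0 : 0 <= S n w by exact: (error_norm_ge0 H a4 ab w_fin).
  rewrite /C mulrDl EFinD; apply: leeD.
    apply: (@holder_sup_le _ _ _ _ _ _ a) => // s t i j s0 st t1.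
    rewrite ord1 /incr !mB /xt /x !vec_path_diagE.
    have := increment_error hH_le hX a4 ab bH w_fin (ltn0Sn n) j s0 st t1.
    by rewrite !mxE.
  apply: (@holder_sup_le _ _ _ _ _ _ (2 * a)) => //; first by rewrite ler_pM2l.
  move=> s t i j s0 st t1; rewrite !mxE.
  by have := area_error_norm hH_gt hH_le hX hX_indep hA a4 ab bH w_fin w_chen (ltn0Sn n) i j s0 st t1; rewrite /area_error !mxE.
- move=> n; under eq_integral do rewrite exprMn EFinM.
  have Cm : (0 <= (C ^+ m)%:E)%E by rewrite lee_fin.
  rewrite ge0_integralZl//; last 2 first.
  + by apply/measurable_EFinP; exact: measurable_funX.
  + by move=> w _; rewrite lee_fin.
  apply: le_trans (lee_wpmul2l Cm (SK n.+1 (ltn0Sn n))) _.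
  by rewrite -EFinM.
- pose e1 := (b - a) * m%:R; pose e2 := 2 * ((H - a) * m%:R - 1).
  have e10 : 0 < e1 by rewrite mulr_gt0 ?subr_gt0// ltr0n.
  have e20 : 0 < e2.
    rewrite mulr_gt0// subr_gt0; apply: lt_trans k1 _.
    by rewrite ltr_pM2r ?ltr0n// ltrD2l ltrN2.
  have eE n : e n = C ^+ m * (K * (n.+1%:R `^ (- e1) + n.+1%:R `^ (- e2))).
    have n0 : 0 < n.+1%:R :> R by rewrite ltr0n.
    congr (_ * (_ * (_ + _))).
      by rewrite -powR_mulrn ?powR_ge0// -powRrM mulNr.
    rewrite -!powR_mulrn ?powR_ge0 ?ler0n// -powRrM -powR_split//; congr (_ `^ _).
    by rewrite /e2 /m natrM; ring.
  rewrite (_ : e = fun n => C ^+ m * (K * (n.+1%:R `^ (- e1) + n.+1%:R `^ (- e2)))); last exact/funext.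
  rewrite -(mulr0 (C ^+ m)) -(mulr0 K) -(addr0 (0 : R)).
  apply: cvgM; first exact: cvg_cst.
  apply: cvgM; first exact: cvg_cst.
  by apply: cvgD; exact: cvg_powRN.
Qed.
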